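(* Let $u(\cdot)\in L_\infty(\Omega,dx)$, $u_{\partial_i}(\cdot)\in L_\infty(\partial\Omega_i,d\sigma)$, $i=1,\dots,n_{\mathrm b}$ (with values in $\mathbb R^{n_u}$ and $\mathbb R^{n_{u_i}}$ respectively), and let $y(\cdot)\in W^{k,\infty}(\Omega^{\mathsf o};\mathbf Y)\cap C(\Omega;\mathbf Y)$ ($k=1$ if $B_{i,j}=0$, $k=2$ otherwise) satisfy $$F(x,y(x),\mathcal D y(x))+\sum_{i\le j}B_{i,j}(x,y(x))\frac{\partial^2y}{\partial x_i\partial x_j}=C(x,y(x))u(x),\quad x\in\Omega,$$ $$G_i(x,y(x),\mathcal D y(x))=C_{\partial_i}(x,y(x))u_{\partial_i}(x),\quad x\in\partial\Omega_i,\ i=1,\dots,n_{\mathrm b},$$ almost everywhere with respect to the Lebesgue measure on $\Omega^{\mathsf o}$ respectively the surface measure $\sigma$ on $\partial\Omega$. Let $\mu$ and $\mu_\partial$ be the occupation and boundary measures of $y(\cdot)$ and let $\nu$, $\nu_{\partial_i}$ be the control measures $d\nu=u\,d\bar\mu$, $d\nu_{\partial_i}=u_{\partial_i}\,d\bar\mu_{\partial_i}$ (see context). Then for all $\phi\in C^\infty(\Omega\times\mathbf Y)$: (a) for all $m\in\{1,\dots,n\}$, $$\int_{\Omega\times\mathbf Y\times\mathbf Z}\Big[\frac{\partial\phi}{\partial x_m}+\sum_{l=1}^{n_y}\frac{\partial\phi}{\partial y_l}z_{l,m}\Big]d\mu(x,y,z)-\int_{\partial\Omega\times\mathbf Y\times\mathbf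 Z}\phi(x,y)\,\eta_m(x)\,d\mu_\partial(x,y,z)=0;$$ (b) $$\int_{\Omega\times\mathbf Y\times\mathbf Z}\phi F\,d\mu-\sum_{i\le j}\int_{\Omega\times\mathbf Y\times\mathbf Z}\phi\Big[\frac{\partial B_{i,j}}{\partial x_j}+\sum_{l=1}^{n_y}\frac{\partial B_{i,j}}{\partial y_l}z_{l,j}\Big]z_{\bullet,i}\,d\mu-\sum_{i\le j}\int_{\Omega\times\mathbf Y\times\mathbf Z}\Big[\frac{\partial\phi}{\partial x_j}+\sum_{l=1}^{n_y}\frac{\partial\phi}{\partial y_l}z_{l,j}\Big]B_{i,j}z_{\bullet,i}\,d\mu$$ $$+\sum_{i\le j}\int_{\partial\Omega\times\mathbf Y\times\mathbf Z}B_{i,j}\,\phi\,z_{\bullet,i}\,\eta_j\,d\mu_\partial=\sum_{r=1}^{n_u}\int_{\Omega\times\mathbf Y}C_{\bullet,r}(x,y)\phi(x,y)\,d\nu^r(x,y);$$ (c) $$\int_{\partial\Omega\times\mathbf Y\times\mathbf Z}\phi(x,y)G(x,y,z)\,d\mu_\partial(x,y,z)=\sum_{i=1}^{n_{\mathrm b}}\sum_{r=1}^{n_{u_i}}\int_{\partial\Omega_i\times\mathbf Y}C^i_{\bullet,r}(x,y)\phi(x,y)\,d\nu^r_{\partial_i}(x,y),$$ where $G(x,y,z)=G_i(x,y,z)$ for $x\in\partial\Omega_i$. Here $z_{\bullet,i}$ is the $i$-th column of $z\in\mathbb R^{n_y\times n}$, $C_{\bullet,r}$ and $C^i_{\bullet,r}$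 are the $r$-th columns of $C$ and $C_{\partial_i}$, and $\nu^r$, $\nu^r_{\partial_i}$ are the $r$-th components of the vector measures $\nu$, $\nu_{\partial_i}$.
   Context: **Domain.** $\Omega=\{x\in\mathbb R^n\mid g^\Omega_i(x)\ge 0,\ i=1,\dots,n^\Omega\}$ is a compact basic semialgebraic set ($g_i^\Omega$ polynomials), equal to the closure of its interior $\Omega^{\mathsf o}$, with (locally) Lipschitz boundary $\partial\Omega$. $\sigma$ is the surface measure on $\partial\Omega$ and $\eta=(\eta_1,\dots,\eta_n)$ the outward unit normal, so that $\int_{\partial\Omega}h\,\eta_m\,d\sigma=\int_\Omega\frac{\partial h}{\partial x_m}\,dx$ for all $h\in W^{1,\infty}(\Omega^{\mathsf o})$. $\partial\Omega=\bigcup_{i=1}^{n_{\mathrm b}}\partial\Omega_i$ with each $\partial\Omega_i$ basic semialgebraic and smooth, the pieces being disjoint up to sets of zero $\sigma$-measure. **Data.** $F$ is a polynomial map of $(x,y,z)\in\mathbb R^n\times\mathbb R^{n_y}\times\mathbb R^{n_y\times n}$ with values in $\mathbb R^{n_F}$; $B_{i,j}(x,y)\in\mathbb R^{n_F\times n_y}$ ($1\le i\le j\le n$), $C(x,y)\in\mathbb R^{n_F\times n_u}$ and $C_{\partial_i}(x,y)\in\mathbb R^{n_{G_i}\times n_{u_i}}$ have polynomial entries in $(x,y)$; $G_i(x,y,z)\in\mathbb R^{n_{G_i}}$ are polynomial maps. **Notation.** $\mathcal D y$ is the weak Jacobian, $(\mathcal D y)_{l,m}=\partial y_l/\partial x_m$,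 and $\frac{\partial^2 y}{\partial x_i\partial x_j}$ is the vector of second weak derivatives of the components of $y$. $\mathbf Y\subset\mathbb R^{n_y}$ and $\mathbf Z\subset\mathbb R^{n_y\times n}$ are basic semialgebraic sets; it is a standing assumption that $y(x)\in\mathbf Y$ and $\mathcal D y(x)\in\mathbf Z$. **Measures.** The occupation measure $\mu$ on $\Omega\times\mathbf Y\times\mathbf Z$ is $\mu(A\times B\times E)=\int_\Omega\mathbb I_{A\times B\times E}(x,y(x),\mathcal D y(x))\,dx$ for Borel $A\subset\Omega$, $B\subset\mathbf Y$, $E\subset\mathbf Z$; the boundary measure $\mu_\partial$ on $\partial\Omega\times\mathbf Y\times\mathbf Z$ is $\mu_\partial(A\times B\times E)=\int_{\partial\Omega}\mathbb I_{A\times B\times E}(x,y(x),\mathcal D y(x))\,d\sigma(x)$ for Borel $A\subset\partial\Omega$, $B\subset\mathbf Y$, $E\subset\mathbf Z$ ($\mathbb I$ denotes the indicator function). It is decomposed as $\mu_\partial=\sum_{i=1}^{n_{\mathrm b}}\mu_{\partial_i}$ with $\mu_{\partial_i}$ a nonnegative measure supported on $\partial\Omega_i\times\mathbf Y\times\mathbf Z$. $\bar\mu$, $\bar\mu_{\partial_i}$ are the $(x,y)$-marginals of $\mu$, $\mu_{\partial_i}$. The control measures $\nu$ (on $\Omega\times\mathbf Y$, with $n_u$ components) and $\nu_{\partial_i}$ (on $\partial\Omega_i\times\mathbf Y$, with $n_{u_i}$ components) are the vector measures with densities $u$ and $u_{\partial_i}$ with respect to $\bar\mu$ and $\bar\mu_{\partial_i}$.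 In the underlying control problem the controls are constrained to $u(x)\in[0,1]^{n_u}$, $u_{\partial_i}(x)\in[0,1]^{n_{u_i}}$, so that these are vectors of nonnegative measures. *)

(* Defs.v *)
From HB Require Import structures.
From mathcomp Require Import all_boot all_order all_algebra.
From mathcomp Require Import all_classical all_reals all_analysis.
From mathcomp Require Import measurable_realfun.
From mathcomp Require mpoly.

Set Implicit Arguments.
Unset Strict Implicit.
Unset Printing Implicit Defensive.

Import Order.TTheory GRing.Theory Num.Theory.
Import numFieldNormedType.Exports.

Local Open Scope classical_set_scope.
Local Open Scope ring_scope.

Section borel_matrix.
Context {R : realType} {m n : nat}.

HB.instance Definition _ := @isMeasurable.Build
  (sigma_display (@open 'M[R]_(m, n))) 'M[R]_(m, n)
  <<s @open 'M[R]_(m, n) >> (@sigma_algebra0 _ setT _)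
  (@sigma_algebraC _ _) (@sigma_algebra_bigcup _ setT _).

Lemma measurable_fun_mx d (T : measurableType d) (f : T -> 'M[R]_(m, n)) :
  (forall i j, measurable_fun setT (fun x => f x i j)) -> measurable_fun setT f.
Proof.
move=> mf; apply: (@measurability _ _ _ _ _ _ (@open 'M[R]_(m, n))) => //.
move=> _ [U oU <-]; rewrite setTI.
pose box (qk : 'M[rat]_(m, n) * nat) : set 'M[R]_(m, n) :=
  [set x | forall i j, `|x i j - ratr (qk.1 i j)| < qk.2.+1%:R^-1].
pose F qk : set T := if `[< box qk `<=` U >] then f @^-1` box qk else set0.
have mF qk : measurable (F qk).
  rewrite /F; case: ifP => // _.
  have -> : f @^-1` box qk = \bigcap_(i in [set: 'I_m]) \bigcap_(j in [set: 'I_n])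
      (fun x => `|f x i j - ratr (qk.1 i j)|) @^-1` `]-oo, qk.2.+1%:R^-1[.
    apply/seteqP; split => x /= h.
      by move=> i _ j _; rewrite /= in_itv/=; exact: h.
    by move=> i j; have := h i Logic.I j Logic.I; rewrite /= in_itv.
  apply: fin_bigcap_measurable => // i _; apply: fin_bigcap_measurable => // j _.
  rewrite -[X in measurable X]setTI.
  suff : measurable_fun setT (fun x => `|f x i j - ratr (qk.1 i j)|).
    by apply => //; exact: measurable_itv.
  apply: measurableT_comp => //; apply: measurable_funB => //.
suff -> : f @^-1` U = \bigcup_qk F qk by exact: countable_bigcupT_measurable.
apply/seteqP; split => [x Ux|x [qk _]]; last first.
  by rewrite /F; case: asboolP => // h; apply: h.
have /nbhs_ballP[e /= e0 eU] : nbhs (f x) U by exact: open_nbhs_nbhs.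
have [k ke] : exists k : nat, k.+1%:R^-1 < e / 2.
  by have [k _ /(_ k (leqnn k))] := near_infty_natSinv_lt (PosNum (divr_gt0 e0 (ltr0n R 2)));
     exists k.
have k0 : (0 : R) < k.+1%:R^-1 by rewrite invr_gt0.
have /fin_all_exists2 : forall ij : 'I_m * 'I_n, exists2 q : rat, True &
    `|f x ij.1 ij.2 - ratr q| < k.+1%:R^-1.
  move=> ij; have : f x ij.1 ij.2 - k.+1%:R^-1 < f x ij.1 ij.2 + k.+1%:R^-1.
    by rewrite ltrBlDr -addrA ltrDl addr_gt0.
  move=> /rat_in_itvoo[q /[!in_itv]/= /andP[q1 q2]]; exists q => //.
  by rewrite ltr_distlC ltrBlDr -ltrBlDr q1 q2.
move=> [q _ qE].
exists (\matrix_(i, j) q (i, j), k) => //.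
rewrite /F ifT; first by move=> i j; rewrite /= mxE; exact: (qE (i, j)).
apply/asboolP => z zb; apply: eU; split => // i j.
have := zb i j; have := qE (i, j); rewrite /= mxE => h1 h2.
rewrite /ball/= (le_lt_trans (ler_distD (ratr (q (i, j))) _ _))//.
rewrite (splitr e) ltrD//; first exact: lt_trans h1 _.
by rewrite distrC; exact: lt_trans h2 _.
Qed.

Lemma measurable_coord_mx i j :
  measurable_fun setT (fun M : 'M[R]_(m, n) => M i j).
Proof.
apply: (measurability _ (RGenOpens.measurableE R)) => _ [_ [a [b ->] <-]].
rewrite setTI; apply: sub_sigma_algebra.
by move/continuousP : (@coord_continuous R m n i j); apply; exact: interval_open.
Qed.

End borel_matrix.

Section lebesgue_rV.
Context {R : realType}.

Definition cons_rV n (p : R * 'rV[R]_n) : 'rV[R]_n.+1 :=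
  \row_j if unlift ord0 j is Some k then p.2 0 k else p.1.

Definition uncons_rV n (v : 'rV[R]_n.+1) : R * 'rV[R]_n :=
  (v 0 0, \row_k v 0 (lift ord0 k)).

Lemma measurable_cons_rV n : measurable_fun setT (@cons_rV n).
Proof.
apply: measurable_fun_mx => i j; under eq_fun do rewrite mxE.
case: (unlift ord0 j) => [k|]; last exact: measurable_fst.
exact: (measurableT_comp (measurable_coord_mx 0 k) measurable_snd).
Qed.

Lemma measurable_uncons_rV n : measurable_fun setT (@uncons_rV n).
Proof.
apply/measurable_fun_pair; first exact: measurable_coord_mx.
apply: measurable_fun_mx => i j; under eq_fun do rewrite mxE.
exact: measurable_coord_mx.
Qed.

Definition uncons_rVK n : cancel (@uncons_rV n) (@cons_rV n).
Proof.
move=> v; apply/rowP => j; rewrite mxE; case: unliftP => [k|] -> //=.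
by rewrite mxE.
Qed.

Lemma cons_rVK n : cancel (@cons_rV n) (@uncons_rV n).
Proof.
move=> [a v]; rewrite /uncons_rV mxE unlift_none; congr pair.
by apply/rowP => j; rewrite !mxE liftK.
Qed.

Section step.
Context n (leb : {sigma_finite_measure set 'rV[R]_n -> \bar R}).

Definition lebesgue_step : set 'rV[R]_n.+1 -> \bar R :=
  pushforward (@lebesgue_measure R \x leb)%E (@cons_rV n).

HB.instance Definition _ := Measure.copy lebesgue_step
  (measure_function_pushforward__canonical__measure_function_Measure
    (@lebesgue_measure R \x leb)%E (@measurable_cons_rV n)).

Let sigma_finite_lebesgue_step : sigma_finite setT lebesgue_step.
Proof.
have /sigma_finiteP[F [FT ndF Foo]] := sigma_finiteT (@lebesgue_measure R).
have /sigma_finiteP[G [GT ndG Goo]] := sigma_finiteT leb.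
exists (fun k => @uncons_rV n @^-1` (F k `*` G k)) => [|k].
  apply/esym; rewrite -subTset => v _.
  have [k _ Fk] : (\bigcup_k F k) (uncons_rV v).1 by rewrite -FT.
  have [l _ Gl] : (\bigcup_k G k) (uncons_rV v).2 by rewrite -GT.
  exists (maxn k l) => //; split.
    by move: Fk; exact/subsetPset/ndF/leq_maxl.
  by move: Gl; exact/subsetPset/ndG/leq_maxr.
have [mF Fk] := Foo k; have [mG Gk] := Goo k; split.
  by rewrite -[X in measurable X]setTI; apply: measurable_uncons_rV => //;
     exact: measurableX.
rewrite /lebesgue_step /pushforward (_ : _ @^-1` _ = F k `*` G k).
  by rewrite product_measure1E// lte_mul_pinfty// ge0_fin_numE.
rewrite -comp_preimage (_ : _ \o _ = id) ?preimage_id//.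
by apply/funext => p; exact: cons_rVK.
Qed.

HB.instance Definition _ := Measure_isSigmaFinite.Build _ _ _
  lebesgue_step sigma_finite_lebesgue_step.

End step.

Fixpoint lebesgue_rV n : {sigma_finite_measure set 'rV[R]_n -> \bar R} :=
  if n is n'.+1 then lebesgue_step (lebesgue_rV n') else \d_(0 : 'rV[R]_0).

End lebesgue_rV.

Section euclidean_geometry.
Context {R : realType} {n : nat}.
Implicit Types (x y e : 'rV[R]_n) (S : set 'rV[R]_n).

Definition dotp x y : R := \sum_i x 0 i * y 0 i.

(* The norm of the normed module 'rV[R]_n is the maximum norm. *)
Definition enorm x : R := Num.sqrt (dotp x x).

Definition boundary S : set 'rV[R]_n := closure S `\` S°.

(* Near each of its boundary points, S is the epigraph, in the direction of a
   unit vector e, of a Lipschitz function g of the component orthogonal to e. *)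
Definition lipschitz_boundary S : Prop :=
  forall p, boundary S p ->
  exists (e : 'rV[R]_n) (g : 'rV[R]_n -> R) (L : R),
    [/\ enorm e = 1,
        forall a b, `|g a - g b| <= L * enorm (a - b) &
        \forall x \near p, S x <-> g (x - dotp x e *: e) <= dotp x e].

(* The tangent cone of S at x is the half-space of the v with <v, nu> <= 0, and
   that of its complement the opposite half-space; at a point of the graph of a
   Lipschitz function this amounts to the differentiability of that function. *)
Definition outward_unit_normal S x (nu : 'rV[R]_n) : Prop :=
  enorm nu = 1 /\
  forall eps : R, 0 < eps -> \forall z \near x,
    (S z -> dotp (z - x) nu <= eps * enorm (z - x)) /\
    (~ S z -> - (eps * enorm (z - x)) <= dotp (z - x) nu).

Definition diameter S : \bar R :=
  ereal_sup [set (enorm (x - y))%:E | x in S & y in S].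

End euclidean_geometry.

Section hausdorff_measure.
Context {R : realType}.

(* Volume of the Euclidean unit ball of R^k, by the classical two-step
   recursion omega_(k+2) = 2 pi / (k + 2) * omega_k. *)
Fixpoint ball_volume (k : nat) : R :=
  match k with
  | 0 => 1
  | 1 => 2
  | k'.+2 => 2 * pi / k'.+2%:R * ball_volume k'
  end.

(* The empty set has weight 0 and a nonempty set has weight 1 for k = 0, so that
   the 0-dimensional Hausdorff measure is the counting measure. *)
Definition hausdorff_weight n (k : nat) (S : set 'rV[R]_n) : \bar R :=
  if pselect (S !=set0) then (ball_volume k * (fine (diameter S) / 2) ^+ k)%:E
  else 0%E.

Definition hausdorff_premeasure n (k : nat) (delta : R) (S : set 'rV[R]_n) :=
  ereal_inf [set (\sum_(0 <= i <oo) hausdorff_weight k (F i))%E | F in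
    [set F : nat -> set 'rV[R]_n | S `<=` \bigcup_i F i /\
      forall i, (diameter (F i) <= delta%:E)%E]].

Definition hausdorff_measure n (k : nat) (S : set 'rV[R]_n) : \bar R :=
  ereal_sup [set hausdorff_premeasure k delta S | delta in [set d : R | 0 < d]].

Definition is_surface_measure n (S : set 'rV[R]_n)
    (sigma : {finite_measure set 'rV[R]_n -> \bar R}) : Prop :=
  forall A : set 'rV[R]_n, measurable A ->
    sigma A = hausdorff_measure n.-1 (A `&` boundary S).

End hausdorff_measure.

Section smooth_functions.
Context {R : realType}.

Fixpoint Ck (V : normedModType R) (k : nat) (f : V -> R) : Prop :=
  continuous f /\
  if k is k'.+1 then
    forall v, (forall x, derivable f x v) /\ Ck k' (fun x => 'D_v f x)
  else True.

Definition smooth (V : normedModType R) (f : V -> R) : Prop :=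
  forall k, Ck k f.

Definition test_function n (U : set 'rV[R]_n) (psi : 'rV[R]_n -> R) : Prop :=
  smooth psi /\
  exists K, [/\ compact K, K `<=` U & forall x, ~ K x -> psi x = 0].

(* S is locally contained in a smooth hypersurface; the piece may have an edge,
   as a face of a polytope does. *)
Definition smooth_piece n (S : set 'rV[R]_n) : Prop :=
  forall p, S p -> exists rho : 'rV[R]_n -> R,
    [/\ smooth rho, exists m, 'D_('e_m) rho p != 0 &
        \forall x \near p, S x -> rho x = 0].

End smooth_functions.

Section polynomial_maps.
Context {R : realType}.

Definition basic_semialgebraic N (S : set 'rV[R]_N) : Prop :=
  exists (k : nat) (g : 'I_k -> mpoly.mpoly N R),
    S = [set x | forall i, 0 <= mpoly.meval (x 0) (g i)].

Definition polynomial_xy n ny (f : 'rV[R]_n * 'rV[R]_ny -> R) : Prop :=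
  exists p : mpoly.mpoly (n + ny) R,
    forall q, f q = mpoly.meval (row_mx q.1 q.2 0) p.

Definition polynomial_xyz n ny
    (f : 'rV[R]_n * 'rV[R]_ny * 'M[R]_(ny, n) -> R) : Prop :=
  exists p : mpoly.mpoly (n + ny + ny * n) R,
    forall q, f q = mpoly.meval (row_mx (row_mx q.1.1 q.1.2) (mxvec q.2) 0) p.

End polynomial_maps.

Section sobolev.
Context {R : realType}.

Definition Linfty d (T : measurableType d) (mu : {measure set T -> \bar R})
    (A : set T) (f : T -> R) : Prop :=
  measurable_fun A f /\ exists M, {ae mu, forall x, A x -> `|f x| <= M}.

Variable n : nat.
Implicit Types (U : set 'rV[R]_n) (f g : 'rV[R]_n -> R).
Local Notation leb := (@lebesgue_rV R n).

Definition loc_integrable U f : Prop :=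
  measurable_fun U f /\
  forall K, compact K -> K `<=` U -> leb.-integrable K (EFin \o f).

Definition weak_partial U (m : 'I_n) f g : Prop :=
  [/\ loc_integrable U f, loc_integrable U g &
      forall psi, test_function U psi ->
        \int[leb]_(x in U) (f x * 'D_('e_m) psi x) =
        - \int[leb]_(x in U) (g x * psi x)].

Fixpoint Wkinfty (k : nat) U f : Prop :=
  Linfty leb U f /\
  if k is k'.+1 then forall m, exists g, weak_partial U m f g /\ Wkinfty k' U g
  else True.

(* The values of f on the boundary of S are the trace of f : the restriction to
   the boundary of the continuous representative on S of the class of f (such
   a representative exists if f is in W^{1,oo} and S has Lipschitz boundary). *)
Definition has_trace S (sigma : {measure set 'rV[R]_n -> \bar R}) f : Prop :=
  exists h : 'rV[R]_n -> R,
    [/\ {within S, continuous h},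
        {ae leb, forall x, S° x -> f x = h x} &
        {ae sigma, forall x, boundary S x -> f x = h x}].

(* A function of W^{1,oo} enters through its continuous representative, whose
   boundary values are its trace. *)
Definition divergence_formula S (sigma : {measure set 'rV[R]_n -> \bar R})
    (eta : 'rV[R]_n -> 'rV[R]_n) : Prop :=
  forall h m g, {within S, continuous h} -> Wkinfty 1 S° h ->
    weak_partial S° m h g -> Linfty leb S g ->
    \int[sigma]_(x in boundary S) (h x * eta x 0 m) = \int[leb]_(x in S) g x.

End sobolev.

Section occupation_measures.
Context {R : realType} {n ny : nat}.
Local Notation X := 'rV[R]_n.
Local Notation XY := ('rV[R]_n * 'rV[R]_ny)%type.
Local Notation XYZ := ('rV[R]_n * 'rV[R]_ny * 'M[R]_(ny, n))%type.

Definition is_occupation_measure (lambda : {measure set X -> \bar R})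
    (S : set X) (Y : set 'rV[R]_ny) (Z : set 'M[R]_(ny, n))
    (y : X -> 'rV[R]_ny) (Dy : X -> 'M[R]_(ny, n))
    (mu : {measure set XYZ -> \bar R}) : Prop :=
  mu (~` (S `*` Y `*` Z)) = 0%E /\
  forall A B E, measurable A -> measurable B -> measurable E ->
    A `<=` S -> B `<=` Y -> E `<=` Z ->
    mu (A `*` B `*` E) =
    (\int[lambda]_(x in S) (\1_(A `*` B `*` E) (x, y x, Dy x))%:E)%E.

Definition xy_marginal (mu : {measure set XYZ -> \bar R}) : set XY -> \bar R :=
  pushforward mu fst.

HB.instance Definition _ (mu : {measure set XYZ -> \bar R}) :=
  Measure.copy (xy_marginal mu)
    (measure_function_pushforward__canonical__measure_function_Measure
       mu measurable_fst).

Definition has_density d (T : measurableType d)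
    (nu : {charge set T -> \bar R}) (mu : {measure set T -> \bar R})
    (D : set T) (f : T -> R) : Prop :=
  forall A, measurable A -> nu A = (\int[mu]_(p in A `&` D) (f p)%:E)%E.

Definition total_partial (V : normedModType R) (f : XY -> V) (m : 'I_n)
    (p : XYZ) : V :=
  'D_('e_m, 0 : 'rV[R]_ny) f p.1 +
  \sum_(l < ny) p.2 l m *: 'D_(0 : X, 'e_l) f p.1.

End occupation_measures.

Section vector_integrals.
Context {R : realType} d {T : measurableType d} {k : nat}.

Definition vintegral (mu : {measure set T -> \bar R}) (D : set T)
    (f : T -> 'cV[R]_k) : 'cV[R]_k :=
  \col_a \int[mu]_(p in D) f p a 0.

Lemma ex_hahn (nu : {charge set T -> \bar R}) :
  exists PN : set T * set T, hahn_decomposition nu PN.1 PN.2.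
Proof. by have [P [N PN]] := Hahn_decomposition nu; exists (P, N). Qed.

Definition vintegral_charge (nu : {charge set T -> \bar R}) (D : set T)
    (f : T -> 'cV[R]_k) : 'cV[R]_k :=
  let PN := svalP (cid (ex_hahn nu)) in
  vintegral (jordan_pos PN) D f - vintegral (jordan_neg PN) D f.

End vector_integrals.

(* A point of several of the S i is assigned the value for the least such i. *)
Definition piecewise T (V : nmodType) k (S : 'I_k -> set T) (g : 'I_k -> V) (x : T) : V :=
  if [pick i | `[< S i x >]] is Some i then g i else 0.

(* Main.v *)
(* Along the graph of y the occupation measure is the image of Lebesgue measure
   under x |-> (x, y x, Dy x), so each identity is an identity between integrals
   over Omega and its boundary.  For (a), apply the divergence formula to
   phi(x, y x), whose weak partial derivatives are the total derivatives of phi.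
   For (b), apply it to phi B_ij(x, y x) times the trace representative of D_i y
   and substitute the equation; (c) is the boundary condition integrated over the
   pieces.

   The weak chain and product rules do not use mollification.  A continuous
   function with a bounded weak partial derivative is Lipschitz along that
   direction on compact sets; hence its difference quotients tested against
   continuous functions of compact support converge to the integrals of the weak
   derivative (smooth functions being dense there), and an increment of H(y) is a
   linear combination of increments of y up to a uniformly small error. *)
From HB Require Import structures.
Require Import Defs.
From mathcomp Require Import all_boot all_order all_algebra.
From mathcomp Require Import all_classical all_reals all_analysis.
From mathcomp Require Import measurable_realfun ring lra.
From mathcomp Require mpoly.

Set Implicit Arguments.
Unset Strict Implicit.
Unset Printing Implicit Defensive.

Import Order.TTheory GRing.Theory Num.Theory.
Import numFieldNormedType.Exports.

Local Open Scope classical_set_scope.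
Local Open Scope ring_scope.

(** * Lebesgue measure on row vectors *)

(** In the chain rule the derivatives of phi at (x, y x) become weights that are only as regular as
    y: continuous, but not admissible as test functions. This is why difference quotients must
    converge against all continuous weights; their uniform bound lets the smooth approximation of a
    weight pass to the limit. The given objects are fixed only up to null sets. The Sobolev
    conditions bound some weak derivatives, while [Dy] and [D2y] are prescribed ones; the
    fundamental lemma of the calculus of variations makes them agree a.e. Weak derivatives and the
    equation live on the interior, [mu] and the divergence formula on all of Omega; the formula
    itself forces the boundary to be Lebesgue null, because its volume integrand may be altered
    there. [mu] is prescribed only on boxes inside its support, so a uniqueness theorem must
    identify it with the image measure. The control measures enter as charges without a sign, and
    integration goes through a Hahn decomposition that matches the sign of the density only up to
    null sets. *)

Lemma measurable_translate (R : realType) n (v : 'rV[R]_n) :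
  measurable_fun setT (fun x : 'rV[R]_n => x + v).
Proof.
apply: measurable_fun_mx => i j; under eq_fun do rewrite mxE.
by apply: measurable_funD => //; exact: measurable_coord_mx.
Qed.

Section lebesgue_rV_theory.
Context {R : realType}.

Definition obox {n} (a b : 'rV[R]_n) : set 'rV[R]_n :=
  [set x | forall j, a 0 j < x 0 j < b 0 j].

Lemma open_measurable_mx m n (A : set 'M[R]_(m, n)) : open A -> measurable A.
Proof. by move=> oA; exact: sub_sigma_algebra. Qed.

Lemma closed_measurable_mx m n (A : set 'M[R]_(m, n)) : closed A -> measurable A.
Proof.
move=> cA; rewrite -(setCK A); apply: measurableC; apply: open_measurable_mx.
by rewrite openC.
Qed.

Lemma compact_measurable_mx m n (A : set 'M[R]_(m, n)) :
  compact A -> measurable A.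
Proof.
by move=> cA; apply: closed_measurable_mx; exact: compact_closed.
Qed.

Lemma open_obox n (a b : 'rV[R]_n) : open (obox a b).
Proof.
rewrite openE => x xab.
have := @filter_forall _ 'I_n (fun j => [set z : 'rV[R]_n | a 0 j < z 0 j < b 0 j]) (nbhs x) _.
apply=> j.
apply: (@coord_continuous R 1 n 0 j x [set u : R | a 0 j < u < b 0 j]).
by apply: open_nbhs_nbhs; split; [rewrite -set_itvoo; exact: interval_open|exact: xab].
Qed.

Lemma measurable_obox n (a b : 'rV[R]_n) : measurable (obox a b).
Proof. by apply: open_measurable_mx; exact: open_obox. Qed.

Lemma oboxI n (a b c d : 'rV[R]_n) : obox a b `&` obox c d =
  obox (\row_j Num.max (a 0 j) (c 0 j)) (\row_j Num.min (b 0 j) (d 0 j)).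
Proof.
apply/seteqP; split => x /=.
  by move=> [h1 h2] j; rewrite !mxE gt_max lt_min;
     have /andP[-> ->] := h1 j; have /andP[-> ->] := h2 j.
move=> h; split=> j; have := h j; rewrite !mxE gt_max lt_min;
  by case/andP => /andP[? ?] /andP[? ?]; apply/andP.
Qed.

Lemma ler_coord_norm m n (x : 'M[R]_(m, n)) i j : `|x i j| <= `|x|.
Proof.
rewrite [leRHS]/Num.norm/= mx_normrE.
exact: (le_bigmax_cond _ (fun i : 'I_m * 'I_n => `|x i.1 i.2|) (j := (i, j))).
Qed.

Definition oboxes n : set (set 'rV[R]_n) :=
  [set A | exists ab : 'rV[R]_n * 'rV[R]_n, A = obox ab.1 ab.2].

Lemma bigcup_obox n :
  \bigcup_k obox (const_mx (- k%:R)) (const_mx k%:R) = [set: 'rV[R]_n].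
Proof.
rewrite -subTset => x _.
exists (Num.truncn `|x|).+1 => // j; rewrite !mxE -ltr_norml.
apply: le_lt_trans (truncnS_gt _).
exact: ler_coord_norm.
Qed.

(** The identity from the space with the sigma-algebra of boxes is measurable by
    [measurable_fun_mx], which only asks for coordinates; hence every Borel set lies in that
    sigma-algebra. *)
Lemma oboxes_generate n : measurable = <<s @oboxes n >>.
Proof.
apply/seteqP; split; last first.
  apply: smallest_sub; first exact: sigma_algebra_measurable.
  by move=> _ [ab ->]; exact: measurable_obox.
move=> A mA.
pose T := g_sigma_algebraType (@oboxes n).
have mid : measurable_fun setT (fun x : T => x : 'rV[R]_n).
  apply: measurable_fun_mx => i j; rewrite ord1.
  apply: (measurability _ (RGenOpens.measurableE R)) => _ [_ [a [b ->] <-]].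
  rewrite setTI.
  (* A strip in direction j is not a box: growing intervals exhaust the other coordinates. *)
  rewrite (_ : _ @^-1` _ = \bigcup_(k in [set: nat]) (obox
    (\row_l if l == j then a else - k%:R) (\row_l if l == j then b else k%:R)
    : set T)).
    apply: bigcupT_measurable => k; apply: sub_sigma_algebra.
    by eexists (_, _).
  apply/seteqP; split => x /=; last first.
    by move=> [k _ /(_ j)]; rewrite !mxE eqxx in_itv.
  rewrite in_itv/= => xab.
  have [k _ xk] : (\bigcup_k obox (const_mx (- k%:R)) (const_mx k%:R)) x.
    by rewrite bigcup_obox.
  exists k => // l; rewrite !mxE; case: eqP => [->//|_].
  by have := xk l; rewrite !mxE.
by have := mid measurableT A mA; rewrite setTI.
Qed.

Lemma rV_measure_unique n (m1 m2 : {measure set 'rV[R]_n -> \bar R}) :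
  (forall a b, m1 (obox a b) = m2 (obox a b)) ->
  (forall a b, (m1 (obox a b) < +oo)%E) ->
  forall A, measurable A -> m1 A = m2 A.
Proof.
move=> m12 m1y; apply: (measure_unique (@oboxes n)
  (fun k => obox (const_mx (- k%:R)) (const_mx k%:R))) => //.
- exact: oboxes_generate.
- by move=> _ _ [ab ->] [cd ->]; rewrite oboxI; eexists (_, _).
- by move=> k; eexists (_, _).
- exact: bigcup_obox.
- by move=> _ [ab ->].
Qed.

(** Along [cons_rV] a box splits into an interval and a box of one dimension less, whence the
    induction. The [Num.max 0] covers empty boxes, so that measures can be compared on all boxes
    without ordering a and b. *)
Lemma lebesgue_rV_obox n (a b : 'rV[R]_n) :
  lebesgue_rV n (obox a b) = (\prod_j Num.max 0 (b 0 j - a 0 j))%:E.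
Proof.
elim: n a b => [a b|n IH a b] /=.
  by rewrite big_ord0 diracE mem_set// => -[].
rewrite /lebesgue_step /pushforward.
rewrite (_ : _ @^-1` _ = `]a 0 0, b 0 0[ `*`
    obox (uncons_rV a).2 (uncons_rV b).2); last first.
  apply/seteqP; split => -[x v] /=.
    move=> h; split; first by have := h 0; rewrite mxE unlift_none/= in_itv.
    by move=> j; have := h (lift ord0 j); rewrite !mxE liftK.
  move=> [h1 h2] j; rewrite mxE; case: unliftP => [k|] ->.
    by have := h2 k; rewrite !mxE.
  by move: h1; rewrite in_itv.
rewrite product_measure1E//; last exact: measurable_obox.
rewrite IH; rewrite /= lebesgue_measure_itv/= lte_fin big_ord_recl EFinM; congr (_ * _)%E.
  case: ltP => ab; first by rewrite max_r ?subr_ge0 ?ltW.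
  by rewrite max_l// subr_le0.
by congr EFin; apply: eq_bigr => j _; rewrite !mxE.
Qed.

Lemma lebesgue_rV_translate n (v : 'rV[R]_n) A : measurable A ->
  lebesgue_rV n ((fun x => x + v) @^-1` A) = lebesgue_rV n A.
Proof.
move=> mA.
have mv := measurable_translate v.
pose m : {measure set 'rV[R]_n -> \bar R} :=
  measure_function_pushforward__canonical__measure_function_Measure
    (lebesgue_rV n) mv.
have mE a b : m (obox a b) = lebesgue_rV n (obox a b).
  rewrite -[LHS]/(lebesgue_rV n ((fun x => x + v) @^-1` (obox a b))).
  rewrite (_ : _ @^-1` _ = obox (a - v) (b - v)).
    rewrite !lebesgue_rV_obox; congr EFin; apply: eq_bigr => j _.
    by rewrite !mxE opprB addrA subrK.
  by apply/seteqP; split => x /= h j; have := h j; rewrite !mxE ltrBlDr ltrBrDr.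
rewrite -[LHS]/(m A); apply: rV_measure_unique => // a b.
by rewrite mE lebesgue_rV_obox ltry.
Qed.

Lemma lebesgue_rV_compact n (K : set 'rV[R]_n) :
  compact K -> (lebesgue_rV n K < +oo)%E.
Proof.
move=> cK; have /compact_bounded[M [_ /(_ (M + 1)) h]] := cK.
have {}h x : K x -> `|x| <= M + 1 by apply: h; rewrite ltrDl.
pose B : set 'rV[R]_n := obox (const_mx (- (M + 2))) (const_mx (M + 2)).
have : (lebesgue_rV n B < +oo)%E.
  by rewrite lebesgue_rV_obox ltry.
apply: le_lt_trans; apply: le_measure; rewrite ?inE; [exact: compact_measurable_mx|
  exact: measurable_obox|move=> x Kx j; rewrite !mxE -ltr_norml].
have : M + 1 < M + 2 by rewrite ltrD2l ltr1n.
apply: le_lt_trans; apply: le_trans (h x Kx); exact: ler_coord_norm.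
Qed.

End lebesgue_rV_theory.

Lemma integral_pushforward_mfun d1 d2 (T1 : measurableType d1)
    (T2 : measurableType d2) (R : realType) (h : T1 -> T2)
    (mh : measurable_fun setT h) (mu : {measure set T1 -> \bar R})
    (D : set T2) (f : T2 -> \bar R) : measurable D -> measurable_fun D f ->
  (\int[pushforward mu h]_(y in D) f y =
   \int[mu]_(x in h @^-1` D) f (h x))%E.
Proof.
move=> mD mf; rewrite [LHS]integralE [RHS]integralE; congr (_ - _)%E.
  rewrite (ge0_integral_pushforward mh)//; last exact: measurable_funepos.
  by apply: eq_integral => x _ /=; rewrite !funeposE.
rewrite (ge0_integral_pushforward mh)//; last exact: measurable_funeneg.
by apply: eq_integral => x _ /=; rewrite !funenegE.
Qed.

Lemma integral_translate (R : realType) n (v : 'rV[R]_n)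
    (f : 'rV[R]_n -> \bar R) : measurable_fun setT f ->
  (\int[lebesgue_rV n]_x f (x + v)%R = \int[lebesgue_rV n]_x f x)%E.
Proof.
move=> mf.
have := integral_pushforward_mfun (measurable_translate v) (lebesgue_rV n)
  measurableT mf.
rewrite preimage_setT => /= <-.
apply: eq_measure_integral => [|mv A mA _]; first exact: measurable_translate.
exact: (lebesgue_rV_translate v mA).
Qed.

Lemma Rintegral_translate (R : realType) n (v : 'rV[R]_n) (f : 'rV[R]_n -> R) :
  measurable_fun setT f ->
  \int[lebesgue_rV n]_x f (x + v) = \int[lebesgue_rV n]_x f x.
Proof.
move=> /measurable_EFinP mf.
by rewrite /Rintegral (integral_translate v (f := EFin \o f)).
Qed.

Lemma integrable_translate (R : realType) n (v : 'rV[R]_n)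
    (f : 'rV[R]_n -> \bar R) : (lebesgue_rV n).-integrable setT f ->
  (lebesgue_rV n).-integrable setT (fun x => f (x + v)).
Proof.
move=> /integrableP[mf foo]; apply/integrableP; split.
  by apply: (measurableT_comp mf); exact: measurable_translate.
rewrite (integral_translate v (f := fun x => `|f x|%E))//.
exact: measurableT_comp.
Qed.

(** * Smooth functions and test functions *)

Section Ck_algebra.
Context {R : realType}.

Section normed_module.
Context {V : normedModType R}.
Implicit Types (f g : V -> R) (k : nat).

Lemma Ck_continuous k f : Ck k f -> continuous f.
Proof. by case: k => [|k] []. Qed.

Lemma CkW k f : Ck k.+1 f -> Ck k f.
Proof.
elim: k f => [|k IH] f [cf df]; first by split.
by split => // v; have [dv kv] := df v; split => //; exact: IH.
Qed.

Lemma Ck_cst k (c : R) : Ck k (cst c : V -> R).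
Proof.
elim: k c => [|k IH] c; split => //; try by move=> x; exact: cvg_cst.
move=> v; split; first by move=> x; exact: derivable_cst.
rewrite (_ : 'D_v _ = cst 0); first exact: IH.
by apply/funext => x; rewrite derive_cst.
Qed.

Lemma Ck_add k f g : Ck k f -> Ck k g -> Ck k (f \+ g).
Proof.
elim: k f g => [|k IH] f g [cf df] [cg dg]; split => //;
  try by move=> x; apply: cvgD; [exact: cf|exact: cg].
move=> v; have [dfv kf] := df v; have [dgv kg] := dg v.
split; first by move=> x; exact: derivableD.
rewrite (_ : 'D_v _ = 'D_v f \+ 'D_v g); first exact: IH.
by apply/funext => x; rewrite deriveD.
Qed.

Lemma Ck_mul k f g : Ck k f -> Ck k g -> Ck k (f \* g).
Proof.
elim: k f g => [|k IH] f g kf kg; move: (kf) (kg) => [cf df] [cg dg];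
  split => //; try by move=> x; apply: cvgM; [exact: cf|exact: cg].
move=> v; have [dfv kfv] := df v; have [dgv kgv] := dg v.
split; first by move=> x; exact: derivableM.
rewrite (_ : 'D_v _ = (f \* 'D_v g) \+ (g \* 'D_v f)).
  by apply: Ck_add; apply: IH => //; exact: CkW.
by apply/funext => x; rewrite deriveM.
Qed.

Lemma Ck_inv k f : (forall x, f x != 0) -> Ck k f -> Ck k (fun x => (f x)^-1).
Proof.
move=> f0; elim: k => [|k IH] kf; move: (kf) => [cf df]; split => //;
  try by move=> x; apply: cvgV => //; exact: cf.
move=> v; have [dfv kfv] := df v.
split; first by move=> x; exact: derivableV.
rewrite (_ : 'D_v _ = (cst (- 1) \* 'D_v f) \*
    ((fun x => (f x)^-1) \* (fun x => (f x)^-1))).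
  have ? := IH (CkW kf).
  by apply: Ck_mul; apply: Ck_mul => //; exact: Ck_cst.
apply/funext => x; rewrite deriveV// /=.
by rewrite -expr2 -exprVn mulN1r mulNr scaleNr mulrC.
Qed.

Lemma Ck_sum k (I : Type) (s : seq I) (P : pred I) (F : I -> V -> R) :
  (forall i, P i -> Ck k (F i)) -> Ck k (fun x => \sum_(i <- s | P i) F i x).
Proof.
move=> h; elim: s => [|i s IH].
  by under eq_fun do rewrite big_nil; exact: Ck_cst.
under eq_fun do rewrite big_cons.
by case: (boolP (P i)) => // Pi; apply: Ck_add => //; exact: h.
Qed.

Lemma Ck_prod k (I : Type) (s : seq I) (P : pred I) (F : I -> V -> R) :
  (forall i, P i -> Ck k (F i)) -> Ck k (fun x => \prod_(i <- s | P i) F i x).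
Proof.
move=> h; elim: s => [|i s IH].
  by under eq_fun do rewrite big_nil; exact: Ck_cst.
under eq_fun do rewrite big_cons.
by case: (boolP (P i)) => // Pi; apply: Ck_mul => //; exact: h.
Qed.

End normed_module.

Lemma derive_comp_affine (V W : normedModType R) (l l' : V -> W) (f : W -> R) v :
  (forall h x, l (h *: v + x) = h *: l' v + l x) ->
  'D_v (f \o l) = 'D_(l' v) f \o l.
Proof.
move=> lE; apply/funext => x; rewrite /derive /=.
by under eq_fun do rewrite lE.
Qed.

(* The difference quotients of f \o l are those of f, so the derivatives need no
   chain rule. *)
Lemma Ck_comp_affine (V W : normedModType R) (l l' : V -> W) k (f : W -> R) :
  continuous l -> (forall h v x, l (h *: v + x) = h *: l' v + l x) ->
  Ck k f -> Ck k (f \o l).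
Proof.
move=> cl lE; elim: k f => [|k IH] f [cf df]; split => //;
  try by move=> x; apply: continuous_comp; [exact: cl|exact: cf].
move=> v; have [dfv kfv] := df (l' v); split.
  move=> x; rewrite /derivable.
  rewrite (_ : (fun h => _) =
    (fun h => h^-1 *: ((f \o shift (l x)) (h *: l' v) - f (l x)))).
    exact: dfv.
  by apply/funext => h /=; rewrite lE.
rewrite (derive_comp_affine (l' := l'))//; exact: IH.
Qed.

End Ck_algebra.

(** * Smooth step functions on the real line *)

Section flat.
Context {R : realType}.
Implicit Types (N : nat) (s t : R).

(** The powers of 1/s are included so that the family is closed under differentiation up to linear
    combinations: the derivative of [flat N] involves only [flat N.+2] and [flat N.+1]. Smoothness
    then follows by induction for all N at once. *)
Definition flat N s : R := if 0 < s then s^-1 ^+ N * expR (- s^-1) else 0.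

Lemma flat_ge0 N s : 0 <= flat N s.
Proof.
by rewrite /flat; case: ifP => // s0; rewrite mulr_ge0// ?expR_ge0// exprn_ge0// invr_ge0 ltW.
Qed.

Lemma flat_gt0 N s : 0 < s -> 0 < flat N s.
Proof.
by move=> s0; rewrite /flat s0 mulr_gt0 ?expR_gt0// exprn_gt0 ?invr_gt0.
Qed.

Lemma flat_le0 N s : s <= 0 -> flat N s = 0.
Proof. by rewrite /flat leNgt => /negbTE ->. Qed.

(** For s > 0 the exponential series gives exp(1/s) >= s^-(N+2) / (N+2)!, two powers better than
    s^-N. The square is what flattens the difference quotient at 0. *)
Lemma flat_bound N s : flat N s <= N.+2`!%:R * s ^+ 2.
Proof.
have [s0|s0] := leP s 0; first by rewrite flat_le0// mulr_ge0// sqr_ge0.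
rewrite /flat s0 expRN.
have := @expR_ge1Dxn R s^-1 N.+1; rewrite invr_ge0 ltW// => /(_ isT) h.
rewrite ler_pdivrMr ?expR_gt0//.
have f0 : (0 : R) < N.+2`!%:R by rewrite ltr0n fact_gt0.
have -> : s^-1 ^+ N = N.+2`!%:R * s ^+ 2 * (s^-1 ^+ N.+2 / N.+2`!%:R).
  by rewrite !exprS; field; rewrite !gt_eqF.
rewrite ler_wpM2l//; first by rewrite mulr_ge0 ?ltW// exprn_gt0.
by apply: le_trans h; rewrite lerDr.
Qed.

Lemma is_derive_flat N s :
  is_derive s 1 (flat N) (flat N.+2 s - N%:R * flat N.+1 s).
Proof.
have [s0|s0|s0] := ltgtP s 0.
- rewrite !flat_le0 ?ltW// mulr0 subr0.
  apply: (@near_eq_is_derive _ _ _ (cst 0)).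
  near=> t; rewrite flat_le0// ltW//; near: t; exact: lt_nbhsl.
- apply: (@near_eq_is_derive _ _ _ (fun t => t^-1 ^+ N * expR (- t^-1))).
    by near=> t; rewrite /flat ifT//; near: t; exact: lt_nbhsr.
  have ? : s != 0 by rewrite gt_eqF.
  have h1 : is_derive s 1 (fun t : R => t^-1) (- s^-1 ^+ 2).
    apply: is_derive_eq (is_deriveV _ _) _ => //.
    by rewrite scaler1 exprVn.
  pose h := (fun t : R => t^-1) ^+ N * (fun t => expR (- t^-1)).
  have : is_derive s 1 h (h s * s^-1 ^+ 2 - N%:R * (s^-1 ^+ N.+1 * expR (- s^-1))).
    have hE := @is_derive1_comp _ expR (- (fun t : R => t^-1)) s _ _
      (is_derive_expR (- s^-1)) (is_deriveN h1).
    apply: is_derive_eq (is_deriveM (is_deriveX N h1) hE) _.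
    rewrite /h/= /GRing.scale/= !fctE.
    case: (N) => [|m]; first by rewrite !mul0r subr0 expr0 mul1r; ring.
    by rewrite !exprS /=; ring.
  rewrite /h !fctE /flat s0 => hd; apply: is_derive_eq hd _.
  by rewrite !exprS /=; ring.
- rewrite s0 !flat_le0// mulr0 subr0.
  (* At 0 the quotient is at most (N+2)! |h| by [flat_bound], so the derivative is 0, in agreement
     with the recursion. *)
  suff c0 : h^-1 *: ((flat N \o shift 0) (h *: 1) - flat N 0) @[h --> 0^'] --> (0 : R).
    by apply: DeriveDef; [apply/cvg_ex; exists 0|exact: cvg_lim c0].
  apply/cvgr0Pnorm_lt => e e0; near=> h.
  have C0 : (0 : R) < N.+2`!%:R by rewrite ltr0n fact_gt0.
  rewrite /= addr0 [h *: 1]mulr1 (flat_le0 _ (lexx 0)) subr0 /GRing.scale/=.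
  rewrite normrM normfV (ger0_norm (flat_ge0 _ _)).
  have h0 : 0 < `|h| by rewrite normr_gt0; near: h; exact: nbhs_dnbhs_neq.
  apply: (@le_lt_trans _ _ (`|h|^-1 * (N.+2`!%:R * h ^+ 2))).
    by rewrite ler_wpM2l ?invr_ge0// flat_bound.
  rewrite -real_normK ?num_real// mulrCA expr2 mulKf ?gt_eqF//.
  rewrite mulrC -ltr_pdivlMr//; near: h; apply: dnbhs0_lt; exact: divr_gt0.
Unshelve. all: by end_near.
Qed.

Lemma Ck_flat k N : Ck k (flat N).
Proof.
have cf M : continuous (flat M).
  move=> x; apply: differentiable_continuous; apply/derivable1_diffP.
  by have [] := is_derive_flat M x.
elim: k N => [|k IH] N; split => // v; split.
  move=> x; apply: diff_derivable; apply/derivable1_diffP.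
  by have [] := is_derive_flat N x.
rewrite (_ : 'D_v _ = cst v \* (flat N.+2 \+ (cst (- N%:R) \* flat N.+1))).
  by apply: Ck_mul; [exact: Ck_cst|apply: Ck_add => //; apply: Ck_mul => //;
    exact: Ck_cst].
apply/funext => x; have [dx Dx] := is_derive_flat N x.
have df : differentiable (flat N) x by apply/derivable1_diffP.
rewrite deriveE// -[in LHS](mulr1 v) -[v * 1]/(v *: (1 : R)) linearZ/=.
by rewrite -deriveE// Dx /= mulNr.
Qed.

(** The denominator is positive everywhere because s and 1 - s are never both nonpositive. *)
Definition smoothstep s : R := flat 0 s * (flat 0 s + flat 0 (1 - s))^-1.

Lemma smoothstep_den s : 0 < flat 0 s + flat 0 (1 - s).
Proof.
have [s0|s0] := ltP 0 s; first by rewrite ltr_pwDl ?flat_gt0 ?flat_ge0.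
by rewrite ltr_pwDr ?flat_ge0// flat_gt0// subr_gt0 (le_lt_trans s0).
Qed.

Lemma smoothstep_le0 s : s <= 0 -> smoothstep s = 0.
Proof. by move=> s0; rewrite /smoothstep flat_le0// mul0r. Qed.

Lemma smoothstep_ge1 s : 1 <= s -> smoothstep s = 1.
Proof.
move=> s1; have := smoothstep_den s.
rewrite /smoothstep (@flat_le0 _ (1 - s)) ?subr_le0// addr0 => h.
by rewrite mulfV// gt_eqF.
Qed.

Lemma smoothstep_01 s : 0 <= smoothstep s <= 1.
Proof.
have h := smoothstep_den s; rewrite /smoothstep.
by rewrite ler_pdivrMr// mul1r lerDl flat_ge0 mulr_ge0 ?flat_ge0// invr_ge0 ltW.
Qed.

Lemma Ck_smoothstep k : Ck k smoothstep.
Proof.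
apply: Ck_mul; first exact: Ck_flat.
apply: Ck_inv; first by move=> s; rewrite gt_eqF// smoothstep_den.
apply: Ck_add; first exact: Ck_flat.
apply: (@Ck_comp_affine _ _ _ (fun s => 1 - s) (fun s => - s) _ (flat 0)).
- by move=> x; apply: cvgB; [exact: cvg_cst|exact: cvg_id].
- by move=> h v x; rewrite opprD addrCA scalerN.
- exact: Ck_flat.
Qed.

(** A difference of consecutive translates, so that integer translates telescope to a partition of
    unity. *)
Definition hat s : R := smoothstep s - smoothstep (s - 1).

Lemma hat_ge0 s : 0 <= hat s.
Proof.
rewrite /hat; have [s1|s1] := leP s 1.
  by rewrite (@smoothstep_le0 (s - 1)) ?subr_le0// subr0; case/andP: (smoothstep_01 s).
rewrite (smoothstep_ge1 (ltW s1)) subr_ge0.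
by case/andP: (smoothstep_01 (s - 1)).
Qed.

Lemma hat_eq0 s : ~~ (0 <= s <= 2) -> hat s = 0.
Proof.
rewrite negb_and -!ltNge /hat => /orP[s0|s2].
  by rewrite !smoothstep_le0 ?subrr//; lra.
by rewrite !smoothstep_ge1 ?subrr//; lra.
Qed.

Lemma Ck_hat k : Ck k hat.
Proof.
have Ck1 : Ck k (fun s => smoothstep (s - 1)).
  apply: (@Ck_comp_affine _ _ _ (fun s => s - 1) id _ smoothstep).
  - by move=> x; apply: cvgB; [exact: cvg_id|exact: cvg_cst].
  - by move=> h v x; rewrite addrA.
  - exact: Ck_smoothstep.
rewrite (_ : hat = smoothstep \+ (cst (- 1) \* (fun s => smoothstep (s - 1)))).
  by apply: Ck_add; [exact: Ck_smoothstep|apply: Ck_mul => //; exact: Ck_cst].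
by apply/funext => s; rewrite /hat/= mulN1r.
Qed.

Lemma sum_hat m s : 1 <= s -> s <= m%:R -> \sum_(k < m) hat (s - k%:R) = 1.
Proof.
move=> s1 sm; rewrite -(big_mkord predT (fun k => hat (s - k%:R))).
rewrite (eq_big_nat _ _ (F2 := fun k => (- smoothstep (s - k.+1%:R)) -
    (- smoothstep (s - k%:R)))); last first.
  by move=> k _; rewrite /hat opprK addrC -addrA -opprD natr1.
rewrite telescope_sumr// subr0 opprK smoothstep_le0 ?subr_le0//.
by rewrite oppr0 add0r smoothstep_ge1.
Qed.

End flat.

(** * Closed neighbourhoods of compact sets and smooth approximation *)

Section thickening.
Context {R : realType} {n : nat}.
Local Notation V := 'rV[R]_n.
Implicit Types (K U : set V) (r : R).

Definition thick K r : set V := [set x | exists2 z, K z & `|x - z| <= r].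

Lemma sub_thick K r : 0 <= r -> K `<=` thick K r.
Proof. by move=> r0 x Kx; exists x => //; rewrite subrr normr0. Qed.

Lemma thickW K r s : r <= s -> thick K r `<=` thick K s.
Proof. by move=> rs x [z Kz xz]; exists z => //; exact: le_trans xz rs. Qed.

Lemma compact_thick K r : compact K -> compact (thick K r).
Proof.
move=> cK.
have cB : compact [set v : V | `|v| <= r].
  apply: bounded_closed_compact.
    by exists r; split; [exact: num_real|move=> s rs x /= /le_trans; apply; exact: ltW].
  apply: (@preimage_closed _ _ (fun v : V => `|v|) [set s : R | s <= r]).
  - by move=> x _; exact: norm_continuous.
  - exact: closed_le.
have -> : thick K r = (fun p : V * V => p.1 + p.2) @` (K `*` [set v : V | `|v| <= r]).
  apply/seteqP; split => x.
    by move=> [z Kz xz]; exists (z, x - z) => //=; rewrite addrC subrK.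
  by move=> [[z v] /= [Kz vr] <-]; exists z => //=; rewrite addrC addKr.
apply: continuous_compact; last exact: compact_setX.
by apply: continuous_subspaceT => x; exact: add_continuous.
Qed.

Lemma thick_sub K U : compact K -> open U -> K `<=` U ->
  exists2 r, 0 < r & thick K r `<=` U.
Proof.
move=> /compact_near_coveringP cK oU KU.
(* The near-covering form of compactness, over radii tending to 0 from the right, turns a radius
   depending on the point into a common one. *)
have /(_ _) := cK R (0^'+) (fun r x => forall z, `|z - x| <= r -> U z) _.
case.
  move=> x Kx.
  have /nbhs_ballP[e /= e0 eU] : nbhs x U by apply: open_nbhs_nbhs; split => //; exact: KU.
  exists (ball x (e / 2), [set r | r < e / 2]) => /=.
    split; first by apply: nbhsx_ballx; exact: divr_gt0.
    by apply: nbhs_right_lt; exact: divr_gt0.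
  move=> [x' r] /= [xx' re] z zr; apply: eU.
  move: xx'; rewrite -!ball_normE/= => xx'.
  rewrite (splitr e) -(subrK x' x) -addrA; apply: le_lt_trans (ler_normD _ _) _.
  by rewrite ltrD// distrC (le_lt_trans zr).
move=> e /= e0 h.
exists (e / 2); first exact: divr_gt0.
move=> x [z Kz xz]; apply: (h (e / 2)) xz => //.
- by rewrite /= sub0r normrN gtr0_norm ?divr_gt0// ltr_pdivrMr// ltr_pMr// ltr1n.
- exact: divr_gt0.
Qed.

(** The second point may leave K: continuity near each centre in K controls both points at once, and
    compactness gives a common distance. *)
Lemma compact_unif_continuous (chi : V -> R) K (e : R) : compact K ->
  continuous chi -> 0 < e ->
  exists2 d, 0 < d & forall x z, K x -> `|x - z| <= d -> `|chi x - chi z| <= e.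
Proof.
move=> /compact_near_coveringP cK cchi e0.
have /(_ _) := cK R (0^'+) (fun r x => forall z, `|x - z| <= r -> `|chi x - chi z| <= e) _.
case.
  move=> x Kx.
  have /nbhs_ballP[d /= d0 dU] : nbhs x [set z | `|chi x - chi z| < e / 2].
    by have /cvgrPdist_lt := cchi x; apply; exact: divr_gt0.
  exists (ball x (d / 2), [set r | r < d / 2]) => /=.
    split; first by apply: nbhsx_ballx; exact: divr_gt0.
    by apply: nbhs_right_lt; exact: divr_gt0.
  move=> [x' r] /= [xx' re] z zr.
  rewrite (splitr e) (le_trans (ler_distD (chi x) _ _))// lerD//.
    rewrite distrC ltW//; apply: dU; apply: le_ball xx'.
    by rewrite ler_pdivrMr// ler_pMr// ler1n.
  rewrite ltW//; apply: dU; move: xx'; rewrite -!ball_normE/= => xx'.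
  rewrite (splitr d) (le_lt_trans (ler_distD x' _ _))// ltrD//.
  exact: le_lt_trans re.
move=> d /= d0 h.
exists (d / 2); first exact: divr_gt0.
move=> x z Kx xz; apply: (h (d / 2)) xz => //.
- by rewrite /= sub0r normrN gtr0_norm ?divr_gt0// ltr_pdivrMr// ltr_pMr// ltr1n.
- exact: divr_gt0.
Qed.

(* Interpolation of chi at the nodes of the grid d Z^n by a smooth partition of
   unity. *)
Lemma smooth_dense (chi : V -> R) K r (e : R) : compact K -> continuous chi ->
  (forall x, ~ K x -> chi x = 0) -> 0 < r -> 0 < e ->
  exists psi : V -> R, [/\ smooth psi, forall x, ~ thick K r x -> psi x = 0 &
    forall x, `|psi x - chi x| <= e].
Proof.
move=> cK cchi chi0 r0 e0.
have [d1 d10 hd1] := compact_unif_continuous (compact_thick (r := r) cK) cchi e0.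
(* Mesh of the grid: a weight lives within 2 d of its node, so 2 d <= d1 controls the oscillation of
   chi and 2 d <= r keeps the support inside [thick K r]. *)
pose d := Num.min d1 r / 2.
have d0 : 0 < d by rewrite divr_gt0// lt_min d10.
have dd1 : 2 * d <= d1 by rewrite mulrC divfK ?pnatr_eq0// ge_min lexx.
have dr : 2 * d <= r by rewrite mulrC divfK ?pnatr_eq0// ge_min lexx orbT.
have [M hM] : exists M : R, forall x, thick K r x -> `|x| <= M.
  have /compact_bounded[M [_ /(_ (M + 1)) h]] := compact_thick (r := r) cK.
  by exists (M + 1) => x Kx; apply: h => //; rewrite ltrDl.
(* [sum_hat] wants x / d + L between 1 and 2 L in each coordinate; with |x| <= M this is M / d + 1
   <= L. *)
pose L := (Num.truncn (M / d)).+2.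
have LM : M / d + 1 <= L%:R.
  by rewrite /L -natr1 lerD2r ltW// truncnS_gt.
pose node (k : {ffun 'I_n -> 'I_(L + L)}) : V := \row_j (d * ((k j)%:R - L%:R)).
pose w (k : {ffun 'I_n -> 'I_(L + L)}) (x : V) :=
  \prod_(j < n) hat ((d^-1 * x 0 j + L%:R) - (k j)%:R).
have w0 k x : 0 <= w k x by apply: prodr_ge0 => j _; exact: hat_ge0.
have wn k x : w k x != 0 -> `|x - node k| <= 2 * d.
  move=> wk; rewrite [leLHS]/Num.norm/= mx_normrE; apply: bigmax_le.
    by rewrite mulr_ge0// ltW.
  move=> [i j] _; rewrite ord1 !mxE /=.
  have /prodf_neq0/(_ j isT) hj : \prod_(j < n) hat ((d^-1 * x 0 j + L%:R) - (k j)%:R) != 0 by [].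
  have : 0 <= d^-1 * x 0 j + L%:R - (k j)%:R <= 2.
    by apply: contra_neqT hj; exact: hat_eq0.
  rewrite (_ : d^-1 * x 0 j + L%:R - (k j)%:R =
      d^-1 * (x 0 j - d * ((k j)%:R - L%:R))); last first.
    by field; rewrite gt_eqF.
  rewrite mulrC => /andP[]; rewrite pmulr_lge0 ?invr_gt0// => h1.
  by rewrite ler_pdivrMr// => h2; rewrite ger0_norm.
(* By distributivity the sum over all nodes of the product weights is the product over coordinates
   of one-dimensional sums, each equal to 1. *)
have w1 x : thick K r x -> \sum_k w k x = 1.
  move=> /hM xM; rewrite /w -(bigA_distr_bigA (fun (j : 'I_n) (k : 'I_(L + L)) =>
    hat ((d^-1 * x 0 j + L%:R) - k%:R))).
  apply: big1 => j _; apply: sum_hat.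
    have := le_trans (ler_coord_norm x 0 j) xM; rewrite ler_norml => /andP[h _].
    rewrite -lerBlDr; apply: le_trans (_ : - (M / d) <= _); first by lra.
    by rewrite -mulNr (mulrC d^-1) ler_pM2r ?invr_gt0.
  have := le_trans (ler_coord_norm x 0 j) xM; rewrite ler_norml => /andP[_ h].
  rewrite natrD lerD2r (le_trans _ LM)// (mulrC d^-1).
  by rewrite -[leLHS]addr0 lerD// ler_pM2r ?invr_gt0.
exists (fun x => \sum_k chi (node k) * w k x); split.
- move=> k; apply: Ck_sum => i _; apply: (@Ck_mul _ _ _ (cst (chi (node i)))).
    exact: Ck_cst.
  apply: Ck_prod => j _.
  apply: (@Ck_comp_affine _ _ _ (fun x : V => d^-1 * x 0 j + L%:R - (i j)%:R)
    (fun x : V => d^-1 * x 0 j) _ hat).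
  + move=> x; apply: (@cvgB _ _ _ (nbhs x)); last exact: cvg_cst.
    apply: (@cvgD _ _ _ (nbhs x)); last exact: cvg_cst.
    by apply: cvgM; [exact: cvg_cst|exact: coord_continuous].
  + move=> h v x; rewrite !mxE /GRing.scale/=; ring.
  + exact: Ck_hat.
- move=> x nKx; apply: big1 => k _.
  have [->|/wn h] := eqVneq (w k x) 0; first by rewrite mulr0.
  rewrite chi0 ?mul0r// => Kn; apply: nKx; exists (node k) => //.
  exact: le_trans h dr.
- move=> x.
  have [Kx|nKx] := pselect (thick K r x); last first.
    rewrite chi0; last by move=> Kx; apply: nKx; exact: (sub_thick (ltW r0)).
    rewrite subr0 big1 ?normr0 ?ltW// => k _.
    have [->|/wn h] := eqVneq (w k x) 0; first by rewrite mulr0.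
    rewrite chi0 ?mul0r// => Kn; apply: nKx; exists (node k) => //.
    exact: le_trans h dr.
  rewrite -[chi x]mulr1 -(w1 _ Kx) mulr_sumr -sumrB.
  apply: le_trans (ler_norm_sum _ _ _) _.
  rewrite -[leRHS]mulr1 -(w1 _ Kx) mulr_sumr; apply: ler_sum => k _.
  rewrite -mulrBl normrM (ger0_norm (w0 _ _)).
  have [->|/wn h] := eqVneq (w k x) 0; first by rewrite !mulr0.
  by rewrite ler_wpM2r// distrC; apply: hd1 => //; exact: le_trans h dd1.
Qed.

End thickening.

(** * Measures with a density *)

Section density_measure.
Local Open Scope ereal_scope.
Context d (T : measurableType d) (R : realType) (mu : {measure set T -> \bar R}).
Variables (h : T -> R) (mh : measurable_fun setT h) (h0 : forall x, (0 <= h x)%R).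

(** The two proofs are arguments so that the measure structure can be inferred from the term
    alone. *)
Definition density_measure of measurable_fun setT h & forall x, (0 <= h x)%R :=
  fun A => \int[mu]_(x in A) (h x)%:E.

Local Notation nu := (density_measure mh h0).

Let nu0 : nu set0 = 0. Proof. exact: integral_set0. Qed.

Let nu_ge0 A : 0 <= nu A.
Proof. by apply: integral_ge0 => x _; rewrite lee_fin. Qed.

Let nu_sigma_additive : semi_sigma_additive nu.
Proof.
by apply: semi_sigma_additive_nng_induced; [exact/measurable_EFinP|
  move=> x; rewrite lee_fin].
Qed.

HB.instance Definition _ := isMeasure.Build _ _ _ nu nu0 nu_ge0 nu_sigma_additive.

Import HBNNSimple.

(** Monotone convergence on both sides along the same simple functions reduces the claim to
    indicators, where it is the definition of the density. *)
Lemma ge0_integral_density E (f : T -> \bar R) : measurable E ->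
  measurable_fun E f -> (forall x, E x -> 0 <= f x) ->
  \int[nu]_(x in E) f x = \int[mu]_(x in E) (f x * (h x)%:E).
Proof.
move=> mE mf f0; have mhE := measurable_funTS (D := E) ((measurable_EFinP _ _).2 mh).
pose s_ := nnsfun_approx mE mf.
transitivity (limn (fun n => \int[nu]_(x in E) (s_ n x)%:E)).
  rewrite -monotone_convergence//.
  - apply: eq_integral => y /[!inE] yE; apply/esym/cvg_lim => //.
    by apply: cvg_nnsfun_approx=> // *; apply: f0; rewrite inE.
  - by move=> n; exact/measurable_EFinP/measurable_funTS/measurable_funP.
  - by move=> n y _; rewrite lee_fin.
  - by move=> y _ m n mn; rewrite lee_fin; exact/lefP/nd_nnsfun_approx.
transitivity (limn (fun n => \int[mu]_(x in E) ((s_ n x)%:E * (h x)%:E))); last first.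
  rewrite -monotone_convergence//.
  - apply: eq_integral => y /[!inE] yE; apply/cvg_lim => //.
    by apply: cvgeZr => //; apply: cvg_nnsfun_approx=> // *; apply: f0; rewrite inE.
  - move=> n; apply: emeasurable_funM => //.
    exact/measurable_EFinP/measurable_funTS/measurable_funP.
  - by move=> n y _; rewrite mule_ge0// lee_fin.
  - by move=> y _ m n mn; rewrite lee_wpmul2r ?lee_fin//; exact/lefP/nd_nnsfun_approx.
congr (limn _); apply/funext => n; set s := s_ n.
have indich r : measurable_fun E (fun x => (r * \1_(s @^-1` [set r]) x)%:E).
  by apply: (measurable_comp measurableT) => //; exact: measurable_funM.
transitivity (\int[nu]_(x in E)
   (\sum_(y \in range s) (y * \1_(s @^-1` [set y]) x)%:E)).
  by apply: eq_integral => t tE; rewrite /= [in LHS]fimfunE -fsumEFin.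
rewrite ge0_integral_fsum//; last by move=> m y Ey; exact: nnfun_muleindic_ge0.
transitivity (\int[mu]_(x in E) (\sum_(y \in range s)
    (y * \1_(s @^-1` [set y]) x)%:E * (h x)%:E)); last first.
  apply: eq_integral => x xE.
  rewrite -ge0_mule_fsuml => [|y]; last exact: nnfun_muleindic_ge0.
  by rewrite fsumEFin // -(fimfunE _ x).
rewrite ge0_integral_fsum//; last 2 first.
  - by move=> y; apply: emeasurable_funM.
  - move=> m y Ey; apply: mule_ge0; last by rewrite lee_fin.
    exact: nnfun_muleindic_ge0.
apply: eq_fsbigr => r rhn.
under eq_integral do rewrite EFinM.
rewrite integralZl_indic_nnsfun => //.
under [RHS]eq_integral do rewrite EFinM -muleA.
rewrite ge0_integralZl//.
- congr (_ * _); under [RHS]eq_integral do rewrite muleC.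
  rewrite [RHS](eq_integral ((EFin \o h) \_ (s @^-1` [set r]))); last first.
    by move=> x xE; rewrite epatch_indic.
  by rewrite -integral_mkcondr integral_indic// setIC.
- by apply: emeasurable_funM => //; exact/measurable_EFinP.
- by move=> t Et; rewrite mule_ge0 ?lee_fin.
- by move: rhn; rewrite inE => -[t _ <-]; rewrite lee_fin.
Qed.

End density_measure.

(** * Smooth bumps converging to the indicator of a box *)

Section box_approximation.
Context {R : realType} {n : nat}.
Local Notation V := 'rV[R]_n.
Implicit Types (a b : V).

Definition cbox a b : set V := [set x | forall j, a 0 j <= x 0 j <= b 0 j].

Lemma compact_cbox a b : compact (cbox a b).
Proof.
rewrite (_ : cbox a b = [set x | forall j, `[a 0 j, b 0 j]%classic (x ord0 j)]).
  apply: (@rV_compact _ n (fun j => `[a 0 j, b 0 j]%classic)) => j.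
  exact: segment_compact.
by apply/seteqP; split => x /= h j; have := h j; rewrite in_itv.
Qed.

Lemma sub_obox_cbox a b : obox a b `<=` cbox a b.
Proof. by move=> x h j; have /andP[/ltW -> /ltW ->] := h j. Qed.

(** A factor is exp(-1/((k+1) s)), with s the distance to a face: it tends to 1 for s > 0 and is
    exactly 0 for s <= 0, so the bumps vanish off the open box. *)
Definition box_bump a b k (x : V) : R :=
  \prod_(j < n) (flat 0 (k.+1%:R * (x 0 j - a 0 j)) *
                 flat 0 (k.+1%:R * (b 0 j - x 0 j))).

Lemma flat0_le1 (s : R) : flat 0 s <= 1.
Proof.
rewrite /flat; case: ifP => // s0; rewrite expr0 mul1r.
by rewrite expR_le1 oppr_le0 invr_ge0 ltW.
Qed.

Lemma box_bump_ge0 a b k x : 0 <= box_bump a b k x.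
Proof. by apply: prodr_ge0 => j _; rewrite mulr_ge0// flat_ge0. Qed.

Lemma box_bump_le1 a b k x : box_bump a b k x <= 1.
Proof.
apply: prodr_ile1 => j _; rewrite mulr_ge0 ?flat_ge0//=.
by rewrite mulr_ile1 ?flat_ge0 ?flat0_le1.
Qed.

Lemma box_bump_gt0 a b k x : obox a b x -> 0 < box_bump a b k x.
Proof.
move=> h; apply: prodr_gt0 => j _; have /andP[h1 h2] := h j.
by rewrite mulr_gt0// flat_gt0// mulr_gt0// ?subr_gt0.
Qed.

Lemma box_bump_eq0 a b k x : ~ obox a b x -> box_bump a b k x = 0.
Proof.
move=> /existsNP[j /negP]; rewrite negb_and -!leNgt => h.
apply/eqP/prodf_eq0; exists j => //; rewrite mulf_eq0.
have k0 : 0 <= k.+1%:R :> R by [].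
by case/orP: h => h; apply/orP; [left|right]; apply/eqP; apply: flat_le0;
  rewrite mulr_ge0_le0// subr_le0.
Qed.

Lemma smooth_box_bump a b k : smooth (box_bump a b k).
Proof.
move=> m; apply: Ck_prod => j _; apply: Ck_mul.
  apply: (@Ck_comp_affine _ _ _ (fun x : V => k.+1%:R * (x 0 j - a 0 j))
    (fun x : V => k.+1%:R * x 0 j) _ (flat 0)).
  - move=> x; apply: (@cvgM _ _ (nbhs x)); first exact: cvg_cst.
    by apply: (@cvgB _ _ _ (nbhs x)); [exact: coord_continuous|exact: cvg_cst].
  - by move=> h v x; rewrite !mxE /GRing.scale/=; ring.
  - exact: Ck_flat.
apply: (@Ck_comp_affine _ _ _ (fun x : V => k.+1%:R * (b 0 j - x 0 j))
    (fun x : V => - k.+1%:R * x 0 j) _ (flat 0)).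
- move=> x; apply: (@cvgM _ _ (nbhs x)); first exact: cvg_cst.
  by apply: (@cvgB _ _ _ (nbhs x)); [exact: cvg_cst|exact: coord_continuous].
- by move=> h v x; rewrite !mxE /GRing.scale/=; ring.
- exact: Ck_flat.
Qed.

Lemma cvg_flat0 (s : R) : 0 < s -> flat 0 (k.+1%:R * s) @[k --> \oo] --> (1 : R).
Proof.
move=> s0; rewrite (_ : (fun k => _) = (fun k : nat => expR (- (k.+1%:R^-1 * s^-1)))).
  rewrite -[X in _ --> X](@expR0 R); apply: continuous_cvg; first exact: continuous_expR.
  rewrite -[X in _ --> X]oppr0; apply: cvgN; rewrite -[X in _ --> X](mul0r s^-1); apply: cvgM.
    exact: cvg_harmonic.
  exact: cvg_cst.
by apply/funext => k; rewrite /flat mulr_gt0// expr0 mul1r invfM.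
Qed.

Lemma cvg_box_bump a b x :
  box_bump a b k x @[k --> \oo] --> (\1_(obox a b) x : R).
Proof.
have [xab|xab] := pselect (obox a b x); last first.
  rewrite indicE memNset//; under eq_fun do rewrite box_bump_eq0//.
  exact: cvg_cst.
rewrite indicE mem_set//= (_ : 1%:R = \prod_(j < n) (1 * 1 : R)); last first.
  by rewrite big1// => j _; rewrite mulr1.
apply: (@cvg_big R _ *%R 1 predT (@mul_continuous R) _ _ _
  (fun j k => flat 0 (k.+1%:R * (x 0 j - a 0 j)) *
              flat 0 (k.+1%:R * (b 0 j - x 0 j))) (fun=> 1 * 1)) => j _; have /andP[h1 h2] := xab j.
by apply: cvgM; apply: cvg_flat0; rewrite subr_gt0.
Qed.

Lemma test_function_box_bump U a b k : cbox a b `<=` U ->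
  test_function U (box_bump a b k).
Proof.
move=> abU; split; first exact: smooth_box_bump.
exists (cbox a b); split => //; first exact: compact_cbox.
by move=> x xab; apply: box_bump_eq0 => /sub_obox_cbox.
Qed.

End box_approximation.

(** * Weak derivatives *)

Lemma Rintegral_support d (T : measurableType d) (R : realType)
    (mu : {measure set T -> \bar R}) (D E : set T) (f : T -> R) :
  E `<=` D -> (forall x, D x -> ~ E x -> f x = 0) ->
  \int[mu]_(x in D) f x = \int[mu]_(x in E) f x.
Proof.
move=> ED f0; rewrite Rintegral_mkcond [RHS]Rintegral_mkcond; congr Rintegral.
apply/funext => x; rewrite /patch; case: ifPn => xD; case: ifPn => xE //.
  by apply: f0; [exact: set_mem|move=> /mem_set; exact/negP].
by move: xD; rewrite notin_setE => -[]; exact/ED/set_mem.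
Qed.

Lemma continuous_measurable_rV (R : realType) m n (f : 'M[R]_(m, n) -> R) :
  continuous f -> measurable_fun setT f.
Proof.
move=> cf; apply: (measurability _ (RGenOpens.measurableE R)) => _ [_ [a [b ->] <-]].
rewrite setTI; apply: open_measurable_mx.
by move/continuousP : cf; apply; exact: interval_open.
Qed.

(** * Fundamental lemma of the calculus of variations *)

Section fundamental_lemma.
Context {R : realType} {n : nat}.
Local Notation V := 'rV[R]_n.
Local Notation leb := (@lebesgue_rV R n).
Implicit Types (a b c : V) (U : set V) (f : V -> R).

(** The positive and negative parts of f, extended by 0, are densities of two measures finite on
    boxes. These agree on every open box, which meets the given one in a box of the hypothesis; so
    they coincide, and equal measures have densities equal a.e. *)
Lemma ae0_obox a b f : leb.-integrable (obox a b) (EFin \o f) ->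
  (forall c e : V, (forall j, a 0 j <= c 0 j) -> (forall j, e 0 j <= b 0 j) ->
    \int[leb]_(x in obox c e) f x = 0) ->
  {ae leb, forall x, obox a b x -> f x = 0}.
Proof.
move=> intf f0; pose g := f \_ (obox a b).
have mQ := measurable_obox a b.
have intg : leb.-integrable setT (EFin \o g).
  by have /(integrable_mkcond _ mQ) := intf; rewrite restrict_EFin.
have mg : measurable_fun setT g by apply/measurable_EFinP; exact: (measurable_int leb).
have mgp : measurable_fun setT g^\+ by exact: measurable_funrpos.
have mgn : measurable_fun setT g^\- by exact: measurable_funrneg.
have gp0 x : 0 <= g^\+ x by exact: funrpos_ge0.
have gn0 x : 0 <= g^\- x by exact: funrneg_ge0.
have intp : leb.-integrable setT (EFin \o g^\+) by exact: integrable_funrpos.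
have intn : leb.-integrable setT (EFin \o g^\-) by exact: integrable_funrneg.
have intS h A : measurable A -> leb.-integrable setT h -> leb.-integrable A h.
  by move=> mA; exact: integrableS.
have eqA A : measurable A ->
    density_measure leb mgp gp0 A = density_measure leb mgn gn0 A.
  move=> mA; apply: rV_measure_unique => // c e; last first.
    by have mce := measurable_obox c e; apply: integrable_lty => //; exact: intS.
  have mce := measurable_obox c e.
  suff : \int[leb]_(x in obox c e) (g^\+ x - g^\- x) = 0.
    rewrite RintegralB//; [|exact: intS..].
    move/eqP; rewrite subr_eq0 /Rintegral => /eqP h.
    rewrite /density_measure -[LHS]fineK ?h ?fineK//.
    - by apply: integrable_fin_num => //; exact: intS.
    - by apply: integrable_fin_num => //; exact: intS.
  transitivity (\int[leb]_(x in obox c e) g x).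
    by apply: eq_Rintegral => x _; rewrite -[g in RHS]funrposBneg.
  rewrite /g -Rintegral_mkcondr oboxI; apply: f0 => j; rewrite mxE.
    by rewrite le_max lexx orbT.
  by rewrite ge_min lexx orbT.
have : ae_eq leb setT (EFin \o g^\+) (EFin \o g^\-).
  apply: integral_ae_eq => //; first exact/measurable_EFinP.
  by move=> E _ mE; exact: eqA.
apply: filterS => x /= /(_ Logic.I) [gx] xab.
have : g x = 0 by rewrite -[g]funrposBneg !fctE gx subrr.
by rewrite /g patchE mem_set.
Qed.

Lemma loc_integrable_compact U f K : loc_integrable U f -> compact K ->
  K `<=` U -> leb.-integrable K (EFin \o f).
Proof. by move=> [_]; exact. Qed.

(** The test functions [box_bump] converge boundedly to the indicator of a box, so dominated
    convergence yields the hypothesis of [ae0_obox]. The compact closed box inside U supplies the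
    integrable majorant. *)
Lemma ae0_cbox U f a b : loc_integrable U f ->
  (forall psi, test_function U psi -> \int[leb]_(x in U) (f x * psi x) = 0) ->
  cbox a b `<=` U -> {ae leb, forall x, obox a b x -> f x = 0}.
Proof.
move=> Uf f0 abU.
have cK := compact_cbox (a := a) (b := b).
have mK := compact_measurable_mx cK.
have iK := loc_integrable_compact Uf cK abU.
apply: ae0_obox.
  by apply: integrableS iK => //; [exact: measurable_obox|exact: sub_obox_cbox].
move=> c e ac eb.
have sub : obox c e `<=` cbox a b.
  move=> x xce j; have /andP[cx xe] := xce j.
  by rewrite (le_trans (ac j) (ltW cx)) (le_trans (ltW xe) (eb j)).
have mce := measurable_obox c e.
have csub : cbox c e `<=` cbox a b.
  move=> x xce j; have /andP[cx xe] := xce j.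
  by rewrite (le_trans (ac j) cx) (le_trans xe (eb j)).
have mf := measurable_int _ iK.
have mb k : measurable_fun (cbox a b) (box_bump c e k).
  apply: measurable_funTS; apply: continuous_measurable_rV.
  exact: (Ck_continuous (smooth_box_bump c e k 0)).
pose F k x := (f x * box_bump c e k x)%:E.
have [] := @dominated_convergence _ _ _ leb (cbox a b) mK F
  (fun x => (f x * \1_(obox c e) x)%:E) (fun x => `|(f x)%:E|%E).
- by move=> k; apply/measurable_EFinP/measurable_funM => //; exact/measurable_EFinP.
- by apply/measurable_EFinP/measurable_funM => //; exact/measurable_EFinP.
- apply: aeW => x _; apply: cvg_EFin; first exact: nearW.
  by apply: cvgM; [exact: cvg_cst|exact: cvg_box_bump].
- exact: integrable_abse.
- apply: aeW => x k _; rewrite lee_fin normrM ler_piMr//.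
  by rewrite ger0_norm ?box_bump_ge0 ?box_bump_le1.
move=> _ _.
have -> : [sequence (\int[leb]_(x in cbox a b) F k x)%E]_k = cst 0%E.
  apply/funext => k; rewrite /F.
  have iF : leb.-integrable (cbox a b) (F k).
    apply: (le_integrable mK _ _ (integrable_abse iK)).
      by apply/measurable_EFinP/measurable_funM => //; exact/measurable_EFinP.
    move=> x _; rewrite /F abse_id lee_fin normrM ler_piMr//.
    by rewrite ger0_norm ?box_bump_ge0 ?box_bump_le1.
  rewrite -[LHS]fineK; last exact: integrable_fin_num.
  congr EFin; rewrite -[RHS](f0 (box_bump c e k)); last first.
    by apply: test_function_box_bump; exact: subset_trans abU.
  apply/esym; apply: Rintegral_support => // x _ xab.
  by rewrite box_bump_eq0 ?mulr0// => /sub.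
move=> /cvg_lim => /(_ (@ereal_hausdorff R)); rewrite lim_cst// => h.
rewrite (_ : \int[leb]_(x in obox c e) f x =
    \int[leb]_(x in cbox a b) (f x * \1_(obox c e) x)).
  by rewrite /Rintegral -h.
rewrite Rintegral_mkcond [RHS]Rintegral_mkcond; congr Rintegral.
apply/funext => x; rewrite !patchE indicE; case: ifPn => xce.
  by rewrite mem_set ?mulr1//; exact/sub/set_mem.
by rewrite mulr0; case: ifP.
Qed.

Lemma ae0_test U f : open U -> loc_integrable U f ->
  (forall psi, test_function U psi -> \int[leb]_(x in U) (f x * psi x) = 0) ->
  {ae leb, forall x, U x -> f x = 0}.
Proof.
move=> oU Uf f0.
(* Boxes with rational corners whose closed box lies in U cover U, and only countably many null sets
   have to be joined. *)
pose B (p : 'rV[rat]_n * 'rV[rat]_n) : V * V := (map_mx ratr p.1, map_mx ratr p.2).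
pose P k x := if unpickle k is Some p then
  cbox (B p).1 (B p).2 `<=` U -> obox (B p).1 (B p).2 x -> f x = 0 else True.
have aeP k : {ae leb, forall x, P k x}.
  rewrite /P; case: unpickle => [p|]; last exact: aeW.
  have [sU|nsU] := pselect (cbox (B p).1 (B p).2 `<=` U); last exact: aeW.
  by apply: filterS (ae0_cbox Uf f0 sU) => x h _.
have := ae_foralln aeP; apply: filterS => x hx Ux.
have /nbhs_ballP[e /= e0 eU] : nbhs x U.
  by apply: open_nbhs_nbhs; split.
have /fin_all_exists2 : forall j : 'I_n, exists2 q : rat, True &
    x 0 j - e / 2 < ratr q < x 0 j.
  move=> j; have : x 0 j - e / 2 < x 0 j by rewrite ltrBlDr ltrDl divr_gt0.
  by move=> /rat_in_itvoo[q /[!in_itv]/= h]; exists q.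
move=> [a _ ha].
have /fin_all_exists2 : forall j : 'I_n, exists2 q : rat, True &
    x 0 j < ratr q < x 0 j + e / 2.
  move=> j; have : x 0 j < x 0 j + e / 2 by rewrite ltrDl divr_gt0.
  by move=> /rat_in_itvoo[q /[!in_itv]/= h]; exists q.
move=> [b _ hb].
have := hx (pickle (\row_j a j : 'rV[rat]_n, \row_j b j : 'rV[rat]_n)).
rewrite /P pickleK; apply; last first.
  by move=> j; rewrite !mxE; case/andP: (ha j) => _ ->; case/andP: (hb j) => ->.
move=> z zab; apply: eU; rewrite -ball_normE/=.
apply: (@le_lt_trans _ _ (e / 2)); last by rewrite ltr_pdivrMr// ltr_pMr// ltr1n.
rewrite [leLHS]/Num.norm/= mx_normrE; apply: bigmax_le.
  by rewrite divr_ge0// ltW.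
move=> [i j] _; rewrite ord1 !mxE /= ler_norml.
have := zab j; rewrite !mxE => /andP[h1 h2].
by have /andP[? ?] := ha j; have /andP[? ?] := hb j; lra.
Qed.

End fundamental_lemma.

(** On the line through x the difference quotients are those of f along v, so derivability along v
    alone suffices. Writing the intermediate point as a fraction of t covers both signs of t. *)
Lemma MVT_dir (R : realType) (V : normedModType R) (f : V -> R) (v : V) :
  (forall x, derivable f x v) -> forall x t, exists2 s, 0 <= s <= 1 &
    f (x + t *: v) - f x = t * 'D_v f (x + (s * t) *: v).
Proof.
move=> df x t.
pose g s := f (s *: v + x).
have dg (s : R) : is_derive s 1 g ('D_v f (s *: v + x)).
  have dq : (fun h => h^-1 *: ((g \o shift s) (h *: 1) - g s)) =
      (fun h => h^-1 *: ((f \o shift (s *: v + x)) (h *: v) - f (s *: v + x))).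
    apply/funext => h /=; congr (_ *: (f _ - _)).
    by rewrite [h *: 1]mulr1 scalerDl addrA.
  by split; rewrite /derivable /derive dq//; exact: df.
have cg a b : {within `[a, b], continuous g}.
  apply: continuous_subspaceT => s; apply: differentiable_continuous.
  by apply/derivable1_diffP; case: (dg s).
have [t0|t0|->] := ltgtP t 0; last first.
- exists 0; first by rewrite lexx ler01.
  by rewrite scale0r addr0 subrr mul0r.
- have [c] := MVT_segment (ltW t0) (fun s _ => dg s) (cg 0 t).
  rewrite /g scale0r add0r subr0 in_itv/= => /andP[c0 ct] gE.
  exists (c / t); first by rewrite divr_ge0 ?(ltW t0)//= ler_pdivrMr// mul1r.
  by rewrite mulfVK ?gt_eqF// (addrC x) gE mulrC [c *: v + x]addrC.
- have [c] := MVT_segment (ltW t0) (fun s _ => dg s) (cg t 0).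
  rewrite /g scale0r add0r sub0r in_itv/= => /andP[ct c0] gE.
  exists (c / t).
    by rewrite -mulrNN -invrN divr_ge0 ?oppr_ge0 ?(ltW t0)//= ler_pdivrMr ?oppr_gt0// mul1r lerN2.
  rewrite mulfVK ?lt_eqF// (addrC x) -[LHS]opprB gE mulrN opprK mulrC.
  by rewrite [c *: v + x]addrC.
Qed.

(** * Integration against functions of compact support *)

Section compact_support.
Context {R : realType} {n : nat}.
Local Notation V := 'rV[R]_n.
Local Notation leb := (@lebesgue_rV R n).
Implicit Types (f chi : V -> R) (K : set V) (e : V).

Lemma derive_support K e chi : closed K -> (forall x, ~ K x -> chi x = 0) ->
  forall x, ~ K x -> 'D_e chi x = 0.
Proof.
move=> cK chi0 x nKx; rewrite -(derive_cst 0 x e); apply: near_eq_derive.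
have : nbhs x (~` K) by apply: open_nbhs_nbhs; split => //; exact: closed_openC.
by apply: filterS => z /chi0.
Qed.

Lemma bounded_support K chi : compact K -> continuous chi ->
  (forall x, ~ K x -> chi x = 0) -> exists2 M, 0 <= M & forall x, `|chi x| <= M.
Proof.
move=> cK cchi chi0.
have : compact (chi @` K).
  by apply: continuous_compact => //; exact: continuous_subspaceT.
move=> /compact_bounded[M [_ /(_ (`|M| + 1)) h]].
exists (`|M| + 1) => // x; have [Kx|/chi0 ->] := pselect (K x); last by rewrite normr0.
by apply: h; [rewrite (le_lt_trans (ler_norm _))// ltrDl|exists x].
Qed.

Lemma integrable_support f chi K : compact K -> measurable_fun setT f ->
  leb.-integrable K (EFin \o f) -> measurable_fun setT chi ->
  (exists M, forall x, `|chi x| <= M) -> (forall x, ~ K x -> chi x = 0) ->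
  leb.-integrable setT (EFin \o (fun x => f x * chi x)).
Proof.
move=> cK mf intf mchi [M chiM] chi0.
have mK := compact_measurable_mx cK.
have intM : leb.-integrable K (EFin \o (fun x => f x * M)).
  have := integrableZr mK M intf.
  by apply: eq_integrable => // x _ /=; rewrite EFinM.
have : leb.-integrable K (EFin \o (fun x => f x * chi x)).
  apply: le_integrable intM => //.
    by apply/measurable_EFinP/measurable_funTS/measurable_funM.
  move=> x _; rewrite lee_fin !normrM ler_wpM2l//.
  by rewrite (le_trans (chiM x))// ler_norm.
move/(integrable_mkcond _ mK); rewrite restrict_EFin.
apply: eq_integrable => // x _ /=; rewrite patchE; case: ifPn => //= /negP xK.
by rewrite chi0 ?mulr0// => /mem_set.
Qed.

Lemma le_Rintegral_support f chi K c : compact K -> measurable_fun setT f ->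
  leb.-integrable K (EFin \o f) -> measurable_fun setT chi ->
  (forall x, `|chi x| <= c) -> (forall x, ~ K x -> chi x = 0) ->
  `|\int[leb]_x (f x * chi x)| <= c * \int[leb]_(x in K) `|f x|.
Proof.
move=> cK mf intf mchi chic chi0.
have mK := compact_measurable_mx cK.
have int : leb.-integrable setT (EFin \o (fun x => f x * chi x)).
  by apply: (integrable_support cK) => //; exists c.
have intK := integrableS measurableT mK (@subsetT _ _) int.
have intn : leb.-integrable K (EFin \o (fun x => `|f x|)).
  exact: integrable_norm.
rewrite (@Rintegral_support _ _ _ _ _ K)//; last by move=> x _ /chi0 ->; rewrite mulr0.
apply: le_trans (le_normr_Rintegral mK intK) _.
rewrite -RintegralZl//; apply: le_Rintegral => //.
- exact: integrable_norm.
- exact: (integrableZl mK c intn).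
- by move=> x _; rewrite normrM mulrC ler_wpM2r.
Qed.

Lemma near_scale e (d : R) : 0 < d -> \forall t \near (0 : R)^', `|t *: e| <= d.
Proof.
move=> d0; near=> t; rewrite normrZ.
apply: (@le_trans _ _ (`|t| * (`|e| + 1))); first by rewrite ler_wpM2l// lerDl.
rewrite -ler_pdivlMr ?ltr_wpDl//; near: t.
by apply: dnbhs0_le; rewrite divr_gt0// ltr_wpDl.
Unshelve. all: by end_near.
Qed.

Lemma Rintegral_shift f chi (v : V) : measurable_fun setT f ->
  measurable_fun setT chi ->
  \int[leb]_x (f x * chi (x - v)) = \int[leb]_x (f (x + v) * chi x).
Proof.
move=> mf mchi; rewrite -(@Rintegral_translate _ _ v (fun x => f x * chi (x - v))).
  by apply: eq_Rintegral => x _; rewrite addrK.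
apply: measurable_funM => //; apply: (measurableT_comp mchi).
exact: measurable_translate.
Qed.

(* Discrete integration by parts: the difference quotients of chi converge
   uniformly. *)
Lemma cvg_diff_quotient f chi K r e : compact K -> 0 < r ->
  measurable_fun setT f -> leb.-integrable (thick K r) (EFin \o f) ->
  Ck 1 chi -> (forall x, ~ K x -> chi x = 0) ->
  t^-1 * (\int[leb]_x (f x * chi (x - t *: e)) - \int[leb]_x (f x * chi x))
    @[t --> 0^'] --> - \int[leb]_x (f x * 'D_e chi x).
Proof.
move=> cK r0 mf intf [cchi /(_ e)[dchi [cdchi _]]] chi0.
have cKr := compact_thick (r := r) cK.
have mKr := compact_measurable_mx cKr.
have KKr : K `<=` thick K r by exact/sub_thick/ltW.
have chi0r x : ~ thick K r x -> chi x = 0 by move=> h; apply: chi0 => /KKr.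
have clK : closed K by exact: compact_closed.
have dchi0 := @derive_support _ e _ clK chi0.
have dchi0r x : ~ thick K r x -> 'D_e chi x = 0 by move=> h; apply: dchi0 => /KKr.
have mchi := continuous_measurable_rV cchi.
have mdchi := continuous_measurable_rV cdchi.
pose I := \int[leb]_(x in thick K r) `|f x|.
have I0 : 0 <= I by apply: Rintegral_ge0.
apply/cvgrPdist_le => /= eps eps0.
(* The final estimate multiplies this tolerance by I; the added 1 keeps the denominator positive
   when I = 0. *)
have eps1 : 0 < eps / (I + 1) by rewrite divr_gt0// ltr_pwDr.
have [d d0 hd] := compact_unif_continuous cKr cdchi eps1.
near=> t.
have t0 : t != 0 by near: t; exact: nbhs_dnbhs_neq.
have tr : `|t *: e| <= r.
  near: t; exact: near_scale.
have td : `|t *: e| <= d.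
  near: t; exact: near_scale.
(* The error of the difference quotient of chi, which tends to minus the derivative because chi is
   evaluated at x - t e. It vanishes off [thick K r] once |t e| <= r. *)
pose q (x : V) := t^-1 * (chi (x - t *: e) - chi x) + 'D_e chi x.
have mchit : measurable_fun setT (fun x : V => chi (x - t *: e)).
  by apply: (measurableT_comp mchi); exact: measurable_translate.
have q0 x : ~ thick K r x -> q x = 0.
  move=> nx; rewrite /q (chi0r _ nx) (dchi0r _ nx) chi0; last first.
    move=> Kx; apply: nx; exists (x - t *: e) => //.
    by rewrite opprB addrCA subrr addr0.
  by rewrite subrr mulr0 addr0.
have qe x : `|q x| <= eps / (I + 1).
  have [Kx|/q0 ->] := pselect (thick K r x); last by rewrite normr0 ltW.
  have [s /andP[s0 s1]] := MVT_dir dchi x (- t).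
  rewrite scaleNr /q => ->.
  rewrite mulrA mulrN mulVf// mulN1r addrC; apply: hd => //.
  rewrite opprD addrA subrr sub0r normrN mulrN scaleNr normrN -scalerA normrZ ger0_norm//.
  by rewrite (le_trans _ td)// ler_piMl.
have int1 : leb.-integrable setT (EFin \o (fun x => f x * chi x)).
  apply: (integrable_support cKr) => //.
  by have [M] := bounded_support cK cchi chi0; exists M.
have int2 : leb.-integrable setT (EFin \o (fun x => f x * chi (x - t *: e))).
  apply: (integrable_support cKr) => //.
    by have [M _ h] := bounded_support cK cchi chi0; exists M.
  move=> x nx; apply: chi0 => Kx; apply: nx; exists (x - t *: e) => //.
  by rewrite opprB addrCA subrr addr0.
have int3 : leb.-integrable setT (EFin \o (fun x => f x * 'D_e chi x)).
  apply: (integrable_support cKr) => //.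
  by have [M] := bounded_support cK cdchi dchi0; exists M.
rewrite -opprD normrN.
have -> : \int[leb]_x (f x * 'D_e chi x) +
    t^-1 * (\int[leb]_x (f x * chi (x - t *: e)) - \int[leb]_x (f x * chi x)) =
    \int[leb]_x (f x * q x).
  rewrite -RintegralB// -RintegralZl//; last first.
    have := integrableB measurableT int2 int1.
    by apply: eq_integrable => // x _ /=; rewrite -EFinB.
  rewrite -RintegralD//; last first.
    have := integrableZl measurableT t^-1 (integrableB measurableT int2 int1).
    by apply: eq_integrable => // x _ /=; rewrite -EFinB -EFinM.
  by apply: eq_Rintegral => x _; rewrite /q; ring.
apply: le_trans (le_Rintegral_support cKr _ intf _ qe q0) _ => //.
  apply: measurable_funD => //; apply: measurable_funM => //.
  exact: measurable_funB.
rewrite mulrAC ler_pdivrMr ?ltr_pwDr// ler_pM2l// lerDl.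
Unshelve. all: by end_near.
Qed.

End compact_support.

Section Rintegral_ae.
Context d (T : measurableType d) (R : realType) (mu : {measure set T -> \bar R}).
Implicit Types (D : set T) (f g : T -> R).

Lemma ae_eq_Rintegral D f g : measurable D -> measurable_fun D f ->
  measurable_fun D g -> {ae mu, forall x, D x -> f x = g x} ->
  \int[mu]_(x in D) f x = \int[mu]_(x in D) g x.
Proof.
move=> mD mf mg fg; congr fine; apply: ae_eq_integral => //.
- exact/measurable_EFinP.
- exact/measurable_EFinP.
- by apply: filterS fg => x /= h Dx; rewrite h.
Qed.

Lemma ae_le_Rintegral D f g : measurable D ->
  mu.-integrable D (EFin \o f) -> mu.-integrable D (EFin \o g) ->
  {ae mu, forall x, D x -> f x <= g x} ->
  \int[mu]_(x in D) f x <= \int[mu]_(x in D) g x.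
Proof.
move=> mD intf intg fg; rewrite -subr_ge0 -RintegralB//.
have mf : measurable_fun D f by apply/measurable_EFinP; exact: measurable_int intf.
have mg : measurable_fun D g by apply/measurable_EFinP; exact: measurable_int intg.
(* The absolute value makes the integrand nonnegative everywhere instead of almost everywhere. *)
rewrite (@ae_eq_Rintegral _ _ (fun x => `|g x - f x|))//.
- by apply: Rintegral_ge0.
- exact: measurable_funB.
- by apply: measurableT_comp => //; exact: measurable_funB.
- by apply: filterS fg => x h Dx; rewrite ger0_norm// subr_ge0 h.
Qed.

End Rintegral_ae.

(** The derivative is asked for only up to |t|: in the application, larger shifts may push the test
    function out of its domain. *)
Lemma MVT_ball (R : realType) (f df : R -> R) t :
  (forall s : R, `|s| <= `|t| -> is_derive s 1 f (df s)) ->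
  exists2 c, `|c| <= `|t| & f t - f 0 = t * df c.
Proof.
move=> dfP.
have cf a b : (forall s, s \in `[a, b] -> `|s| <= `|t|) -> {within `[a, b], continuous f}.
  move=> h; apply: derivable_within_continuous => s /h /dfP [].
  by [].
have [t0|t0|->] := ltgtP t 0; last first.
- by exists 0 => //; rewrite subrr mul0r.
- have h s : s \in `[0, t] -> `|s| <= `|t|.
    by rewrite in_itv/= => /andP[s0 st]; rewrite !ger0_norm// ltW.
  have [c ct fE] := MVT_segment (ltW t0)
    (fun s st => dfP s (h s (subset_itv_oo_cc st))) (cf 0 t h).
  by exists c; [exact: h|rewrite fE subr0 mulrC].
- have h s : s \in `[t, 0] -> `|s| <= `|t|.
    by rewrite in_itv/= => /andP[st s0]; rewrite !ler0_norm ?lerN2// ltW.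
  have [c ct fE] := MVT_segment (ltW t0)
    (fun s st => dfP s (h s (subset_itv_oo_cc st))) (cf t 0 h).
  by exists c; [exact: h|rewrite -[LHS]opprB fE sub0r mulrN opprK mulrC].
Qed.

(** * Integrated Lipschitz estimate from a bounded weak derivative *)

Section weak_derivative.
Context {R : realType} {n : nat}.
Local Notation V := 'rV[R]_n.
Local Notation leb := (@lebesgue_rV R n).
Implicit Types (f g chi w : V -> R) (K U : set V) (e : V) (r M t : R).

(* As [weak_partial], but for functions on the whole space, so that they can be
   translated. *)
Definition wderiv U e f g : Prop :=
  [/\ measurable_fun setT f, measurable_fun setT g,
      forall K, compact K -> K `<=` U -> leb.-integrable K (EFin \o f),
      forall K, compact K -> K `<=` U -> leb.-integrable K (EFin \o g) &
      forall psi, test_function U psi ->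
        \int[leb]_x (f x * 'D_e psi x) = - \int[leb]_x (g x * psi x)].

Lemma wderivN U e f g : wderiv U e f g -> wderiv U e (\- f) (\- g).
Proof.
move=> [mf mg intf intg fg]; split.
- exact: measurableT_comp.
- exact: measurableT_comp.
- move=> K cK KU; have := integrableN (intf K cK KU).
  by apply: eq_integrable => //; exact: compact_measurable_mx.
- move=> K cK KU; have := integrableN (intg K cK KU).
  by apply: eq_integrable => //; exact: compact_measurable_mx.
- move=> psi tpsi; have [spsi [K [cK KU psi0]]] := tpsi.
  have [cpsi /(_ e)[_ [cdpsi _]]] := spsi 1%N.
  have dpsi0 := @derive_support R n K e psi (compact_closed (@norm_hausdorff _ _) cK) psi0.
  have int1 : leb.-integrable setT (EFin \o (fun x => f x * 'D_e psi x)).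
    apply: (integrable_support cK) => //; first exact: intf.
      exact: continuous_measurable_rV.
    by have [M _ ?] := bounded_support cK cdpsi dpsi0; exists M.
  have int2 : leb.-integrable setT (EFin \o (fun x => g x * psi x)).
    apply: (integrable_support cK) => //; first exact: intg.
      exact: continuous_measurable_rV.
    by have [M _ ?] := bounded_support cK cpsi psi0; exists M.
  under eq_Rintegral do rewrite mulNr -mulN1r.
  under [in RHS]eq_Rintegral do rewrite mulNr -mulN1r.
  by rewrite !RintegralZl// fg//; ring.
Qed.

Lemma smooth_translate chi (v : V) : smooth chi -> smooth (fun x => chi (x - v)).
Proof.
move=> sc k; apply: (@Ck_comp_affine R V V (fun x => x - v) id k chi) => //.
- by move=> x; apply: (@cvgB _ _ _ (nbhs x)); [exact: cvg_id|exact: cvg_cst].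
- by move=> h w x; rewrite addrA.
Qed.

Lemma integrable_cc chi K : compact K -> measurable_fun setT chi ->
  (exists M, forall x, `|chi x| <= M) -> (forall x, ~ K x -> chi x = 0) ->
  leb.-integrable setT (EFin \o chi).
Proof.
move=> cK mchi bchi chi0; have mK := compact_measurable_mx cK.
have int1 : leb.-integrable K (EFin \o (fun=> 1 : R)).
  apply: measurable_bounded_integrable => //; first exact: lebesgue_rV_compact.
  exists 1; split; first exact: num_real.
  by move=> x x1 y _ /=; rewrite normr1; exact: ltW.
have m1 : measurable_fun setT ((fun=> 1) : V -> R) by [].
have := integrable_support cK m1 int1 mchi bchi chi0.
by apply: eq_integrable => // x _ /=; rewrite mul1r.
Qed.

(** The integral of w against chi shifted by s e is differentiable in s, with derivative the
    integral of g against the same shift: a shifted chi stays a test function in U while |s e| < r.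
    The mean value theorem and |g| <= M conclude. *)
Lemma wderiv_shift_le U e w g K r M chi t : wderiv U e w g ->
  {ae leb, forall x, `|g x| <= M} -> compact K -> thick K r `<=` U ->
  smooth chi -> (forall x, ~ K x -> chi x = 0) -> (forall x, 0 <= chi x) ->
  `|t *: e| < r ->
  `|\int[leb]_x ((w (x + t *: e) - w x) * chi x)| <= M * `|t| * \int[leb]_x chi x.
Proof.
move=> [mw mg intw intg wg] gM cK KU schi chi0 chige0 tr.
have r0 : 0 < r by exact: le_lt_trans tr.
pose Phi s := \int[leb]_x (w x * chi (x - s *: e)).
have cchi := Ck_continuous (schi 0%N).
have mchi := continuous_measurable_rV cchi.
have [C C0 hC] := bounded_support cK cchi chi0.
have mK := compact_measurable_mx cK.
have se (s : R) : `|s| <= `|t| -> `|s *: e| < r.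
  move=> st; apply: le_lt_trans tr; rewrite !normrZ; exact: ler_wpM2r.
pose Ks (s : R) : set V := thick K `|s *: e|.
have Kchi s x : ~ Ks s x -> chi (x - s *: e) = 0.
  move=> nK; apply: chi0 => Kx; apply: nK; exists (x - s *: e) => //.
  by rewrite opprB addrCA subrr addr0.
have cKs s : compact (Ks s) by exact: compact_thick.
have KsU (s : R) : `|s| <= `|t| -> Ks s `<=` U.
  by move=> st; apply: subset_trans KU; apply: thickW; exact/ltW/se.
have mchis s : measurable_fun setT (fun x : V => chi (x - s *: e)).
  by apply: (measurableT_comp mchi); exact: measurable_translate.
have dPhi (s : R) : `|s| <= `|t| ->
    is_derive s 1 Phi (\int[leb]_x (g x * chi (x - s *: e))).
  move=> st; have rs : 0 < r - `|s *: e| by rewrite subr_gt0 se.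
  have sub : thick (Ks s) (r - `|s *: e|) `<=` U.
    apply: subset_trans KU => x [z [k Kk zk] xz]; exists k => //.
    rewrite -(subrK z x) -addrA (le_trans (ler_normD _ _))//.
    by rewrite -(subrK `|s *: e| r) lerD.
  have stest : test_function U (fun x => chi (x - s *: e)).
    by split; [exact: smooth_translate|exists (Ks s); split => //; [exact: KsU|exact: Kchi]].
  have := @cvg_diff_quotient R n w (fun x => chi (x - s *: e)) (Ks s) _ e (cKs s) rs mw
    (intw _ (compact_thick (cKs s)) sub) (stest.1 1%N) (Kchi s).
  rewrite wg// opprK => h.
  have dq : (fun h : R => h^-1 *: ((Phi \o shift s) (h *: 1) - Phi s)) =
    (fun t : R => t^-1 * (\int[leb]_x (w x * chi (x - t *: e - s *: e)) - Phi s)).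
    apply/funext => u; rewrite -[LHS]/(u^-1 * (Phi (u * 1 + s) - Phi s)) mulr1.
    congr (_ * (_ - _)); apply: eq_Rintegral => x _.
    by rewrite scalerDl opprD addrA.
  by split; [rewrite /derivable dq; apply/cvg_ex; eexists; exact: h|
    rewrite /derive dq; exact: cvg_lim h].
have [c ct PhiE] := MVT_ball dPhi.
have intws (s : R) : `|s| <= `|t| -> leb.-integrable setT (EFin \o (fun x => w x * chi (x - s *: e))).
  move=> st; apply: (integrable_support (cKs s)) => //; last exact: Kchi.
    exact/intw/KsU.
  by exists C.
have intgs (s : R) : `|s| <= `|t| -> leb.-integrable setT (EFin \o (fun x => g x * chi (x - s *: e))).
  move=> st; apply: (integrable_support (cKs s)) => //; last exact: Kchi.
    exact/intg/KsU.
  by exists C.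
have intchi s : leb.-integrable setT (EFin \o (fun x => chi (x - s *: e))).
  by apply: (integrable_cc (cKs s)) => //; [exists C|exact: Kchi].
have -> : \int[leb]_x ((w (x + t *: e) - w x) * chi x) = Phi t - Phi 0.
  rewrite /Phi Rintegral_shift//.
  under [X in _ = _ - X]eq_Rintegral do rewrite scale0r subr0.
  rewrite -RintegralB//.
  - by apply: eq_Rintegral => x _; rewrite mulrBl.
  - have := integrable_translate (t *: e) (intws t (lexx _)).
    by apply: eq_integrable => // x _ /=; rewrite addrK.
  - have := intws 0; rewrite normr0 => /(_ (normr_ge0 _)).
    by apply: eq_integrable => // x _ /=; rewrite scale0r subr0.
rewrite PhiE normrM -mulrA mulrCA ler_wpM2l//.
(* Translation invariance removes the intermediate shift c from the bound. *)
have chiE : \int[leb]_x chi x = \int[leb]_x chi (x - c *: e).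
  by rewrite -(@Rintegral_translate _ _ (- (c *: e)) chi).
apply: le_trans (le_normr_Rintegral measurableT (intgs c ct)) _.
rewrite chiE -RintegralZl//; apply: ae_le_Rintegral => //.
- exact: integrable_norm (intgs c ct).
- exact: (integrableZl measurableT M (intchi c)).
- apply: filterS gM => x gx _; rewrite normrM [X in _ * X]ger0_norm//.
  exact: ler_wpM2r.
Qed.

End weak_derivative.

(** * Pointwise Lipschitz estimate and weak convergence of difference quotients *)

Section chain_rule.
Context {R : realType} {n : nat}.
Local Notation V := 'rV[R]_n.
Local Notation leb := (@lebesgue_rV R n).
Implicit Types (f g chi w : V -> R) (K U : set V) (e : V) (r M t : R).

Lemma integrable_shift f chi K r (v : V) : compact K -> `|v| <= r ->
  measurable_fun setT f -> leb.-integrable (thick K r) (EFin \o f) ->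
  measurable_fun setT chi -> (exists M, forall x, `|chi x| <= M) ->
  (forall x, ~ K x -> chi x = 0) ->
  leb.-integrable setT (EFin \o (fun x => f (x + v) * chi x)).
Proof.
move=> cK vr mf intf mchi [M chiM] chi0.
have cKr := compact_thick (r := r) cK.
have mchiv : measurable_fun setT (fun x : V => chi (x - v)).
  by apply: (measurableT_comp mchi); exact: measurable_translate.
have int1 : leb.-integrable setT (EFin \o (fun x => f x * chi (x - v))).
  apply: (integrable_support cKr) => //; first by exists M.
  move=> x nx; apply: chi0 => Kx; apply: nx; exists (x - v) => //.
  by rewrite opprB addrCA subrr addr0.
have := integrable_translate v int1.
by apply: eq_integrable => // x _ /=; rewrite addrK.
Qed.

(** Were the integral 0, the nonnegative bump would vanish a.e., yet it is positive on a box of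
    positive measure. *)
Lemma Rintegral_box_bump_gt0 (a b : V) k : (forall j, a 0 j < b 0 j) ->
  0 < \int[leb]_x box_bump a b k x.
Proof.
move=> ab.
have mb := continuous_measurable_rV (Ck_continuous (smooth_box_bump a b k 0)).
have intb : leb.-integrable setT (EFin \o box_bump a b k).
  apply: (integrable_cc (compact_cbox (a := a) (b := b))) => //.
    by exists 1 => x; rewrite ger0_norm ?box_bump_ge0 ?box_bump_le1.
  by move=> x nx; apply: box_bump_eq0 => /sub_obox_cbox.
rewrite lt_neqAle Rintegral_ge0 ?andbT; last by move=> x _; exact: box_bump_ge0.
apply/eqP => /esym I0.
have I0' : (\int[leb]_x `|(box_bump a b k x)%:E| = 0)%E.
  rewrite -[LHS]fineK; last by apply: integrable_fin_num => //; exact: integrable_abse.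
  congr EFin; rewrite -[RHS]I0; congr fine; apply: eq_integral => x _.
  by rewrite /= ger0_norm// box_bump_ge0.
have mbE : measurable_fun setT (EFin \o box_bump a b k) by exact/measurable_EFinP.
have [+ _] := ae_eq_integral_abs leb measurableT mbE.
move=> /(_ I0') [N [mN N0 subN]].
have : (lebesgue_rV n (obox a b) <= lebesgue_rV n N)%E.
  apply: le_measure; rewrite ?inE//; first exact: measurable_obox.
  move=> x xab; apply: subN => /= /(_ Logic.I) []; apply/eqP.
  by rewrite gt_eqF// box_bump_gt0.
rewrite N0 lebesgue_rV_obox lee_fin leNgt => /negP; apply.
by apply: prodr_gt0 => j _; rewrite lt_max subr_gt0 ab orbT.
Qed.

(* Where the estimate fails, it fails on a small box by continuity; a bump function
   supported there contradicts the integrated estimate. *)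
Lemma lipschitz_dir_le U e w g K r M x t : wderiv U e w g ->
  {ae leb, forall x, `|g x| <= M} -> (forall z, U z -> {for z, continuous w}) ->
  thick K r `<=` U -> K x -> `|t *: e| < r ->
  w (x + t *: e) - w x <= M * `|t|.
Proof.
move=> wg gM cw KU Kx tr; rewrite leNgt; apply/negP => lt.
(* Half of the supposed excess over M |t|: by continuity the other half persists near x. *)
pose eta := (w (x + t *: e) - w x - M * `|t|) / 2.
have eta0 : 0 < eta by rewrite divr_gt0// subr_gt0.
have r0 : 0 < r by exact: le_lt_trans tr.
have Ux : U x by apply: KU; exists x => //; rewrite subrr normr0 ltW.
have Uxt : U (x + t *: e).
  by apply: KU; exists x => //; rewrite addrAC subrr add0r ltW.
have cD : w (z + t *: e) - w z @[z --> x] --> w (x + t *: e) - w x.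
  apply: (@cvgB _ _ _ (nbhs x)); last exact: cw.
  apply: (@cvg_comp _ _ _ (fun z => z + t *: e) w (nbhs x) (nbhs (x + t *: e))); last exact: cw.
  by apply: (@cvgD _ _ _ (nbhs x)); [exact: cvg_id|exact: cvg_cst].
have /nbhs_ballP[d /= d0 dD] :
    \forall z \near x, M * `|t| + eta < w (z + t *: e) - w z.
  have /cvgrPdist_lt/(_ _ eta0) := cD; apply: filterS => z.
  by rewrite ltr_distlC => /andP[+ _]; rewrite /eta; apply: le_lt_trans; lra.
have rt : 0 < r - `|t *: e| by rewrite subr_gt0.
(* The box of half-width s must lie where the increment is too large, and its thickening by (r + |t
   e|) / 2, a radius strictly between |t e| and r, must stay in U. *)
pose s := Num.min d (r - `|t *: e|) / 2.
have s0 : 0 < s by rewrite divr_gt0// lt_min d0.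
have sd : s < d.
  by rewrite ltr_pdivrMr// gt_min ltr_pMr// ltr1n.
have sr : s <= (r - `|t *: e|) / 2.
  by rewrite ler_pM2r ?invr_gt0// ge_min lexx orbT.
pose a := x - const_mx s; pose b := x + const_mx s.
have abx z : cbox a b z -> `|z - x| <= s.
  move=> h; rewrite [leLHS]/Num.norm/= mx_normrE; apply: bigmax_le; first exact: ltW.
  move=> [i j] _; rewrite ord1 !mxE /= ler_norml.
  by have := h j; rewrite !mxE => /andP[h1 h2]; apply/andP; split; lra.
have tr' : `|t *: e| < (r + `|t *: e|) / 2 by lra.
have sub : thick (cbox a b) ((r + `|t *: e|) / 2) `<=` U.
  move=> z [z' /abx h zz']; apply: KU; exists x => //.
  rewrite -(subrK z' z) -addrA (le_trans (ler_normD _ _))//.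
  by apply: le_trans (lerD zz' h) _; lra.
have chi0 z : ~ cbox a b z -> box_bump a b 0 z = 0.
  by move=> nz; apply: box_bump_eq0 => /sub_obox_cbox.
have cK := compact_cbox (a := a) (b := b).
have schi := smooth_box_bump a b 0.
have mchi := continuous_measurable_rV (Ck_continuous (schi 0%N)).
have bchi : exists M, forall x, `|box_bump a b 0 x| <= M.
  by exists 1 => z; rewrite ger0_norm ?box_bump_ge0 ?box_bump_le1.
have := @wderiv_shift_le R n U e w g _ _ M _ t wg gM cK sub schi chi0 (box_bump_ge0 a b 0) tr'.
apply/negP; rewrite -ltNge.
have I0 : 0 < \int[leb]_x box_bump a b 0 x.
  by apply: Rintegral_box_bump_gt0 => j; rewrite !mxE; lra.
apply: (@lt_le_trans _ _ ((M * `|t| + eta) * \int[leb]_x box_bump a b 0 x)).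
  by rewrite ltr_pM2r// ltrDl.
apply: le_trans (ler_norm _).
have [mw mg intw intg _] := wg.
have intb : leb.-integrable setT (EFin \o box_bump a b 0) by exact: (integrable_cc cK).
rewrite -RintegralZl//; apply: le_Rintegral => //.
- exact: (integrableZl measurableT (M * `|t| + eta) intb).
- have i1 := integrable_shift cK (ltW tr') mw (intw _ (compact_thick cK) sub) mchi bchi chi0.
  have sub0 : cbox a b `<=` U.
    by apply: subset_trans sub; apply: sub_thick; rewrite divr_ge0// addr_ge0// ltW.
  have i2 := integrable_support cK mw (intw _ cK sub0) mchi bchi chi0.
  have := integrableB measurableT i1 i2.
  by apply: eq_integrable => // z _ /=; rewrite -EFinB mulrBl.
- move=> z _; have [zab|/chi0 ->] := pselect (cbox a b z); last by rewrite !mulr0.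
  rewrite ler_wpM2r ?box_bump_ge0// ltW//; apply: dD.
  by rewrite -ball_normE /ball_ /= distrC (le_lt_trans (abx _ zab)).
Qed.

Lemma lipschitz_dir U e w g K r M x t : wderiv U e w g ->
  {ae leb, forall x, `|g x| <= M} -> (forall z, U z -> {for z, continuous w}) ->
  thick K r `<=` U -> K x -> `|t *: e| < r ->
  `|w (x + t *: e) - w x| <= M * `|t|.
Proof.
move=> wg gM cw KU Kx tr; rewrite ler_norml (lipschitz_dir_le wg gM cw KU Kx tr) andbT.
rewrite lerNl; have := @lipschitz_dir_le U e (\- w) (\- g) K r M x t (wderivN wg).
move=> /= H; rewrite opprB addrC -[w x]opprK; apply: H => //.
- by apply: filterS gM => z; rewrite /= normrN.
- by move=> z Uz; apply: (@cvgN _ _ _ (nbhs z)); exact: cw.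
Qed.

(** For smooth chi this is [cvg_diff_quotient]. A continuous chi is uniformly close to a smooth psi,
    and the error stays small uniformly in t because the difference quotients of w are bounded by M
    on the enlarged support. *)
Lemma cvg_diff_quotient_weak U e w g K r M chi : wderiv U e w g -> 0 <= M ->
  {ae leb, forall x, `|g x| <= M} -> (forall z, U z -> {for z, continuous w}) ->
  compact K -> 0 < r -> thick K r `<=` U ->
  continuous chi -> (forall x, ~ K x -> chi x = 0) ->
  t^-1 * (\int[leb]_x ((w (x + t *: e) - w x) * chi x)) @[t --> 0^'] -->
  \int[leb]_x (g x * chi x).
Proof.
move=> wg M0 gM cw cK r0 KU cchi chi0.
have [mw mg intw intg wgE] := wg.
(* Half of the margin is spent on the support of psi, the other half on translations. *)
pose r2 := r / 2; have r20 : 0 < r2 by rewrite divr_gt0.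
pose K2 := thick K r2; have cK2 : compact K2 := compact_thick cK.
have mK2 := compact_measurable_mx cK2.
have K2U : thick K2 r2 `<=` U.
  move=> x [z [k Kk zk] xz]; apply: KU; exists k => //.
  rewrite -(subrK z x) -addrA (le_trans (ler_normD _ _))//.
  by apply: le_trans (lerD xz zk) _; rewrite -splitr.
have K2U0 : K2 `<=` U by apply: subset_trans K2U; exact/sub_thick/ltW.
have KK2 : K `<=` K2 by exact/sub_thick/ltW.
have lK2 := lebesgue_rV_compact cK2.
(* The two approximation errors together: the first summand comes from the bounded difference
   quotients, the second from the limit. *)
pose C := M * fine (leb K2) + \int[leb]_(x in K2) `|g x|.
have C0 : 0 <= C.
  apply: addr_ge0; last by apply: Rintegral_ge0.
  by apply: mulr_ge0 => //; exact: fine_ge0.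
apply/cvgrPdist_le => /= eps eps0.
have eps1 : 0 < eps / 2 / (C + 1) by rewrite !divr_gt0// ltr_pwDr.
have [psi [spsi psi0 psichi]] := smooth_dense cK cchi chi0 r20 eps1.
have cpsi := Ck_continuous (spsi 0%N).
have mpsi := continuous_measurable_rV cpsi.
have mchi := continuous_measurable_rV cchi.
have [Cp _ hCp] := bounded_support cK2 cpsi psi0.
have chi02 x : ~ K2 x -> chi x = 0 by move=> h; apply: chi0 => /KK2.
have [Cc _ hCc] := bounded_support cK cchi chi0.
have bpsi : exists M, forall x, `|psi x| <= M by exists Cp.
have bchi : exists M, forall x, `|chi x| <= M by exists Cc.
have tpsi : test_function U psi by split => //; exists K2; split.
have := @cvg_diff_quotient R n w psi K2 r2 e cK2 r20 mw (intw _ (compact_thick cK2) K2U) (spsi 1%N) psi0.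
rewrite wgE// opprK => /cvgrPdist_le /(_ (eps / 2)).
rewrite divr_gt0// => /(_ isT) cvgpsi.
near=> t.
have t0 : t != 0 by near: t; exact: nbhs_dnbhs_neq.
have tr : `|t *: e| < r2.
  have tr4 : `|t *: e| <= r2 / 2.
    by near: t; apply: near_scale; rewrite divr_gt0.
  by rewrite (le_lt_trans tr4)// ltr_pdivrMr// ltr_pMr// ltr1n.
have hpsi : `|\int[leb]_x (g x * psi x) - t^-1 *
   (\int[leb]_x (w x * psi (x - t *: e)) - \int[leb]_x (w x * psi x))| <= eps / 2.
  by near: t.
have iw1 := integrable_shift cK2 (ltW tr) mw (intw _ (compact_thick cK2) K2U).
have iw2 := integrable_support cK2 mw (intw _ cK2 K2U0).
have ig2 := integrable_support cK2 mg (intg _ cK2 K2U0).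
pose dw (x : V) := w (x + t *: e) - w x.
have mdw : measurable_fun setT dw.
  apply: measurable_funB => //; apply: (measurableT_comp mw).
  exact: measurable_translate.
have idw (c : V -> R) : measurable_fun setT c -> (exists M, forall x, `|c x| <= M) ->
    (forall x, ~ K2 x -> c x = 0) ->
    leb.-integrable setT (EFin \o (fun x => dw x * c x)).
  move=> mc bc c0; have := integrableB measurableT (iw1 _ mc bc c0) (iw2 _ mc bc c0).
  by apply: eq_integrable => // z _ /=; rewrite -EFinB mulrBl.
have dwle (x : V) : K2 x -> `|dw x| <= M * `|t|.
  move=> K2x; exact: (lipschitz_dir wg gM cw K2U).
have iK2 (c : R) : leb.-integrable K2 (EFin \o (fun=> c : R)).
  apply: measurable_bounded_integrable => //.
  exists `|c|; split; first exact: num_real.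
  by move=> x x1 y _ /=; exact: ltW.
have idwK : leb.-integrable K2 (EFin \o dw).
  apply: le_integrable (iK2 (M * `|t|)) => //.
    exact/measurable_EFinP/measurable_funTS.
  by move=> x /dwle h; rewrite lee_fin (le_trans h)// ler_norm.
pose d (x : V) := chi x - psi x.
have md : measurable_fun setT d by exact: measurable_funB.
have dle x : `|d x| <= eps / 2 / (C + 1) by rewrite distrC.
have d0 x : ~ K2 x -> d x = 0.
  by move=> nx; rewrite /d chi02// psi0// subrr.
have bd : exists M, forall x, `|d x| <= M by eexists.
rewrite Rintegral_shift// in hpsi.
have E1 : \int[leb]_x (w (x + t *: e) * psi x) - \int[leb]_x (w x * psi x) =
    \int[leb]_x (dw x * psi x).
  rewrite -RintegralB//; [|exact: iw1|exact: iw2].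
  by apply: eq_Rintegral => x _; rewrite -mulrBl.
rewrite E1 in hpsi.
have E2 : \int[leb]_x (dw x * chi x) = \int[leb]_x (dw x * psi x) + \int[leb]_x (dw x * d x).
  rewrite -RintegralD//; [|exact: idw|exact: idw].
  by apply: eq_Rintegral => x _; rewrite -mulrDr /d addrC subrK.
have E3 : \int[leb]_x (g x * chi x) = \int[leb]_x (g x * psi x) + \int[leb]_x (g x * d x).
  rewrite -RintegralD//; [|exact: ig2|exact: ig2].
  by apply: eq_Rintegral => x _; rewrite -mulrDr /d addrC subrK.
rewrite [X in _ * X]E2 E3.
set A := \int[leb]_x (g x * psi x) in hpsi *; set B := \int[leb]_x (dw x * psi x) in hpsi *.
set A' := \int[leb]_x (g x * d x); set B' := \int[leb]_x (dw x * d x).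
have -> : A + A' - t^-1 * (B + B') = (A - t^-1 * B) + (A' - t^-1 * B') by ring.
rewrite (splitr eps) (le_trans (ler_normD _ _))// lerD//.
have hA' : `|A'| <= eps / 2 / (C + 1) * \int[leb]_(x in K2) `|g x|.
  by apply: le_Rintegral_support => //; exact: intg.
have hB' : `|B'| <= eps / 2 / (C + 1) * (M * `|t| * fine (leb K2)).
  apply: le_trans (le_Rintegral_support cK2 mdw idwK md dle d0) _.
  rewrite ler_wpM2l ?(ltW eps1)// -Rintegral_cst//; apply: le_Rintegral => //.
  exact: integrable_norm.
apply: le_trans (ler_normB _ _) _; rewrite normrM.
have hB : `|t^-1| * `|B'| <= eps / 2 / (C + 1) * (M * fine (leb K2)).
  rewrite normfV mulrC ler_pdivrMr ?normr_gt0//.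
  by apply: le_trans hB' _; rewrite le_eqVlt; apply/orP; left; apply/eqP; ring.
apply: le_trans (lerD hA' hB) _.
rewrite -mulrDr [X in _ * X]addrC -/C mulrAC ler_pdivrMr ?ltr_pwDr//.
by rewrite ler_pM2l ?divr_gt0// lerDl.
Unshelve. all: by end_near.
Qed.

End chain_rule.

Section Rintegral_sum.
Context d (T : measurableType d) (R : realType) (mu : {measure set T -> \bar R}).
Variables (D : set T) (mD : measurable D) (I : Type) (P : pred I) (F : I -> T -> R).
Hypothesis iF : forall i, P i -> mu.-integrable D (EFin \o F i).

Lemma integrable_Rsum (s : seq I) :
  mu.-integrable D (EFin \o (fun x => \sum_(i <- s | P i) F i x)).
Proof.
elim: s => [|i s IH].
  by apply: eq_integrable (integrable0 _ _) => // x _ /=; rewrite big_nil.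
case: (boolP (P i)) => Pi; last first.
  by apply: eq_integrable IH => // x _ /=; rewrite big_cons (negbTE Pi).
apply: eq_integrable (integrableD mD (iF Pi) IH) => // x _ /=.
by rewrite big_cons Pi EFinD.
Qed.

Lemma Rintegral_sum (s : seq I) :
  \int[mu]_(x in D) (\sum_(i <- s | P i) F i x) =
  \sum_(i <- s | P i) \int[mu]_(x in D) F i x.
Proof.
elim: s => [|i s IH].
  by rewrite big_nil; under eq_Rintegral do rewrite big_nil;
    rewrite Rintegral_cst// mul0r.
under eq_Rintegral do rewrite big_cons.
rewrite big_cons; case: (boolP (P i)) => Pi; last by rewrite -IH.
rewrite -IH -RintegralD//; [exact: iF|exact: integrable_Rsum].
Qed.

End Rintegral_sum.

Lemma cvg_Rsum (R : realType) (T : Type) (F : set_system T) (FF : Filter F)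
    (I : Type) (s : seq I) (f : I -> T -> R) (a : I -> R) :
  (forall i, f i @ F --> a i) ->
  (fun t => \sum_(i <- s) f i t) @ F --> \sum_(i <- s) a i.
Proof.
move=> fa; elim: s => [|i s IH].
  by rewrite big_nil; under eq_fun do rewrite big_nil; exact: cvg_cst.
by rewrite big_cons; under eq_fun do rewrite big_cons; exact: cvgD.
Qed.

(** * Chain rule from a first-order expansion in increments *)

Section chain_rule.
Context {R : realType} {n : nat}.
Local Notation V := 'rV[R]_n.
Local Notation leb := (@lebesgue_rV R n).
Implicit Types (f g chi w : V -> R) (K U : set V) (e : V) (r M t : R).

(** Nothing is known of f off U, but there the product is 0 on a whole neighbourhood, since K is
    closed and contained in U. *)
Lemma continuous_cut U K f chi : open U -> compact K -> K `<=` U ->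
  (forall x, U x -> {for x, continuous f}) -> continuous chi ->
  (forall x, ~ K x -> chi x = 0) -> continuous (fun x => f x * chi x).
Proof.
move=> oU cK KU cf cchi chi0.
suff key (x : V) : {for x, continuous (fun x => f x * chi x)} by [].
have [Ux|nUx] := pselect (U x).
  by apply: (@cvgM _ _ (nbhs x)); [exact: cf|exact: cchi].
have nKx : ~ K x by move=> /KU.
have nK : \forall z \near x, 0 = f z * chi z.
  have : nbhs x (~` K).
    by apply: open_nbhs_nbhs; split => //; apply: closed_openC; exact: compact_closed.
  by apply: filterS => z /chi0 ->; rewrite mulr0.
rewrite /prop_for /continuous_at chi0// mulr0.
apply: (cvg_trans _ (@cst_continuous V R 0 x)); apply: near_eq_cvg; first exact: (nbhs_filter x).
exact: nK.
Qed.

Lemma integrable_continuous_on K f : compact K -> measurable_fun setT f ->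
  (forall x, K x -> {for x, continuous f}) -> leb.-integrable K (EFin \o f).
Proof.
move=> cK mf cf; apply: measurable_bounded_integrable.
- exact: compact_measurable_mx.
- exact: lebesgue_rV_compact.
- exact: measurable_funTS.
have : compact (f @` K).
  apply: continuous_compact => //; apply: continuous_in_subspaceT => x.
  by move=> /set_mem; exact: cf.
move=> /compact_bounded; rewrite /bounded_near/= => h.
apply: filterS h => M h x Kx; apply: h; by exists x.
Qed.

(** The assumed expansion of H uses increments of the [w l] in place of differentials, which suits
    products and compositions alike. Tested against psi and divided by t, the increment of H
    converges by discrete integration by parts, those of the [w l] by [cvg_diff_quotient_weak] with
    the continuous weight c l psi. *)
Lemma wderiv_chain N U e (w g c : 'I_N -> V -> R) (a H : V -> R) M psi :
  open U -> (forall l, wderiv U e (w l) (g l)) -> 0 <= M ->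
  (forall l, {ae leb, forall x, `|g l x| <= M}) ->
  (forall l z, U z -> {for z, continuous (w l)}) ->
  (forall l z, U z -> {for z, continuous (c l)}) ->
  (forall z, U z -> {for z, continuous a}) ->
  measurable_fun setT H -> (forall z, U z -> {for z, continuous H}) ->
  (forall x (eps : R), U x -> 0 < eps -> \forall z \near x & t \near (0 : R)^',
    `|H (z + t *: e) - H z - t * a z -
      \sum_l c l z * (w l (z + t *: e) - w l z)| <= eps * `|t|) ->
  test_function U psi ->
  \int[leb]_x (H x * 'D_e psi x) =
  - \int[leb]_x ((a x + \sum_l c l x * g l x) * psi x).
Proof.
move=> oU wg M0 gM cw cc ca mH cH HE [spsi [K [cK KU psi0]]].
have [r r0 KrU] := thick_sub cK oU KU.
have cKr := compact_thick (r := r) cK.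
have cpsi := Ck_continuous (spsi 0%N).
have mpsi := continuous_measurable_rV cpsi.
have bpsi : exists M, forall x, `|psi x| <= M.
  by have [Cp _ hCp] := bounded_support cK cpsi psi0; exists Cp.
have iH : leb.-integrable (thick K r) (EFin \o H).
  by apply: integrable_continuous_on => // x /KrU /cH.
have iHK : leb.-integrable K (EFin \o H).
  by apply: integrable_continuous_on => // x /KU /cH.
pose chi l x := c l x * psi x.
have cchi l : continuous (chi l) by apply: (continuous_cut oU cK KU) => // z; exact: cc.
have capsi : continuous (fun x => a x * psi x) by exact: (continuous_cut oU cK KU).
have chi0 l x : ~ K x -> chi l x = 0 by move=> /psi0; rewrite /chi => ->; rewrite mulr0.
have apsi0 x : ~ K x -> a x * psi x = 0 by move=> /psi0 ->; rewrite mulr0.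
have mchi l := continuous_measurable_rV (cchi l).
have mapsi := continuous_measurable_rV capsi.
have bchi l : exists M, forall x, `|chi l x| <= M.
  by have [Cp _ hCp] := bounded_support cK (cchi l) (chi0 l); exists Cp.
have bapsi : exists M, forall x, `|a x * psi x| <= M.
  by have [Cp _ hCp] := bounded_support cK capsi apsi0; exists Cp.
have iapsi : leb.-integrable setT (EFin \o (fun x => a x * psi x)) by exact: (integrable_cc cK).
have ipsi : leb.-integrable setT (EFin \o (fun x => `|psi x|)).
  by apply: integrable_norm; exact: (integrable_cc cK).
have igchi l : leb.-integrable setT (EFin \o (fun x => g l x * chi l x)).
  have [mw mg intw intg _] := wg l.
  exact: (integrable_support cK mg (intg _ cK KU) (mchi l) (bchi l) (chi0 l)).
have int_sum (F : 'I_N -> V -> R) : (forall l, leb.-integrable setT (EFin \o F l)) ->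
    leb.-integrable setT (EFin \o (fun x => \sum_l F l x)).
  by move=> iF; exact: integrable_Rsum.
have Rint_sum (F : 'I_N -> V -> R) : (forall l, leb.-integrable setT (EFin \o F l)) ->
    \int[leb]_x (\sum_l F l x) = \sum_l \int[leb]_x F l x.
  by move=> iF; exact: Rintegral_sum.
pose A t := t^-1 * (\int[leb]_x (H x * psi (x - t *: e)) - \int[leb]_x (H x * psi x)).
have A1 : A t @[t --> 0^'] --> - \int[leb]_x (H x * 'D_e psi x).
  exact: (@cvg_diff_quotient R n H psi K r e cK r0 mH iH (spsi 1%N) psi0).
pose B t := \int[leb]_x (a x * psi x) +
  \sum_l t^-1 * \int[leb]_x ((w l (x + t *: e) - w l x) * chi l x).
have B1 : B t @[t --> 0^'] --> \int[leb]_x (a x * psi x) + \sum_l \int[leb]_x (g l x * chi l x).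
  apply: (@cvgD _ _ _ (0^')); first exact: cvg_cst.
  apply: cvg_Rsum => l.
  exact: (cvg_diff_quotient_weak (wg l) M0 (gM l) (cw l) cK r0 KrU (cchi l) (chi0 l)).
(* The expansion error is a small multiple of |t| uniformly on K, so it stays small after division
   by t. *)
have AB : A t - B t @[t --> 0^'] --> (0 : R).
  apply/cvgr0Pnorm_le => eps eps0.
  pose I := \int[leb]_x `|psi x|.
  have I0 : 0 <= I by apply: Rintegral_ge0.
  have eps1 : 0 < eps / (I + 1) by rewrite divr_gt0// ltr_pwDr.
  have nearK : \forall t \near (0 : R)^', forall z, K z ->
    `|H (z + t *: e) - H z - t * a z -
      \sum_l c l z * (w l (z + t *: e) - w l z)| <= eps / (I + 1) * `|t|.
    have /compact_near_coveringP cov := cK.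
    by apply: cov => x Kx; apply: HE => //; exact: KU.
  near=> t.
  have t0 : t != 0 by near: t; exact: nbhs_dnbhs_neq.
  have tr : `|t *: e| <= r by near: t; exact: near_scale.
  have hK : forall z, K z -> `|H (z + t *: e) - H z - t * a z -
      \sum_l c l z * (w l (z + t *: e) - w l z)| <= eps / (I + 1) * `|t| by near: t.
  pose dH x := (H (x + t *: e) - H x) * psi x.
  pose dw l x := (w l (x + t *: e) - w l x) * chi l x.
  have idH : leb.-integrable setT (EFin \o dH).
    have i1 := integrable_shift cK tr mH iH mpsi bpsi psi0.
    have i2 := integrable_support cK mH iHK mpsi bpsi psi0.
    have := integrableB measurableT i1 i2.
    by apply: eq_integrable => // z _ /=; rewrite -EFinB -mulrBl.
  have idw l : leb.-integrable setT (EFin \o dw l).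
    have [mw mg intw intg _] := wg l.
    have i1 := integrable_shift cK tr mw (intw _ cKr KrU) (mchi l) (bchi l) (chi0 l).
    have i2 := integrable_support cK mw (intw _ cK KU) (mchi l) (bchi l) (chi0 l).
    have := integrableB measurableT i1 i2.
    by apply: eq_integrable => // z _ /=; rewrite -EFinB -mulrBl.
  have isdw := int_sum dw idw.
  have AE : A t = t^-1 * \int[leb]_x dH x.
    rewrite /A Rintegral_shift// -RintegralB//.
    - by congr (_ * _); apply: eq_Rintegral => x _; rewrite -mulrBl.
    - exact: (integrable_shift cK tr mH iH mpsi bpsi psi0).
    - exact: (integrable_support cK mH iHK mpsi bpsi psi0).
  pose rem x := dH x - t * (a x * psi x) - \sum_l dw l x.
  have i2 : leb.-integrable setT (EFin \o (fun x => t * (a x * psi x))).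
    exact: (integrableZl measurableT t iapsi).
  have i3 : leb.-integrable setT (EFin \o (fun x => dH x - t * (a x * psi x))).
    have := integrableB measurableT idH i2.
    by apply: eq_integrable => // z _ /=; rewrite -EFinB.
  have irem : leb.-integrable setT (EFin \o rem).
    have := integrableB measurableT i3 isdw.
    by apply: eq_integrable => // z _ /=; rewrite -EFinB.
  have ABE : A t - B t = t^-1 * \int[leb]_x rem x.
    rewrite AE /B /rem RintegralB// RintegralB// RintegralZl// Rint_sum//.
    rewrite -mulr_sumr !mulrBr mulKf//; ring.
  rewrite ABE normrM normfV mulrC ler_pdivrMr ?normr_gt0//.
  apply: le_trans (le_normr_Rintegral measurableT irem) _.
  apply: (@le_trans _ _ (\int[leb]_x (eps / (I + 1) * `|t| * `|psi x|))).
    apply: le_Rintegral => //.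
    - exact: integrable_norm.
    - exact: (integrableZl measurableT (eps / (I + 1) * `|t|) ipsi).
    move=> x _; have [Kx|nKx] := pselect (K x); last first.
      have -> : rem x = 0.
        rewrite /rem /dH /dw psi0// !mulr0 subr0 big1 ?subrr// => l _.
        by rewrite chi0 ?mulr0.
      by rewrite psi0// !normr0 mulr0.
    have -> : rem x = (H (x + t *: e) - H x - t * a x -
      \sum_l c l x * (w l (x + t *: e) - w l x)) * psi x.
      rewrite /rem /dH /dw /chi !mulrBl mulr_suml mulrA; congr (_ - _).
      by apply: eq_bigr => l _; ring.
    by rewrite normrM ler_wpM2r//; exact: hK.
  rewrite RintegralZl// -/I mulrAC ler_wpM2r//.
  by rewrite mulrAC ler_pdivrMr ?ltr_pwDr// ler_pM2l// lerDl.
have E := cvg_unique (@Rhausdorff R) (cvgB A1 B1) AB.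
rewrite -[LHS]opprK (subr0_eq (E _ _)).
congr (- _); rewrite -Rint_sum// -RintegralD//; last exact: int_sum.
apply: eq_Rintegral => x _; rewrite mulrDl mulr_suml; congr (_ + _).
by apply: eq_bigr => l _; rewrite /chi; ring.
Unshelve. all: by end_near.
Qed.

End chain_rule.

(** * Chain rule for [weak_partial] on an open set *)

Section weak_partial_calculus.
Context {R : realType} {n : nat}.
Local Notation V := 'rV[R]_n.
Local Notation leb := (@lebesgue_rV R n).
Implicit Types (f g w : V -> R) (K U : set V) (M : R).

Lemma Rintegral_patch_mul U f g :
  \int[leb]_(x in U) (f x * g x) = \int[leb]_x ((f \_ U) x * g x).
Proof.
rewrite Rintegral_mkcond; apply: eq_Rintegral => x _.
by rewrite !patchE; case: ifP => // _; rewrite mul0r.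
Qed.

(** Extension by 0 gives translates a meaning; the conditions only see compact subsets of U and test
    functions supported there. *)
Lemma weak_partial_wderiv U (m : 'I_n) f g : open U -> weak_partial U m f g ->
  wderiv U 'e_m (f \_ U) (g \_ U).
Proof.
move=> oU [[mf intf] [mg intg] fg]; have mU := open_measurable_mx oU.
split.
- exact/(measurable_restrictT _ mU).
- exact/(measurable_restrictT _ mU).
- move=> K cK KU; have := intf K cK KU; apply: eq_integrable.
    exact: compact_measurable_mx.
  by move=> x xK /=; rewrite patchE mem_set//; exact/KU/set_mem.
- move=> K cK KU; have := intg K cK KU; apply: eq_integrable.
    exact: compact_measurable_mx.
  by move=> x xK /=; rewrite patchE mem_set//; exact/KU/set_mem.
- by move=> psi /fg; rewrite (Rintegral_patch_mul U f) (Rintegral_patch_mul U g).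
Qed.

Lemma patch_continuous_at U f x : open U -> U x -> {for x, continuous f} ->
  {for x, continuous (f \_ U)}.
Proof.
move=> oU Ux cf; have nU : \forall z \near x, f z = (f \_ U) z.
  have : nbhs x U by apply: open_nbhs_nbhs; split.
  by apply: filterS => z Uz; rewrite patchE mem_set.
rewrite /prop_for /continuous_at patchE mem_set//.
by apply: (cvg_trans _ cf); apply: near_eq_cvg; [exact: (nbhs_filter x)|exact: nU].
Qed.

Lemma continuous_on_measurable U f : open U ->
  (forall x, U x -> {for x, continuous f}) -> measurable_fun U f.
Proof.
move=> oU cf; apply: (measurability _ (RGenOpens.measurableE R)).
move=> _ [_ [a [b ->] <-]].
suff : open (U `&` f @^-1` `]a, b[%classic : set V) by exact: open_measurable_mx.
rewrite openE => x [Ux fx]; apply: filterI.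
  by apply: open_nbhs_nbhs; split.
by apply: (cf x Ux); apply: open_nbhs_nbhs; split => //; exact: interval_open.
Qed.

Lemma near_translate U (e x : V) : open U -> U x ->
  \forall z \near x & t \near (0 : R)^', U (z + t *: e).
Proof.
move=> oU Ux; have /nbhs_ballP[d /= d0 dU] : nbhs x U by apply: open_nbhs_nbhs; split.
have d2 : 0 < d / 2 by rewrite divr_gt0.
exists (ball x (d / 2), [set t | `|t *: e| <= d / 2]) => /=.
  by split; [exact: nbhsx_ballx|exact: near_scale].
move=> [z t] /= []; rewrite -ball_normE/= => xz te; apply: dU.
rewrite -ball_normE/= opprD addrA (splitr d) (le_lt_trans (ler_normB _ _))//.
exact: ltr_leD.
Qed.

(** Here z and t vary together, as in the expansion of the chain rule. One half of r is for z, and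
    halving again makes the bound on t e_m strict. *)
Lemma near_lipschitz U (m : 'I_n) w g M x : open U -> weak_partial U m w g ->
  {ae leb, forall z, U z -> `|g z| <= M} -> 0 <= M ->
  (forall z, U z -> {for z, continuous w}) -> U x ->
  \forall z \near x & t \near (0 : R)^',
    `|w (z + t *: 'e_m) - w z| <= M * `|t|.
Proof.
move=> oU wg gM M0 cw Ux; have wd := weak_partial_wderiv oU wg.
have xU : [set x] `<=` U by move=> _ ->.
have [r r0 rU] := thick_sub (@compact_set1 _ x) oU xU.
have r2 : 0 < r / 2 by rewrite divr_gt0.
have r4 : 0 < r / 2 / 2 by rewrite divr_gt0.
have sub : thick (thick [set x] (r / 2)) (r / 2) `<=` U.
  move=> z [z' [_ /= -> xz] zz']; apply: rU; exists x => //.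
  rewrite -(subrK z' z) -addrA (splitr r) (le_trans (ler_normD _ _))//.
  by rewrite lerD.
exists (ball x (r / 2), [set t | `|t *: ('e_m : V)| <= r / 2 / 2]) => /=.
  by split; [exact: nbhsx_ballx|exact: near_scale].
move=> [z t] /= [] xz te.
have zK : thick [set x] (r / 2) z.
  by exists x => //; move: xz; rewrite -ball_normE/= distrC => /ltW.
have te2 : `|t *: ('e_m : V)| < r / 2.
  by apply: (le_lt_trans te); rewrite ltr_pdivrMr// ltr_pMr// ltr1n.
have Uz : U z by apply: sub; exact: (sub_thick (ltW r2)).
have Uzt : U (z + t *: 'e_m).
  by apply: sub; exists z => //; rewrite addrAC subrr add0r ltW.
have aeM : {ae leb, forall x, `|(g \_ U) x| <= M}.
  apply: filterS gM => v h; rewrite patchE; case: ifPn => [/set_mem/h//|_].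
  by rewrite normr0.
have := lipschitz_dir wd aeM _ sub zK te2.
rewrite !patchE !mem_set//; apply => v Uv.
by apply: patch_continuous_at => //; exact: cw.
Qed.

Lemma weak_partial_chain N U (m : 'I_n) (w g c : 'I_N -> V -> R) (a H : V -> R) M :
  open U -> (forall l, weak_partial U m (w l) (g l)) -> 0 <= M ->
  (forall l, {ae leb, forall x, U x -> `|g l x| <= M}) ->
  (forall l z, U z -> {for z, continuous (w l)}) ->
  (forall l z, U z -> {for z, continuous (c l)}) ->
  (forall z, U z -> {for z, continuous a}) ->
  (forall z, U z -> {for z, continuous H}) ->
  (forall x (eps : R), U x -> 0 < eps -> \forall z \near x & t \near (0 : R)^',
    `|H (z + t *: 'e_m) - H z - t * a z -
      \sum_l c l z * (w l (z + t *: 'e_m) - w l z)| <= eps * `|t|) ->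
  weak_partial U m H (fun x => a x + \sum_l c l x * g l x).
Proof.
move=> oU wg M0 gM cw cc ca cH HE.
have mU := open_measurable_mx oU.
have wd l := weak_partial_wderiv oU (wg l).
have bK f K : compact K -> K `<=` U -> (forall z, U z -> {for z, continuous f}) ->
    leb.-integrable K (EFin \o f).
  move=> cK KU cf.
  have := @integrable_continuous_on R n K (f \_ U) cK.
  have mfU : measurable_fun setT (f \_ U).
    by apply/(measurable_restrictT _ mU); exact: continuous_on_measurable.
  move=> /(_ mfU) ifU; apply: eq_integrable (ifU _).
  - exact: compact_measurable_mx.
  - by move=> x xK /=; rewrite patchE mem_set//; exact/KU/set_mem.
  - by move=> x /KU Ux; apply: patch_continuous_at => //; exact: cf.
split.
- split; first exact: continuous_on_measurable.
  by move=> K cK KU; exact: bK.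
- split.
    apply: measurable_funD; first exact: continuous_on_measurable.
    apply: measurable_sum => l; apply: measurable_funM.
      by apply: continuous_on_measurable => // z; exact: cc.
    by have [_ [mg _] _] := wg l.
  move=> K cK KU; have mK := compact_measurable_mx cK.
  have iS : leb.-integrable K (EFin \o (fun x => \sum_l c l x * g l x)).
    apply: integrable_Rsum => // l _.
    have [_ [mg ig] _] := wg l.
    have : compact (c l @` K).
      apply: continuous_compact => //; apply: continuous_in_subspaceT => x.
      by move=> /set_mem /KU; exact: cc.
    move=> /compact_bounded cb.
    apply: (@integrableMr _ _ _ _ _ mK (c l) (EFin \o g l)) => //.
    - by apply: measurable_funS (continuous_on_measurable oU (cc l)).
    - rewrite /bounded_near/= in cb *; apply: filterS cb => B hB x Kx.
      by apply: hB; exists x.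
    - exact: ig.
  have := integrableD mK (bK a K cK KU ca) iS.
  by apply: eq_integrable => // x _ /=; rewrite EFinD.
- move=> psi tpsi.
  have aeM l : {ae leb, forall x, `|(g l \_ U) x| <= M}.
    apply: filterS (gM l) => v h; rewrite patchE; case: ifPn => [/set_mem/h//|_].
    by rewrite normr0.
  have mHU : measurable_fun setT (H \_ U).
    by apply/(measurable_restrictT _ mU); exact: continuous_on_measurable.
  have := @wderiv_chain R n N U 'e_m (fun l => w l \_ U) (fun l => g l \_ U) c a (H \_ U) M psi
    oU wd M0 aeM _ cc ca mHU _ _ tpsi.
  rewrite (Rintegral_patch_mul U H) (Rintegral_patch_mul U (fun x => a x + \sum_l c l x * g l x)) => ->.
  + congr (- _); apply: eq_Rintegral => x _.
    have [spsi [K [cK KU psi0]]] := tpsi.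
    have [Ux|nUx] := pselect (U x); last first.
      by rewrite psi0 ?mulr0// => /KU.
    rewrite patchE mem_set//; congr ((_ + _) * _).
    by apply: eq_bigr => l _; rewrite patchE mem_set.
  + by move=> l z Uz; apply: patch_continuous_at => //; exact: cw.
  + by move=> z Uz; apply: patch_continuous_at => //; exact: cH.
  move=> x eps Ux eps0.
  have h1 := HE x eps Ux eps0.
  have h2 := near_translate 'e_m oU Ux.
  have h3 : \forall z \near x & t \near (0 : R)^', U z.
    exists (U, setT) => /=; last by move=> [z t] [].
    by split; [apply: open_nbhs_nbhs; split|exact: filterT].
  apply: filterS2 (filterI h2 h3) h1 => -[z t] /= [Uzt Uz].
  move=> h; rewrite !patchE !mem_set//.
  by under eq_bigr do rewrite /= !patchE !mem_set//.
Qed.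

End weak_partial_calculus.

Section weak_partial_rules.
Context {R : realType} {n : nat}.
Local Notation V := 'rV[R]_n.
Local Notation leb := (@lebesgue_rV R n).
Implicit Types (f h : V -> R) (U : set V) (M : R).

Lemma near_abs (d : R) : 0 < d -> \forall t \near (0 : R)^', `|t| <= d.
Proof. by move=> d0; exact: dnbhs0_le. Qed.

(** The expansion error of f h is exactly the product of the two increments, at most (M |t|)^2 by
    the Lipschitz estimate. *)
Lemma weak_partial_mul U (m : 'I_n) f f' h h' M : open U ->
  weak_partial U m f f' -> weak_partial U m h h' -> 0 <= M ->
  {ae leb, forall x, U x -> `|f' x| <= M} ->
  {ae leb, forall x, U x -> `|h' x| <= M} ->
  (forall z, U z -> {for z, continuous f}) ->
  (forall z, U z -> {for z, continuous h}) ->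
  weak_partial U m (fun x => f x * h x) (fun x => h x * f' x + f x * h' x).
Proof.
move=> oU ff hh M0 fM hM cf ch.
have := @weak_partial_chain R n 2 U m
  (fun l => if l == 0 then f else h) (fun l => if l == 0 then f' else h')
  (fun l => if l == 0 then h else f) (fun=> 0) (fun x => f x * h x) M oU.
rewrite (_ : (fun x => 0 + _) = (fun x => h x * f' x + f x * h' x)); last first.
  by apply/funext => x; rewrite !big_ord_recl big_ord0 /= addr0 add0r.
apply => //.
- by move=> l; case: ifP.
- by move=> l; case: ifP.
- by move=> l; case: ifP.
- by move=> l; case: ifP.
- by move=> z _; exact: cst_continuous.
- by move=> z Uz; apply: (@cvgM _ _ (nbhs z)); [exact: cf|exact: ch].
move=> x eps Ux eps0.
have h1 := near_lipschitz oU ff fM M0 cf Ux.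
have h2 := near_lipschitz oU hh hM M0 ch Ux.
have e1 : 0 < eps / (M * M + 1) by rewrite divr_gt0// ltr_wpDl// mulr_ge0.
have h3 : \forall z \near x & t \near (0 : R)^', `|t| <= eps / (M * M + 1).
  exists (setT, [set t : R | `|t| <= eps / (M * M + 1)]) => /=.
    by split; [exact: filterT|exact: near_abs].
  by move=> [z t] [].
apply: filterS3 h1 h2 h3 => -[z t] /= d1 d2 d3.
rewrite !big_ord_recl big_ord0 /= addr0 mulr0 subr0.
rewrite (_ : _ - _ - _ = (f (z + t *: 'e_m) - f z) * (h (z + t *: 'e_m) - h z)); last by ring.
rewrite normrM (@le_trans _ _ (M * `|t| * (M * `|t|)))//; first exact: ler_pM.
rewrite mulrACA mulrA ler_wpM2r//.
apply: (@le_trans _ _ ((M * M + 1) * `|t|)); first by rewrite ler_wpM2r// lerDl.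
by rewrite mulrC -ler_pdivlMr// ltr_wpDl// mulr_ge0.
Qed.

(** The derivative is taken at q and not at the starting point p, so that all steps of a polygonal
    path can be compared with derivatives at one common point. *)
Lemma C1_uniform (W : normedModType R) (phi : W -> R) (v p0 : W) (eps : R) :
  Ck 1 phi -> 0 < eps -> exists2 d, 0 < d & forall p q, `|p - p0| < d ->
    `|q - p0| < d -> forall s : R, `|p + s *: v - p0| < d ->
    `|phi (p + s *: v) - phi p - s * 'D_v phi q| <= eps * `|s|.
Proof.
move=> [cphi /(_ v)[dphi [cdphi _]]] eps0.
have e2 : 0 < eps / 2 by rewrite divr_gt0.
have /cvgrPdist_lt/(_ _ e2)/nbhs_ballP[d /= d0 dD] := cdphi p0.
exists d => // p q pd qd s psd.
have [th /andP[th0 th1] ->] := MVT_dir dphi p s.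
rewrite -mulrBr normrM mulrC ler_wpM2r//.
rewrite (splitr eps) (le_trans (ler_distD ('D_v phi p0) _ _))// lerD//; last first.
  by apply/ltW/dD; rewrite -ball_normE /ball_/= distrC.
rewrite distrC; apply/ltW/dD; rewrite -ball_normE /ball_/= distrC.
(* The intermediate point is a convex combination of p and p + s v, so it stays in the ball. *)
rewrite (_ : _ - p0 = (1 - th) *: (p - p0) + th *: (p + s *: v - p0)); last first.
  rewrite scalerBl scale1r.
  rewrite (_ : p + s *: v - p0 = (p - p0) + s *: v); last by rewrite addrAC.
  by rewrite [th *: (p - p0 + _)]scalerDr scalerA addrA subrK addrAC.
apply: le_lt_trans (ler_normD _ _) _; rewrite !normrZ (ger0_norm th0) ger0_norm ?subr_ge0//.
have [->|th_neq] := eqVneq th 0; first by rewrite subr0 mul1r mul0r addr0.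
have thp : 0 < th by rewrite lt_neqAle eq_sym th_neq.
rewrite (_ : d = (1 - th) * d + th * d); last by rewrite -mulrDl subrK mul1r.
by rewrite ler_ltD// ?ltr_pM2l// ler_wpM2l ?subr_ge0// ltW.
Qed.

End weak_partial_rules.

(** * Composition of a C^1 function with the graph of y *)

Section composition.
Context {R : realType} {n ny : nat}.
Local Notation V := 'rV[R]_n.
Local Notation leb := (@lebesgue_rV R n).

(** A path from a to b that replaces one coordinate at a time, so that directional derivatives along
    basis vectors suffice. *)
Definition mix (a b : 'rV[R]_ny) (k : nat) : 'rV[R]_ny :=
  \row_l (if (l < k)%N then b 0 l else a 0 l).

Lemma mix0 a b : mix a b 0 = a.
Proof. by apply/rowP => l; rewrite mxE. Qed.

Lemma mix_all a b : mix a b ny = b.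
Proof. by apply/rowP => l; rewrite mxE ltn_ord. Qed.

Lemma mixS a b (k : 'I_ny) : mix a b k.+1 = mix a b k + (b 0 k - a 0 k) *: 'e_k.
Proof.
apply/rowP => l; rewrite !mxE ltnS leq_eqVlt.
have [->|lk] := eqVneq l k; first by rewrite eqxx ltnn mulr1 addrC subrK.
by rewrite (inj_eq val_inj) (negbTE lk) /= mulr0 addr0.
Qed.

Lemma mix_norm a b c k d : `|a - c| < d -> `|b - c| < d -> `|mix a b k - c| < d.
Proof.
move=> ac bc; have d0 : 0 < d by exact: le_lt_trans ac.
rewrite [ltLHS]/Num.norm/= mx_normrE; apply/bigmax_ltP; split => // -[i j] _.
rewrite ord1 !mxE/=; case: ifP => _.
  by apply: le_lt_trans bc; have := ler_coord_norm (b - c) 0 j; rewrite !mxE.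
by apply: le_lt_trans ac; have := ler_coord_norm (a - c) 0 j; rewrite !mxE.
Qed.

(** The increment of phi along the graph splits into one step in x and ny steps in single
    coordinates of y. Each is linear up to a small multiple of its length, and the steps in y are at
    most M |t| by the Lipschitz estimate. *)
Lemma weak_partial_comp (U : set V) (m : 'I_n) (phi : V * 'rV[R]_ny -> R)
    (y : V -> 'rV[R]_ny) (Dy : V -> 'M[R]_(ny, n)) M :
  open U -> (forall l, weak_partial U m (fun x => y x 0 l) (fun x => Dy x l m)) ->
  0 <= M -> (forall l, {ae leb, forall x, U x -> `|Dy x l m| <= M}) ->
  (forall z, U z -> {for z, continuous y}) -> Ck 1 phi ->
  weak_partial U m (fun x => phi (x, y x))
    (fun x => total_partial phi m (x, y x, Dy x)).
Proof.
move=> oU yD M0 DM cy C1; have [cphi dphi] := C1.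
pose v0 : V * 'rV[R]_ny := ('e_m, 0).
pose v1 (l : 'I_ny) : V * 'rV[R]_ny := (0, 'e_l).
have cq z : U z -> {for z, continuous (fun x => (x, y x))}.
  move=> Uz; have c1 : x @[x --> z] --> z by exact: cvg_id.
  exact: (cvg_pair c1 (cy z Uz)).
have cyl l z : U z -> {for z, continuous (fun x => y x 0 l)}.
  move=> Uz; apply: (@continuous_comp _ _ _ y (fun w : 'rV[R]_ny => w 0 l)).
    exact: cy.
  exact: coord_continuous.
have cD v z : U z -> {for z, continuous (fun x => 'D_v phi (x, y x))}.
  move=> Uz; apply: (@continuous_comp _ _ _ (fun x => (x, y x)) ('D_v phi)).
    exact: cq.
  by have [_ [+ _]] := dphi v; apply.
have := @weak_partial_chain R n ny U m (fun l x => y x 0 l) (fun l x => Dy x l m)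
  (fun l x => 'D_(v1 l) phi (x, y x)) (fun x => 'D_v0 phi (x, y x))
  (fun x => phi (x, y x)) M oU yD M0 DM cyl (fun l => cD (v1 l)) (cD v0).
rewrite (_ : (fun x => total_partial _ _ _) = (fun x => 'D_v0 phi (x, y x) +
  \sum_l 'D_(v1 l) phi (x, y x) * Dy x l m)); last first.
  apply/funext => x; rewrite /total_partial /=; congr (_ + _).
  by apply: eq_bigr => l _; rewrite mulrC.
apply.
  move=> z Uz; apply: (@continuous_comp _ _ _ (fun x => (x, y x)) phi).
    exact: cq.
  exact: cphi.
move=> x eps Ux eps0; pose p0 := (x, y x).
(* Each of the ny steps in y contributes an error with factor M, the step in x one with factor 1. *)
pose B := ny%:R * M + 1.
have B0 : 0 < B by rewrite ltr_wpDl// mulr_ge0.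
have e1 : 0 < eps / B by rewrite divr_gt0.
have := C1_uniform v0 p0 C1 e1; move=> [d0 d00 hd0].
have /fin_all_exists2 : forall l : 'I_ny, exists2 d, 0 < d & forall p q, `|p - p0| < d ->
    `|q - p0| < d -> forall s : R, `|p + s *: v1 l - p0| < d ->
    `|phi (p + s *: v1 l) - phi p - s * 'D_(v1 l) phi q| <= eps / B * `|s|.
  by move=> l; exact: C1_uniform.
move=> [d1 d10 hd1].
pose d := \big[Num.min/d0]_l d1 l.
have dd0 : d <= d0 by exact: bigmin_le_id.
have dd1 l : d <= d1 l by exact: bigmin_le.
have d_gt0 : 0 < d by apply/bigmin_gtP; split.
have cyx : \forall z \near x, `|y z - y x| < d.
  by have /cvgrPdist_lt/(_ _ d_gt0) := cy x Ux; apply: filterS => z; rewrite distrC.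
have /nbhs_ballP[e /= e0 eP] : \forall z \near x, `|z - x| < d /\ `|y z - y x| < d.
  apply: filterI => //; apply/nbhs_ballP; exists d => // z.
  by rewrite -ball_normE/= distrC.
have h1 : \forall z \near x & t \near (0 : R)^', ball x e z.
  exists (ball x e, setT) => /=; last by move=> [z t] [].
  by split; [exact: nbhsx_ballx|exact: filterT].
have h2 : \forall z \near x & t \near (0 : R)^', ball x e (z + t *: 'e_m).
  by apply: near_translate; [exact: ball_open|exact: ballxx].
have h3 : \forall z \near x & t \near (0 : R)^', forall l,
    `|y (z + t *: 'e_m) 0 l - y z 0 l| <= M * `|t|.
  have := @filter_forall (V * R)%type 'I_ny
    (fun l zt => `|y (zt.1 + zt.2 *: 'e_m) 0 l - y zt.1 0 l| <= M * `|zt.2|)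
    (filter_prod (nbhs x) (nbhs (0 : R)^')) _.
  apply=> l.
  exact: (near_lipschitz oU (yD l) (DM l) M0 (cyl l) Ux).
apply: filterS3 h1 h2 h3 => -[z t] /= /eP[zx yzx] /eP[ztx yztx] Lip.
set z' := z + t *: 'e_m in ztx yztx Lip *.
have norm_lt (a : V) (b : 'rV[R]_ny) : `|a - x| < d -> `|b - y x| < d -> `|(a, b) - p0| < d.
  by move=> ax bx; rewrite prod_normE/= gt_max ax bx.
have q0 : `|(z, y z) - p0| < d by exact: norm_lt.
pose P k := phi (z', mix (y z) (y z') k).
have tele : phi (z', y z') - phi (z', y z) = \sum_(l < ny) (P l.+1 - P l).
  rewrite -(big_mkord predT (fun l => P l.+1 - P l)) telescope_sumr//.
  by rewrite /P mix0 mix_all.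
have E0 : (z', y z) = (z, y z) + t *: v0.
  by rewrite /v0 /z'; congr pair; rewrite /= scaler0 addr0.
have E1 (l : 'I_ny) : (z', mix (y z) (y z') l.+1) = (z', mix (y z) (y z') l) + (y z' 0 l - y z 0 l) *: v1 l.
  by rewrite mixS /v1; congr pair; rewrite /= scaler0 addr0.
have r0 : `|phi (z', y z) - phi (z, y z) - t * 'D_v0 phi (z, y z)| <= eps / B * `|t|.
  rewrite E0; apply: hd0; rewrite -?E0; apply: lt_le_trans dd0 => //.
  exact: norm_lt.
have r1 (l : 'I_ny) : `|P l.+1 - P l - (y z' 0 l - y z 0 l) * 'D_(v1 l) phi (z, y z)| <= eps / B * (M * `|t|).
  apply: (@le_trans _ _ (eps / B * `|y z' 0 l - y z 0 l|)); last by rewrite ler_wpM2l// ltW.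
  rewrite /P E1; apply: hd1; rewrite -?E1; apply: lt_le_trans (dd1 l) => //; apply: norm_lt => //; exact: mix_norm.
rewrite (_ : _ - _ - _ - _ = (phi (z', y z) - phi (z, y z) - t * 'D_v0 phi (z, y z)) +
   \sum_(l < ny) (P l.+1 - P l - (y z' 0 l - y z 0 l) * 'D_(v1 l) phi (z, y z))); last first.
  rewrite sumrB -tele; under [X in _ - X = _]eq_bigr do rewrite mulrC.
  ring.
apply: le_trans (ler_normD _ _) _; apply: le_trans (lerD r0 (ler_norm_sum _ _ _)) _.
apply: (@le_trans _ _ (eps / B * `|t| + \sum_(l < ny) eps / B * (M * `|t|))).
  by rewrite lerD2l; apply: ler_sum => l _; exact: r1.
rewrite sumr_const card_ord -mulr_natl.
rewrite le_eqVlt; apply/orP; left; apply/eqP; rewrite /B; field.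
by rewrite gt_eqF.
Qed.

End composition.

(** * Occupation measures and charges *)

Section product_uniqueness.
Context {R : realType}.

Lemma rectangle_measure_unique d1 d2 (T1 : measurableType d1)
    (T2 : measurableType d2) (m1 m2 : {measure set (T1 * T2) -> \bar R}) :
  (forall A B, measurable A -> measurable B -> m1 (A `*` B) = m2 (A `*` B)) ->
  (m1 setT < +oo)%E -> forall C, measurable C -> m1 C = m2 C.
Proof.
move=> m12 m1oo; apply: (measure_unique
  [set A1 `*` A2 | A1 in measurable & A2 in measurable] (fun=> setT)) => //.
- exact: measurable_prod_measurableType.
- move=> _ _ [A1 mA1 [A2 mA2 <-]] [B1 mB1 [B2 mB2 <-]].
  by exists (A1 `&` B1); [exact: measurableI|exists (A2 `&` B2);
    [exact: measurableI|rewrite setXI]].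
- by move=> _; exists setT => //; exists setT => //; rewrite setXTT.
- by rewrite bigcup_const//; exists 0%N.
- by move=> _ [A mA [B mB <-]]; exact: m12.
Qed.

(** With the third factor fixed, the measure of a rectangle is a measure in its first factor, so
    uniqueness on rectangles is applied twice. *)
Lemma box_measure_unique d1 d2 d3 (T1 : measurableType d1)
    (T2 : measurableType d2) (T3 : measurableType d3)
    (m1 m2 : {measure set (T1 * T2 * T3) -> \bar R}) :
  (forall A B E, measurable A -> measurable B -> measurable E ->
    m1 (A `*` B `*` E) = m2 (A `*` B `*` E)) ->
  (m1 setT < +oo)%E -> forall C, measurable C -> m1 C = m2 C.
Proof.
move=> m12 m1oo; apply: rectangle_measure_unique => // A E mA mE.
have mTE : measurable ([set: T1 * T2] `*` E) by exact: measurableX.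
pose r (m : {measure set (T1 * T2 * T3) -> \bar R}) : {measure set (T1 * T2) -> \bar R} :=
  measure_function_pushforward__canonical__measure_function_Measure
    (mrestr m mTE) measurable_fst.
have rE m B : r m B = m (B `*` E).
  rewrite -[LHS]/(m (fst @^-1` B `&` ([set: T1 * T2] `*` E))); congr (m _).
  by apply/seteqP; split => [[p q]|[p q]] /=; [case=> ? []|case].
rewrite -!rE; apply: rectangle_measure_unique => //.
  by move=> B C mB mC; rewrite !rE; exact: m12.
rewrite rE; apply: le_lt_trans m1oo; apply: le_measure; rewrite ?inE//.
Qed.

End product_uniqueness.

(** On the part of A where v < 0 the integral of v is nonnegative by hypothesis, yet equals minus
    that of the negative part. *)
Lemma integral_funrneg_eq0 d (T : measurableType d) (R : realType)
    (m : {measure set T -> \bar R}) (v : T -> R) (A : set T) :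
  measurable A -> measurable_fun A v ->
  (forall B, measurable B -> B `<=` A -> 0 <= \int[m]_(x in B) (v x)%:E)%E ->
  (\int[m]_(x in A) (v^\- x)%:E = 0)%E.
Proof.
move=> mA mv v0.
pose B := A `&` v @^-1` `]-oo, 0[.
have mB : measurable B by apply: mv => //; exact: measurable_itv.
have BA : B `<=` A by move=> x [].
have -> : (\int[m]_(x in A) (v^\- x)%:E = \int[m]_(x in B) (v^\- x)%:E)%E.
  rewrite integral_mkcond [RHS]integral_mkcond; apply: eq_integral => x _.
  rewrite !patchE; have [Ax|nAx] := pselect (A x); last first.
    by rewrite memNset// memNset// => /BA.
  rewrite mem_set//; case: ifPn => // /negP xB.
  have : 0 <= v x.
    by rewrite leNgt; apply/negP => vx; apply: xB; rewrite inE; split => //=; rewrite in_itv.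
  by move=> vx; rewrite /funrneg max_r// oppr_le0.
apply/eqP; rewrite eq_le; apply/andP; split; last first.
  by apply: integral_ge0 => x _; rewrite lee_fin.
rewrite -oppe_ge0 -integral_ge0N; last by move=> x _; rewrite lee_fin.
rewrite (_ : (\int[m]_(x in B) - _)%E = (\int[m]_(x in B) (v x)%:E)%E); first exact: v0.
apply: eq_integral => x /set_mem[_ /=]; rewrite in_itv/= => vx.
by rewrite /= /funrneg max_l ?opprK// oppr_ge0 ltW.
Qed.

(** * Integration against a charge with a density *)

Section charge_density.
Context d (T : measurableType d) (R : realType).
Variables (nu : {charge set T -> \bar R}) (m : {measure set T -> \bar R}).

Lemma integral_density (h : T -> R) (mh : measurable_fun setT h)
    (h0 : forall x, 0 <= h x) (D : set T) (f : T -> R) :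
  measurable D -> measurable_fun D f ->
  (\int[density_measure m mh h0]_(x in D) (f x)%:E =
   \int[m]_(x in D) (f x * h x)%:E)%E.
Proof.
move=> mD mf; have mfE : measurable_fun D (EFin \o f) by exact/measurable_EFinP.
rewrite [LHS]integralE [RHS]integralE; congr (_ - _)%E.
  rewrite (ge0_integral_density m mh h0)//; last exact: measurable_funepos.
  apply: eq_integral => x _; rewrite !funeposE -!EFin_max -EFinM.
  by congr EFin; rewrite maxr_pMl// mul0r.
rewrite (ge0_integral_density m mh h0)//; last exact: measurable_funeneg.
apply: eq_integral => x _; rewrite !funenegE -!EFinN -!EFin_max -EFinM.
by congr EFin; rewrite maxr_pMl// mul0r mulNr.
Qed.

Variables (D : set T) (mD : measurable D) (u : T -> R).
Hypotheses (intu : m.-integrable D (EFin \o u)) (nuE : has_density nu m D u).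

Let mu : measurable_fun D u.
Proof. by apply/measurable_EFinP; exact: measurable_int intu. Qed.

(** The Hahn sets P and N need not be the sign sets of u, but within D the negative part of u
    vanishes a.e. on P and the positive part a.e. on N. So the Jordan parts have densities u^+ on P
    and u^- on N, whose difference is u a.e. *)
Lemma Rintegral_charge (f : T -> R) : measurable_fun D f ->
  m.-integrable D (EFin \o (fun x => f x * u x)) ->
  let PN := svalP (cid (ex_hahn nu)) in
  \int[jordan_pos PN]_(x in D) f x - \int[jordan_neg PN]_(x in D) f x =
  \int[m]_(x in D) (f x * u x).
Proof.
move=> mf intfu PN; have [[mP posP] [mN negN] PNT PN0] := PN.
set P := (sval _).1 in mP posP PNT PN0 *; set N := (sval _).2 in mN negN PNT PN0 *.
have mPD : measurable (P `&` D) by exact: measurableI.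
have mND : measurable (N `&` D) by exact: measurableI.
pose up := u^\+ \_ (P `&` D); pose un := u^\- \_ (N `&` D).
have mupD : measurable_fun D u^\+ by exact: measurable_funrpos.
have munD : measurable_fun D u^\- by exact: measurable_funrneg.
have mup : measurable_fun setT up.
  apply/(measurable_restrictT _ mPD); exact: measurable_funS mupD.
have mun : measurable_fun setT un.
  apply/(measurable_restrictT _ mND); exact: measurable_funS munD.
have up0 x : 0 <= up x by rewrite /up patchE; case: ifP.
have un0 x : 0 <= un x by rewrite /un patchE; case: ifP.
have intup : m.-integrable D (EFin \o u^\+) by exact: integrable_funrpos.
have intun : m.-integrable D (EFin \o u^\-) by exact: integrable_funrneg.
have iS A h : measurable A -> A `<=` D -> m.-integrable D h -> m.-integrable A h.
  by move=> mA AD; exact: integrableS.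
have nuD A : measurable A -> A `<=` D -> (\int[m]_(x in A) (u x)%:E = nu A)%E.
  by move=> mA AD; rewrite nuE// setIidl.
have negP A : measurable A -> A `<=` P `&` D -> (\int[m]_(x in A) (u^\- x)%:E = 0)%E.
  move=> mA APD; apply: integral_funrneg_eq0 => //.
    by apply: measurable_funS mu => // x /APD[].
  move=> B mB BA; rewrite nuD//; last by move=> x /BA/APD[].
  by apply: posP => // x /BA/APD[].
have posN A : measurable A -> A `<=` N `&` D -> (\int[m]_(x in A) (u^\+ x)%:E = 0)%E.
  move=> mA AND; rewrite -funrnegN; apply: integral_funrneg_eq0 => //.
    by apply: measurableT_comp => //; apply: measurable_funS mu => // x /AND[].
  move=> B mB BA; have BD : B `<=` D by move=> x /BA/AND[].
  under eq_integral do rewrite EFinN.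
  rewrite integralN; last by apply: integrable_add_def => //; exact: iS intu.
  rewrite nuD// oppe_ge0.
  by apply: negN => // x /BA/AND[].
have splitA A : measurable A -> A `<=` D -> (\int[m]_(x in A) (u x)%:E =
    \int[m]_(x in A) (u^\+ x)%:E - \int[m]_(x in A) (u^\- x)%:E)%E.
  move=> mA AD; rewrite -integralB_EFin//; [|exact: iS..].
  by apply: eq_integral => x _; rewrite -[u in LHS]funrposBneg.
have posE A : measurable A -> jordan_pos PN A = density_measure m mup up0 A.
  move=> mA; rewrite jordan_posE cjordan_posE /crestr0 mem_set// /crestr nuE; last exact: measurableI.
  rewrite -setIA splitA; [|exact: measurableI|by move=> x [_ []]].
  rewrite negP ?sube0; [|exact: measurableI|exact: subIsetr].
  by rewrite integral_mkcondr restrict_EFin.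
have negE A : measurable A -> jordan_neg PN A = density_measure m mun un0 A.
  move=> mA; rewrite jordan_negE cjordan_negE /crestr0 mem_set// /crestr nuE; last exact: measurableI.
  rewrite -setIA splitA; [|exact: measurableI|by move=> x [_ []]].
  rewrite posN ?sub0e ?oppeK; [|exact: measurableI|exact: subIsetr].
  by rewrite integral_mkcondr restrict_EFin.
have muf : measurable_fun D (fun x => f x * u x) by exact: measurable_funM.
have mupD' : measurable_fun D up by exact: measurable_funTS.
have munD' : measurable_fun D un by exact: measurable_funTS.
have ifv (v : T -> R) : measurable_fun D v -> (forall x, `|v x| <= `|u x|) ->
    m.-integrable D (EFin \o (fun x => f x * v x)).
  move=> mv vu; apply: (le_integrable mD _ _ intfu); first exact/measurable_EFinP/measurable_funM.
  by move=> x _; rewrite lee_fin !normrM ler_wpM2l.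
have uE' x : `|u x| = u^\+ x + u^\- x.
  by rewrite -[LHS]/((Num.norm \o u) x) -funrposDneg.
have ifup : m.-integrable D (EFin \o (fun x => f x * up x)).
  apply: ifv => // x; rewrite uE' ger0_norm// /up patchE.
  by case: ifP => _; [rewrite lerDl|exact: addr_ge0].
have ifun : m.-integrable D (EFin \o (fun x => f x * un x)).
  apply: ifv => // x; rewrite uE' ger0_norm// /un patchE.
  by case: ifP => _; [rewrite lerDr|exact: addr_ge0].
rewrite {1 2}/Rintegral.
rewrite (@eq_measure_integral _ _ _ D (density_measure m mup up0) (jordan_pos PN))//; last by move=> A mA _; exact: posE.
rewrite (@eq_measure_integral _ _ _ D (density_measure m mun un0) (jordan_neg PN))//; last by move=> A mA _; exact: negE.
rewrite !integral_density// -RintegralB//.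
have ae0 A (v : T -> R) : measurable A -> measurable_fun A v -> (forall x, 0 <= v x) ->
    (\int[m]_(x in A) (v x)%:E = 0)%E -> {ae m, forall x, A x -> v x = 0}.
  move=> mA mv v0 I0; have mvE : measurable_fun A (EFin \o v) by exact/measurable_EFinP.
  have [+ _] := ae_eq_integral_abs m mA mvE.
  have -> : (\int[m]_(x in A) `|(EFin \o v) x| = 0)%E.
    by rewrite -[RHS]I0; apply: eq_integral => x _ /=; rewrite ger0_norm.
  move=> /(_ erefl); apply: filterS => x h Ax.
  by have [] := h Ax.
have aeP := ae0 _ _ mPD (measurable_funS mD (@subIsetr _ _ _) munD) (funrneg_ge0 u) (negP _ mPD (@subset_refl _ _)).
have aeN := ae0 _ _ mND (measurable_funS mD (@subIsetr _ _ _) mupD) (funrpos_ge0 u) (posN _ mND (@subset_refl _ _)).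
apply: ae_eq_Rintegral => //.
  by apply: measurable_funB; exact: measurable_funM.
apply: filterS2 aeP aeN => x hP hN Dx.
rewrite -mulrBr; congr (_ * _); rewrite /up /un !patchE.
have uE : u x = u^\+ x - u^\- x by rewrite -[u in LHS]funrposBneg.
have : (P `|` N) x by rewrite PNT.
have [Px|nPx] := pselect (P x).
  have nNx : ~ N x by move=> Nx; have : (P `&` N) x by []; rewrite PN0.
  rewrite mem_set; last by split.
  rewrite memNset; last by case.
  by rewrite subr0 uE hP// subr0.
move=> [//|Nx]; rewrite memNset; last by case.
rewrite mem_set; last by split.
by rewrite sub0r uE hN// sub0r.
Qed.

End charge_density.

(** * Occupation measures as image measures *)

Section occupation.
Context {R : realType} {n ny : nat}.
Local Notation X := 'rV[R]_n.
Local Notation XYZ := ('rV[R]_n * 'rV[R]_ny * 'M[R]_(ny, n))%type.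
Variables (lambda : {measure set X -> \bar R}) (S : set X) (mS : measurable S)
  (Soo : (lambda S < +oo)%E).
Variables (Y : set 'rV[R]_ny) (mY : measurable Y)
  (Z : set 'M[R]_(ny, n)) (mZ : measurable Z).
Variables (y : X -> 'rV[R]_ny) (my : measurable_fun S y)
  (Dy : X -> 'M[R]_(ny, n)) (mDy : measurable_fun S Dy).
Hypotheses (yY : forall x, S x -> Y (y x))
  (DyZ : {ae lambda, forall x, S x -> Z (Dy x)}).
Variables (mu : {measure set XYZ -> \bar R})
  (muE : is_occupation_measure lambda S Y Z y Dy mu).

(** Patched by a default value off S, so that the map is measurable on the whole space and can be
    used for a pushforward. *)
Definition graph (x : X) : XYZ := (x, (y \_ S) x, (Dy \_ S) x).

Lemma graphE x : S x -> graph x = (x, y x, Dy x).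
Proof. by move=> Sx; rewrite /graph !patchE mem_set. Qed.

Lemma measurable_graph : measurable_fun setT graph.
Proof.
apply: measurable_fun_pair; last exact/(measurable_restrictT _ mS).
apply: measurable_fun_pair; first exact: measurable_id.
exact/(measurable_restrictT _ mS).
Qed.

Let mind : measurable_fun setT (\1_S : X -> R).
Proof. exact: measurable_indic. Qed.

Let ind0 x : 0 <= (\1_S x : R). Proof. by []. Qed.

Let m2 : {measure set XYZ -> \bar R} :=
  measure_function_pushforward__canonical__measure_function_Measure
    (density_measure lambda mind ind0) measurable_graph.

Let m2E A : measurable A -> m2 A = lambda (S `&` graph @^-1` A).
Proof.
move=> mA; rewrite -[LHS]/(\int[lambda]_(x in graph @^-1` A) (\1_S x)%:E)%E.
rewrite integral_indic//.
by rewrite -[X in measurable X]setTI; exact: measurable_graph.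
Qed.

(** The definition prescribes only boxes inside S x Y x Z. As the complement is null this settles
    all boxes, and a finite measure is determined by its boxes. *)
Lemma occupation_measureE C : measurable C -> mu C = lambda (S `&` graph @^-1` C).
Proof.
have [mu0 muABE] := muE.
have mW : measurable (S `*` Y `*` Z) by apply: measurableX => //; exact: measurableX.
have muI A : measurable A -> mu A = mu (A `&` (S `*` Y `*` Z)).
  move=> mA; apply/eqP; rewrite eq_le; apply/andP; split; last first.
    by apply: le_measure; rewrite ?inE//; exact: measurableI.
  rewrite -[leRHS]adde0 -mu0.
  apply: (@le_trans _ _ (mu (A `&` (S `*` Y `*` Z) `|` ~` (S `*` Y `*` Z)))).
    apply: le_measure; rewrite ?inE//.
      by apply: measurableU; [exact: measurableI|exact: measurableC].
    by move=> p Ap; have [Wp|nWp] := pselect ((S `*` Y `*` Z) p); [left|right].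
  by apply: measureU2; [exact: measurableI|exact: measurableC].
have eqm A B E : measurable A -> measurable B -> measurable E ->
    mu (A `*` B `*` E) = m2 (A `*` B `*` E).
  move=> mA mB mE; have mABE : measurable (A `*` B `*` E).
    by apply: measurableX => //; exact: measurableX.
  rewrite muI// m2E//.
  rewrite (_ : _ `&` _ = (A `&` S) `*` (B `&` Y) `*` (E `&` Z)); last first.
    by rewrite !setXI.
  rewrite muABE//; try exact: measurableI; try exact: subIsetr.
  have mAs : measurable ((A `&` S) `*` (B `&` Y) `*` (E `&` Z)).
    by apply: measurableX; [apply: measurableX|]; exact: measurableI.
  have mgr C' : measurable C' -> measurable (graph @^-1` C').
    by move=> mC; rewrite -[X in measurable X]setTI; exact: measurable_graph.
  rewrite (eq_integral (fun x => (\1_(graph @^-1` ((A `&` S) `*` (B `&` Y) `*` (E `&` Z))) x)%:E)); last first.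
    by move=> x /set_mem Sx; rewrite !indicE -(graphE Sx).
  rewrite integral_indic//; last exact: mgr.
  (* [Dy] lies in Z only off the null set [Nl], so intersecting E with Z may lose points of that
     set. *)
  have [Nl [mNl Nl0 subNl]] := DyZ.
  have mGW := mgr _ mABE; have mGs := mgr _ mAs.
  apply/eqP; rewrite eq_le; apply/andP; split.
    apply: le_measure; rewrite ?inE; [exact: measurableI|exact: measurableI|].
    by move=> x [[[[]]]] /= ? ? [] ? ? [] ? ? ?.
  rewrite -[leRHS]adde0 -Nl0.
  apply: le_trans (measureU2 lambda (measurableI _ _ mGs mS) mNl).
  apply: le_measure; rewrite ?inE; [exact: measurableI|by apply: measurableU => //; exact: measurableI|].
  move=> x [Sx [[/= Ax Bx] Ex]]; have [Zx|nZx] := pselect (Z (Dy x)); last first.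
    by right; apply: subNl => /= /(_ Sx).
  left; split => //; move: Bx Ex; rewrite /= !patchE mem_set// => Bx Ex.
  by split => /=; [split; split => //=|split]; rewrite ?patchE ?mem_set//; exact: yY.
move=> mC; rewrite -m2E//; apply: box_measure_unique => //.
rewrite -setXTT -setXTT eqm// m2E//; last by rewrite !setXTT.
by rewrite !setXTT preimage_setT setIT.
Qed.

Lemma integral_occupation W (f : XYZ -> R) : measurable W -> measurable_fun W f ->
  (\int[mu]_(p in W) (f p)%:E =
   \int[lambda]_(x in S `&` graph @^-1` W) (f (graph x))%:E)%E.
Proof.
move=> mW mf; have mGW : measurable (graph @^-1` W).
  by rewrite -[X in measurable X]setTI; exact: measurable_graph.
rewrite (@eq_measure_integral _ _ _ W m2 mu); last first.
  by move=> A mA _; rewrite occupation_measureE// m2E.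
have mfE : measurable_fun W (EFin \o f) by exact/measurable_EFinP.
have mfg : measurable_fun (graph @^-1` W) (f \o graph).
  apply: (@measurable_comp _ _ _ _ _ _ W) => //; first by move=> _ [x Wx <-].
  exact: measurable_funTS measurable_graph.
have := integral_pushforward_mfun measurable_graph (density_measure lambda mind ind0) mW mfE.
move=> ->.
rewrite (integral_density lambda mind ind0 mGW mfg) setIC integral_mkcondr restrict_EFin.
apply: eq_integral => x _; congr EFin; rewrite patchE indicE /=.
by case: ifP => _; rewrite ?mulr1 ?mulr0.
Qed.

Lemma Rintegral_ae_domain D A (g : X -> R) : measurable D -> measurable A ->
  A `<=` D -> measurable_fun D g -> {ae lambda, forall x, D x -> A x} ->
  \int[lambda]_(x in A) g x = \int[lambda]_(x in D) g x.
Proof.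
move=> mD mA AD mg aeA; rewrite -[in LHS](setIidr AD) Rintegral_mkcondr.
have mDA : measurable (D `&` A) by exact: measurableI.
apply: ae_eq_Rintegral => //.
  apply/(measurable_restrict g mA mD).
  by apply: measurable_funS mg => //; exact: subIsetr.
by apply: filterS aeA => x h Dx; rewrite patchE mem_set//; exact: h.
Qed.

(** Measurability of f is asked only above D, because the normal is measurable only on the
    boundary. *)
Lemma Rintegral_occupation D (f : XYZ -> R) : measurable D -> D `<=` S ->
  measurable_fun (D `*` setT `*` setT) f ->
  \int[mu]_(p in D `*` Y `*` Z) f p = \int[lambda]_(x in D) f (x, y x, Dy x).
Proof.
move=> mD DS mf.
have mW : measurable (D `*` Y `*` Z) by apply: measurableX => //; exact: measurableX.
have mT : measurable (D `*` setT `*` setT : set XYZ) by apply: measurableX => //; exact: measurableX.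
have mfW : measurable_fun (D `*` Y `*` Z) f.
  by apply: measurable_funS mf => // -[[x a] b] [[]].
rewrite /Rintegral integral_occupation//.
have mGW : measurable (S `&` graph @^-1` (D `*` Y `*` Z)).
  apply: measurableI => //.
  by rewrite -[X in measurable X]setTI; exact: measurable_graph.
have mfD : measurable_fun D (fun x => f (graph x)).
  apply: (@measurable_comp _ _ _ _ _ _ (D `*` setT `*` setT)) => //.
    by move=> _ [x Dx <-].
  exact: measurable_funTS measurable_graph.
rewrite -[LHS]/(\int[lambda]_(x in S `&` graph @^-1` (D `*` Y `*` Z)) f (graph x)).
rewrite (@Rintegral_ae_domain D _ (fun x => f (graph x)))//.
- by apply: eq_Rintegral => x /set_mem /DS Sx; rewrite graphE.
- by move=> x [Sx [[]]].
- apply: filterS DyZ => x h Dx; have Sx := DS _ Dx; split => //=.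
  by split => //=; [split => //=|]; rewrite !patchE mem_set//; [exact: yY|exact: h].
Qed.

Lemma integral_marginal D (g : 'rV[R]_n * 'rV[R]_ny -> R) : measurable D ->
  D `<=` S -> measurable_fun (D `*` Y) g ->
  (\int[xy_marginal mu]_(q in D `*` Y) (g q)%:E =
   \int[lambda]_(x in D) (g (x, y x))%:E)%E.
Proof.
move=> mD DS mg.
have mDY : measurable (D `*` Y) by exact: measurableX.
have mgE : measurable_fun (D `*` Y) (EFin \o g) by exact/measurable_EFinP.
have := integral_pushforward_mfun measurable_fst mu mDY mgE.
rewrite -/(xy_marginal mu) => -> /=.
have mW : measurable (fst @^-1` (D `*` Y) : set XYZ).
  by rewrite -[X in measurable X]setTI; exact: measurable_fst.
rewrite (@integral_occupation _ (fun p => g p.1))//; last first.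
  apply: (@measurable_comp _ _ _ _ _ _ (D `*` Y)) => //; first by move=> _ [x Wx <-].
  exact: measurable_funTS measurable_fst.
rewrite (_ : S `&` _ = D).
  by apply: eq_integral => x /set_mem /DS Sx; rewrite /= patchE mem_set.
apply/seteqP; split => [x [_ []]//|x Dx]; split; first exact: DS.
by split => //=; rewrite patchE mem_set//; [exact/yY/DS|exact: DS].
Qed.

Lemma integrable_marginal D (g : 'rV[R]_n * 'rV[R]_ny -> R) : measurable D ->
  D `<=` S -> measurable_fun (D `*` Y) g ->
  lambda.-integrable D (EFin \o (fun x => g (x, y x))) ->
  (xy_marginal mu).-integrable (D `*` Y) (EFin \o g).
Proof.
move=> mD DS mg /integrableP[_ goo]; apply/integrableP; split.
  exact/measurable_EFinP.
rewrite (@integral_marginal _ (fun q => `|g q|))//.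
exact: measurableT_comp.
Qed.

Lemma Rintegral_marginal D (g : 'rV[R]_n * 'rV[R]_ny -> R) : measurable D ->
  D `<=` S -> measurable_fun (D `*` Y) g ->
  \int[xy_marginal mu]_(q in D `*` Y) g q = \int[lambda]_(x in D) g (x, y x).
Proof. by move=> mD DS mg; rewrite /Rintegral integral_marginal. Qed.

End occupation.

(** * Essentially bounded functions and polynomials *)

Section Linfty_algebra.
Context {R : realType} d (T : measurableType d) (mu : {measure set T -> \bar R}).
Variable (D : set T).
Implicit Types (f g : T -> R).
Local Notation Linfty := (Linfty mu D).

Lemma Linfty_cst (c : R) : Linfty (cst c).
Proof. by split; [exact: measurable_cst|exists `|c|; apply: aeW]. Qed.

Lemma Linfty_add f g : Linfty f -> Linfty g -> Linfty (f \+ g).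
Proof.
move=> [mf [M fM]] [mg [N gN]]; split; first exact: measurable_funD.
exists (M + N); apply: filterS2 fM gN => x fx gx Dx.
by apply: le_trans (ler_normD _ _) _; apply: lerD; [exact: fx|exact: gx].
Qed.

Lemma Linfty_mul f g : Linfty f -> Linfty g -> Linfty (f \* g).
Proof.
move=> [mf [M fM]] [mg [N gN]]; split; first exact: measurable_funM.
exists (M * N); apply: filterS2 fM gN => x fx gx Dx.
by rewrite normrM ler_pM//; [exact: fx|exact: gx].
Qed.

Lemma Linfty_sum (I : Type) (s : seq I) (P : pred I) (f : I -> T -> R) :
  (forall i, P i -> Linfty (f i)) -> Linfty (fun x => \sum_(i <- s | P i) f i x).
Proof.
move=> h; elim: s => [|i s IH].
  by under eq_fun do rewrite big_nil; exact: Linfty_cst.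
under eq_fun do rewrite big_cons.
by case: (boolP (P i)) => // Pi; apply: Linfty_add => //; exact: h.
Qed.

Lemma Linfty_ae f g : measurable_fun D g ->
  {ae mu, forall x, D x -> f x = g x} -> Linfty f -> Linfty g.
Proof.
move=> mg fg [_ [M fM]]; split => //; exists M.
by apply: filterS2 fg fM => x fgx fx Dx; rewrite -fgx//; exact: fx.
Qed.

Lemma Linfty_integrable f : measurable D -> (mu D < +oo)%E -> Linfty f ->
  mu.-integrable D (EFin \o f).
Proof.
move=> mD Doo [mf [M fM]]; have mfE : measurable_fun D (EFin \o f).
  exact/measurable_EFinP.
apply/integrableP; split => //.
apply: (@le_lt_trans _ _ (\int[mu]_(x in D) (cst `|M|%:E) x)%E).
  apply: ae_ge0_le_integral => //; first exact: measurableT_comp.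
    by move=> x _; rewrite lee_fin.
  by apply: filterS fM => x fx Dx; rewrite lee_fin (le_trans (fx Dx))// ler_norm.
by rewrite integral_cst// lte_mul_pinfty.
Qed.

End Linfty_algebra.

Lemma LinftyS d (T : measurableType d) (R : realType)
    (mu : {measure set T -> \bar R}) (D E : set T) (f : T -> R) :
  measurable D -> E `<=` D -> Linfty mu D f -> Linfty mu E f.
Proof.
move=> mD ED [mf [M fM]]; split; first exact: measurable_funS mf.
by exists M; apply: filterS fM => x fx /ED.
Qed.

(** Induction principle for polynomial functions; it yields their smoothness, measurability,
    continuity and boundedness along the graph. *)
Lemma meval_closed (R : realType) (T : Type) N (P : (T -> R) -> Prop)
    (v : T -> 'rV[R]_N) (p : mpoly.mpoly N R) :
  (forall c, P (cst c)) -> (forall f g, P f -> P g -> P (f \+ g)) ->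
  (forall f g, P f -> P g -> P (f \* g)) -> (forall i, P (fun x => v x 0 i)) ->
  P (fun x => mpoly.meval (v x 0) p).
Proof.
move=> Pc Padd Pmul Pv; under eq_fun do rewrite mpoly.mevalE.
elim: (mpoly.msupp p) => [|m s IH].
  by under eq_fun do rewrite big_nil; exact: Pc.
under eq_fun do rewrite big_cons.
apply: (Padd _ _) => //; apply: (Pmul _ _); first exact: Pc.
elim: (index_enum _) => [|i t IHt].
  by under eq_fun do rewrite big_nil; exact: Pc.
under eq_fun do rewrite big_cons.
apply: (Pmul _ _) => //; elim: (mpoly.fun_of_multinom m i) => [|k IHk].
  by under eq_fun do rewrite expr0; exact: Pc.
by under eq_fun do rewrite exprS; exact: Pmul.
Qed.

(** * Weak derivatives up to null sets *)

Section weak_partial_ae.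
Context {R : realType} {n : nat}.
Local Notation V := 'rV[R]_n.
Local Notation leb := (@lebesgue_rV R n).
Implicit Types (f g : V -> R) (U : set V).

Lemma weak_partial_ae U (m : 'I_n) f f' g g' : open U ->
  measurable_fun U f' -> measurable_fun U g' ->
  {ae leb, forall x, U x -> f x = f' x} ->
  {ae leb, forall x, U x -> g x = g' x} ->
  weak_partial U m f g -> weak_partial U m f' g'.
Proof.
move=> oU mf' mg' ff' gg' [[mf intf] [mg intg] fg].
have mU := open_measurable_mx oU.
have lint h h' : measurable_fun U h' -> {ae leb, forall x, U x -> h x = h' x} ->
    (forall K, compact K -> K `<=` U -> leb.-integrable K (EFin \o h)) ->
    loc_integrable U h'.
  move=> mh' hh' inth; split => // K cK KU.
  have /integrableP[mh hoo] := inth K cK KU.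
  have mK := compact_measurable_mx cK.
  have mhE : measurable_fun K (EFin \o h') by apply/measurable_EFinP; exact: measurable_funS mh'.
  apply/integrableP; split => //.
  rewrite (@ae_eq_integral _ _ _ _ _ (abse \o (EFin \o h)) _ mK)//.
  - exact: measurableT_comp.
  - exact: measurableT_comp.
  - by apply: filterS hh' => x hx Kx /=; rewrite hx//; exact: KU.
have test_meas psi e : test_function U psi ->
    measurable_fun U psi /\ measurable_fun U ('D_e psi).
  move=> [spsi _]; split; apply: measurable_funTS; apply: continuous_measurable_rV.
    exact: Ck_continuous (spsi 0%N).
  by have [_ /(_ e)[_ []]] := spsi 1%N.
split; [exact: lint ff' intf|exact: lint gg' intg|] => psi tpsi.
have [mpsi mdpsi] := test_meas _ 'e_m tpsi.
rewrite -(@ae_eq_Rintegral _ _ _ leb U (fun x => f x * 'D_('e_m) psi x) (fun x => f' x * 'D_('e_m) psi x))//; last first.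
- by apply: filterS ff' => x h Ux; rewrite h.
- exact: measurable_funM.
- exact: measurable_funM.
rewrite -(@ae_eq_Rintegral _ _ _ leb U (fun x => g x * psi x) (fun x => g' x * psi x))//; last first.
- by apply: filterS gg' => x h Ux; rewrite h.
- exact: measurable_funM.
- exact: measurable_funM.
exact: fg.
Qed.

Lemma weak_partial_unique U (m : 'I_n) f g1 g2 : open U ->
  weak_partial U m f g1 -> weak_partial U m f g2 ->
  {ae leb, forall x, U x -> g1 x = g2 x}.
Proof.
move=> oU wg1 wg2; have [_ [mg1 ig1] fg1] := wg1; have [_ [mg2 ig2] fg2] := wg2.
have mU := open_measurable_mx oU.
suff : {ae leb, forall x, U x -> (g1 \- g2) x = 0}.
  by apply: filterS => x h Ux; apply/eqP; rewrite -subr_eq0; apply/eqP; exact: h.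
apply: ae0_test => //.
  split; first exact: measurable_funB.
  move=> K cK KU; have mK := compact_measurable_mx cK.
  rewrite (_ : _ \o _ = (EFin \o g1) \- (EFin \o g2))%E//.
  by apply: integrableB => //; [exact: ig1|exact: ig2].
move=> psi tpsi; have [spsi [K [cK KU psi0]]] := tpsi.
have cpsi : continuous psi by exact: Ck_continuous (spsi 0%N).
have [B _ psiB] := bounded_support cK cpsi psi0.
have int g : weak_partial U m f g ->
    leb.-integrable setT (EFin \o (fun x => (g \_ U) x * psi x)).
  move=> /(weak_partial_wderiv oU)[_ mg _ ig _].
  by apply: (integrable_support cK) => //;
    [exact: ig|exact: continuous_measurable_rV|exists B].
have -> : \int[leb]_(x in U) ((g1 \- g2) x * psi x) =
    \int[leb]_x ((g1 \_ U) x * psi x - (g2 \_ U) x * psi x).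
  rewrite Rintegral_patch_mul; apply: eq_Rintegral => x _.
  by rewrite !patchE; case: ifP => _; rewrite ?mul0r ?subr0// mulrBl.
rewrite RintegralB//; [|exact: int..].
have := fg1 _ tpsi; rewrite (fg2 _ tpsi) (Rintegral_patch_mul U g1) (Rintegral_patch_mul U g2).
by move=> /oppr_inj ->; rewrite subrr.
Qed.

(** [Wkinfty] only provides some bounded weak partial; by uniqueness any other one agrees with it
    a.e. and is bounded too. *)
Lemma Wkinfty_weak_partial_Linfty k U f (m : 'I_n) g : open U ->
  Wkinfty k.+1 U f -> weak_partial U m f g -> Linfty leb U g.
Proof.
move=> oU [_ /(_ m)[g' [wg' Wg']]] wg.
have [_ [mg _] _] := wg.
apply: (Linfty_ae mg (weak_partial_unique oU wg' wg)).
by case: k Wg' => [|k] [].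
Qed.

End weak_partial_ae.

Section matrix_measurability.
Context {R : realType} {m n : nat}.
Implicit Types (S : set 'M[R]_(m, n)).

Lemma measurable_fun_mx_on d (T : measurableType d) (D : set T)
    (f : T -> 'M[R]_(m, n)) : measurable D ->
  (forall i j, measurable_fun D (fun x => f x i j)) -> measurable_fun D f.
Proof.
move=> mD mf; pose g x := \matrix_(i, j) ((fun x => f x i j) \_ D) x.
apply: (@eq_measurable_fun _ _ _ _ _ g).
  by move=> x Dx; apply/matrixP => i j; rewrite mxE patchE Dx.
apply: measurable_funTS; apply: measurable_fun_mx => i j.
under eq_fun do rewrite mxE.
exact/(measurable_restrictT _ mD).
Qed.

Lemma measurable_coord_on d (T : measurableType d) (D : set T)
    (f : T -> 'M[R]_(m, n)) i j :
  measurable_fun D f -> measurable_fun D (fun x => f x i j).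
Proof. by move=> mf; exact: measurableT_comp (measurable_coord_mx i j) mf. Qed.

Lemma within_continuous_measurable S (f : 'M[R]_(m, n) -> R) : closed S ->
  {within S, continuous f} -> measurable_fun S f.
Proof.
move=> cS cf; apply: (measurability _ (RGenOpens.measurableE R)) => _ [_ [a [b ->] <-]].
have /open_subspaceP[U oU UE] : open (f @^-1` `]a, b[ : set (subspace S)).
  by move/continuousP : cf; apply; exact: interval_open.
rewrite setIC -UE; apply: measurableI; first exact: open_measurable_mx.
exact: closed_measurable_mx.
Qed.

End matrix_measurability.

(** * Regularity and measurability of functions of (x, y) and (x, y, z) *)

Section pairs.
Context {R : realType} {n ny : nat}.
Local Notation X := 'rV[R]_n.
Local Notation XY := ('rV[R]_n * 'rV[R]_ny)%type.
Local Notation XYZ := ('rV[R]_n * 'rV[R]_ny * 'M[R]_(ny, n))%type.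

(** Pairs carry the product sigma-algebra rather than one generated by open sets; f is therefore
    factored through the concatenated row vector, where measurable means Borel. *)
Lemma continuous_measurable_pair (f : XY -> R) : continuous f -> measurable_fun setT f.
Proof.
move=> cf; pose g (v : 'rV[R]_(n + ny)) := f (lsubmx v, rsubmx v).
have -> : f = g \o (fun q => row_mx q.1 q.2).
  by apply/funext => -[x y]; rewrite /g /= row_mxKl row_mxKr.
apply: measurableT_comp.
  apply: continuous_measurable_rV => v; apply: continuous_comp; last exact: cf.
  apply: (@cvg_pair _ _ _ (nbhs v) (nbhs (lsubmx v)) (nbhs (rsubmx v))).
    apply/cvg_ballP => e e0; exists (fun i j => ball (v i j) e).
      by move=> i j; exact: nbhsx_ballx.
    by move=> w vw; split => // i j; have := vw i (lshift _ j); rewrite !mxE.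
  apply/cvg_ballP => e e0; exists (fun i j => ball (v i j) e).
    by move=> i j; exact: nbhsx_ballx.
  by move=> w vw; split => // i j; have := vw i (rshift _ j); rewrite !mxE.
apply: measurable_fun_mx => i j; under eq_fun do rewrite mxE.
case: (fintype.split j) => k; apply: measurable_coord_on; [exact: measurable_fst|exact: measurable_snd].
Qed.

Lemma measurable_pair_fst (f : XY -> R) : continuous f ->
  measurable_fun setT (fun p : XYZ => f p.1).
Proof.
by move=> cf; exact: measurableT_comp (continuous_measurable_pair cf) measurable_fst.
Qed.

Lemma within_continuous_pair (S : set X) (y : X -> 'rV[R]_ny) (f : XY -> R) :
  {within S, continuous y} -> continuous f ->
  {within S, continuous (fun x => f (x, y x))}.
Proof.
move=> cy cf x; apply: (@continuous_comp _ _ _ (fun x : subspace S => (x : X, y x)) f).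
  apply: (@cvg_pair _ _ _ (nbhs (x : subspace S)) (nbhs (x : X)) (nbhs (y x))); last exact: cy.
  by apply: continuous_subspaceT => z; exact: cvg_id.
exact: cf.
Qed.

Lemma Ck_coord k (N : nat) (j : 'I_N) : Ck k (fun v : 'rV[R]_N => v 0 j).
Proof.
have Ck_id : Ck k (@id R).
  case: k => [|k]; split => //; try by move=> x; exact: cvg_id.
  move=> v; split; first by move=> x; exact: derivable_id.
  by under eq_fun do rewrite derive_id; exact: Ck_cst.
apply: (@Ck_comp_affine _ _ _ (fun v : 'rV[R]_N => v 0 j) (fun v => v 0 j) k id) => //.
  exact: coord_continuous.
by move=> h v x; rewrite !mxE.
Qed.

Lemma Ck_fst_coord k i : Ck k (fun q : XY => q.1 0 i).
Proof.
apply: (@Ck_comp_affine R XY _ fst fst k (fun v : X => v 0 i)) => //.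
  by move=> q; exact: cvg_fst.
exact: Ck_coord.
Qed.

Lemma Ck_snd_coord k i : Ck k (fun q : XY => q.2 0 i).
Proof.
apply: (@Ck_comp_affine R XY _ snd snd k (fun v : 'rV[R]_ny => v 0 i)) => //.
  by move=> q; exact: cvg_snd.
exact: Ck_coord.
Qed.

Lemma polynomial_xy_Ck k (f : XY -> R) : polynomial_xy f -> Ck k f.
Proof.
move=> [p fp]; rewrite (_ : f = fun q => mpoly.meval (row_mx q.1 q.2 0) p); last first.
  exact/funext.
apply: (@meval_closed _ _ _ (@Ck R XY k) (fun q => row_mx q.1 q.2)).
- exact: Ck_cst.
- exact: Ck_add.
- exact: Ck_mul.
move=> j; under eq_fun do rewrite mxE.
by case: (fintype.split j) => i; [exact: Ck_fst_coord|exact: Ck_snd_coord].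
Qed.

Lemma polynomial_xyz_closed (P : (XYZ -> R) -> Prop) (f : XYZ -> R) :
  polynomial_xyz f -> (forall c, P (cst c)) ->
  (forall f g, P f -> P g -> P (f \+ g)) -> (forall f g, P f -> P g -> P (f \* g)) ->
  (forall i, P (fun p => p.1.1 0 i)) -> (forall i, P (fun p => p.1.2 0 i)) ->
  (forall i j, P (fun p => p.2 i j)) -> P f.
Proof.
move=> [p fp] Pc Padd Pmul Px Py Pz.
rewrite (_ : f = fun q => mpoly.meval (row_mx (row_mx q.1.1 q.1.2) (mxvec q.2) 0) p); last first.
  exact/funext.
apply: (@meval_closed _ _ _ P (fun q => row_mx (row_mx q.1.1 q.1.2) (mxvec q.2))) => // j.
under eq_fun do rewrite mxE.
case: (fintype.split j) => [i|i].
  by under eq_fun do rewrite mxE; case: (fintype.split i).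
by case/mxvec_indexP: i => a b; under eq_fun do rewrite mxvecE.
Qed.

Lemma polynomial_xyz_measurable (f : XYZ -> R) :
  polynomial_xyz f -> measurable_fun setT f.
Proof.
move=> pf; apply: (polynomial_xyz_closed pf).
- by move=> c; exact: measurable_cst.
- by move=> ? ? ? ?; exact: measurable_funD.
- by move=> ? ? ? ?; exact: measurable_funM.
- by move=> i; apply: measurable_coord_on; exact: measurableT_comp.
- by move=> i; apply: measurable_coord_on; exact: measurableT_comp.
- by move=> i j; apply: measurable_coord_on.
Qed.

Lemma polynomial_xyz_Linfty d (T : measurableType d) (lambda : {measure set T -> \bar R})
    (D : set T) (g : T -> XYZ) (f : XYZ -> R) :
  polynomial_xyz f ->
  (forall i, Linfty lambda D (fun x => (g x).1.1 0 i)) ->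
  (forall i, Linfty lambda D (fun x => (g x).1.2 0 i)) ->
  (forall i j, Linfty lambda D (fun x => (g x).2 i j)) ->
  Linfty lambda D (f \o g).
Proof.
move=> pf gx gy gz.
apply: (polynomial_xyz_closed (P := fun f => Linfty lambda D (f \o g)) pf) => //.
- by move=> c; exact: Linfty_cst.
- by move=> ? ? ? ?; exact: Linfty_add.
- by move=> ? ? ? ?; exact: Linfty_mul.
Qed.

End pairs.

Lemma basic_semialgebraic_closed (R : realType) N (S : set 'rV[R]_N) :
  basic_semialgebraic S -> closed S.
Proof.
move=> [k [g SE]].
rewrite (_ : S = \bigcap_(i in [set: 'I_k])
    (fun x : 'rV[R]_N => mpoly.meval (x 0) (g i)) @^-1` [set r | 0 <= r]).
  apply: closed_bigI => i _; apply: preimage_closed; last exact: closed_ge.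
  move=> x _; move: x; apply: (@meval_closed _ _ _ (fun f => continuous f) id).
  - by move=> c; exact: cst_continuous.
  - by move=> f h cf ch x; apply: (@cvgD _ _ _ (nbhs x)); [exact: cf|exact: ch].
  - by move=> f h cf ch x; apply: (@cvgM _ _ (nbhs x)); [exact: cf|exact: ch].
  - by move=> j; exact: coord_continuous.
by rewrite SE; apply/seteqP; split => x /= h; [move=> i _; exact: h|move=> i; exact: h].
Qed.

(** * The divergence formula along the graph of y *)

Section total_partial.
Context {R : realType} {n ny : nat}.
Local Notation X := 'rV[R]_n.
Local Notation XY := ('rV[R]_n * 'rV[R]_ny)%type.
Local Notation XYZ := ('rV[R]_n * 'rV[R]_ny * 'M[R]_(ny, n))%type.
Implicit Types (f g : XY -> R) (m : 'I_n) (p : XYZ).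

Lemma total_partial_mul f g m p : Ck 1 f -> Ck 1 g ->
  total_partial (f \* g) m p =
  g p.1 * total_partial f m p + f p.1 * total_partial g m p.
Proof.
move=> [_ df] [_ dg].
have DM v : 'D_v (f \* g) p.1 = g p.1 * 'D_v f p.1 + f p.1 * 'D_v g p.1.
  have [dfv _] := df v; have [dgv _] := dg v.
  by rewrite (deriveM (dfv _) (dgv _)) addrC.
rewrite /total_partial DM; under eq_bigr do rewrite DM.
rewrite !mulrDr addrACA; congr (_ + _); rewrite !mulr_sumr -big_split/=.
by apply: eq_bigr => l _; rewrite scalerDr; congr (_ + _); rewrite /GRing.scale/= mulrCA.
Qed.

Lemma total_partial_mx a b (B : XY -> 'M[R]_(a, b)) m p i j :
  (forall i j, Ck 1 (fun q => B q i j)) ->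
  total_partial B m p i j = total_partial (fun q => B q i j) m p.
Proof.
move=> CB; have DB v : 'D_v B p.1 i j = 'D_v (fun q => B q i j) p.1.
  rewrite derive_mx ?mxE//; apply/derivable_mxP => i' j'.
  by have [_ /(_ v)[]] := CB i' j'.
rewrite /total_partial !mxE DB summxE; congr (_ + _); apply: eq_bigr => l _.
by rewrite mxE DB.
Qed.

Lemma total_partial0 (V : normedModType R) m p :
  total_partial (fun _ : XY => 0 : V) m p = 0.
Proof.
by rewrite /total_partial !derive_cst add0r big1// => l _; rewrite derive_cst scaler0.
Qed.

Lemma measurable_total_partial f m : Ck 1 f ->
  measurable_fun setT (total_partial f m : XYZ -> R).
Proof.
move=> [_ df]; have mD v : measurable_fun setT (fun p : XYZ => 'D_v f p.1).
  have [_ [cD _]] := df v.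
  exact: (measurable_pair_fst cD).
apply: measurable_funD => //; apply: measurable_sum => l.
by apply: measurable_funM => //; exact: measurable_coord_on.
Qed.

Section along_graph.
Context (lambda : {measure set X -> \bar R}) (S : set X).
Variables (y : X -> 'rV[R]_ny) (Dy : X -> 'M[R]_(ny, n)).
Hypotheses (cS : compact S) (cy : {within S, continuous y}).

Lemma within_continuous_Linfty (f : X -> R) :
  {within S, continuous f} -> Linfty lambda S f.
Proof.
move=> cf; split.
  by apply: within_continuous_measurable => //; exact: compact_closed.
have /compact_bounded[M [_ fM]] := continuous_compact cf cS.
by exists (M + 1); apply: aeW => x Sx; apply: fM; [rewrite ltrDl|exists x].
Qed.

Lemma Linfty_pair f : continuous f -> Linfty lambda S (fun x => f (x, y x)).
Proof.
by move=> cf; apply: within_continuous_Linfty; exact: within_continuous_pair.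
Qed.

Lemma Linfty_total_partial f m : Ck 1 f ->
  (forall l, Linfty lambda S (fun x => Dy x l m)) ->
  Linfty lambda S (fun x => total_partial f m (x, y x, Dy x)).
Proof.
move=> [_ df] LDy.
have LD v : Linfty lambda S (fun x => 'D_v f (x, y x)).
  by have [_ [cD _]] := df v; exact: (Linfty_pair cD).
apply: Linfty_add => //; apply: Linfty_sum => l _; exact: Linfty_mul.
Qed.

End along_graph.
End total_partial.

(** * The divergence formula on Omega and on its interior *)

Section divergence.
Context {R : realType} {n : nat}.
Local Notation X := 'rV[R]_n.
Local Notation leb := (@lebesgue_rV R n).
Variables (Omega : set X) (sigma : {measure set X -> \bar R}) (eta : X -> X).
Hypotheses (cOmega : compact Omega) (divE : divergence_formula Omega sigma eta).

Let clO : closed Omega.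
Proof. exact: compact_closed. Qed.

Lemma boundary_sub : boundary Omega `<=` Omega.
Proof. by move=> x [+ _]; exact: clO. Qed.

Lemma boundary_setD : boundary Omega = Omega `\` Omega°.
Proof. by rewrite /boundary -(closure_id Omega).1. Qed.

Lemma measurable_boundary : measurable (boundary Omega).
Proof.
rewrite boundary_setD; apply: measurableD; first exact: closed_measurable_mx.
exact: open_measurable_mx (@open_interior _ _).
Qed.

(** [divergence_formula] wants an integrand bounded on Omega, whereas g is known on the interior
    only, so its extension by 0 is used. All the [g i] are needed because [Wkinfty 1] asks for every
    weak partial. *)
Lemma divergence_bounded (h : X -> R) (g : 'I_n -> X -> R) (m : 'I_n) :
  {within Omega, continuous h} ->
  (forall i, weak_partial Omega° i h (g i)) ->
  (forall i, Linfty leb Omega° (g i)) ->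
  \int[sigma]_(x in boundary Omega) (h x * eta x 0 m) =
  \int[leb]_(x in Omega°) g m x.
Proof.
move=> ch hg Lg; have oO : open Omega° by exact: open_interior.
have mO := open_measurable_mx oO.
have eqT (A : set X) (f : X -> R) : A `<=` Omega° ->
    \int[leb]_(x in A) ((g m \_ Omega°) x * f x) = \int[leb]_(x in A) (g m x * f x).
  move=> AO; apply: eq_Rintegral => x /set_mem Ax.
  by rewrite patchE mem_set//; exact: AO.
rewrite (divE (g := g m \_ Omega°) ch); first last.
- have [mg [M gM]] := Lg m; split.
    by apply: measurable_funTS; apply/(measurable_restrictT _ mO).
  exists `|M|; apply: filterS gM => x gx Ox; rewrite patchE; case: ifPn => [/set_mem|_].
    by move=> /gx /le_trans; apply; exact: ler_norm.
  by rewrite [point]/(0 : R) normr0.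
- have := hg m; apply: weak_partial_ae => //.
  + by have [[]] := hg m.
  + by apply: measurable_funTS; apply/(measurable_restrictT _ mO); have [] := Lg m.
  + by apply: aeW.
  + by apply: aeW => x Ox; rewrite patchE mem_set.
- split; last by move=> i; exists (g i); split.
  apply: (@LinftyS _ _ _ _ Omega); last exact: within_continuous_Linfty.
    exact: closed_measurable_mx.
  exact: interior_subset.
by rewrite -(setIidr (@interior_subset _ Omega)) Rintegral_mkcondr setIidr//; exact: interior_subset.
Qed.

(* The indicator of the boundary is a weak partial derivative of 0 on the interior,
   so the divergence formula says that its integral over Omega vanishes. *)
Lemma lebesgue_boundary : (0 < n)%N -> leb (boundary Omega) = 0%E.
Proof.
move=> n0; pose m := Ordinal n0.
have mB := measurable_boundary.
have oO : open Omega° by exact: open_interior.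
have mO := open_measurable_mx oO.
have wp0 i : weak_partial Omega° i (cst 0) (cst 0 : X -> R).
  split; try by split; [exact: measurable_cst|move=> K cK _; exact: integrable0].
  by move=> psi _; rewrite /Rintegral; under eq_integral do rewrite mul0r;
     under [in RHS]eq_integral do rewrite mul0r; rewrite integral0 oppr0.
have := @divE (cst 0) m (\1_(boundary Omega)).
rewrite (_ : \int[sigma]_(x in boundary Omega) _ = 0); last first.
  by rewrite /Rintegral; under eq_integral do rewrite mul0r; rewrite integral0.
move=> /(_ _ _ _ _) H.
have {}H : 0 = \int[leb]_(x in Omega) (\1_(boundary Omega) x : R).
  apply: H.
  - by apply: continuous_subspaceT; exact: cst_continuous.
  - split; first exact: Linfty_cst.
    by move=> i; exists (cst 0); split; [exact: wp0|split => //; exact: Linfty_cst].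
  - apply: weak_partial_ae (wp0 m) => //; first exact: aeW.
    by apply: aeW => x Ox; rewrite indicE memNset// => -[].
  - split; first by apply: measurable_funTS; exact: measurable_indic.
    by exists 1; apply: aeW => x _; rewrite indicE; case: (_ \in _); rewrite ?normr1 ?normr0.
move: H; rewrite /Rintegral integral_indic//; last exact: closed_measurable_mx.
rewrite (setIidl boundary_sub) => /esym H.
have foo : leb (boundary Omega) \is a fin_num.
  rewrite ge0_fin_numE//; apply: le_lt_trans (lebesgue_rV_compact cOmega).
  apply: le_measure; rewrite ?inE//; [exact: closed_measurable_mx|exact: boundary_sub].
by rewrite -(fineK foo) H.
Qed.

Lemma ae_interior : (0 < n)%N -> {ae leb, forall x, Omega x -> Omega° x}.
Proof.
move=> n0; exists (boundary Omega); split.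
- exact: measurable_boundary.
- exact: lebesgue_boundary.
by rewrite boundary_setD => x /= /not_implyP.
Qed.

End divergence.

(** * Control measures along the graph *)

Section charge_occupation.
Context {R : realType} {n ny : nat}.
Local Notation X := 'rV[R]_n.
Local Notation XY := ('rV[R]_n * 'rV[R]_ny)%type.
Local Notation XYZ := ('rV[R]_n * 'rV[R]_ny * 'M[R]_(ny, n))%type.
Variables (lambda : {measure set X -> \bar R}) (S : set X) (mS : measurable S)
  (Soo : (lambda S < +oo)%E).
Variables (Y : set 'rV[R]_ny) (mY : measurable Y)
  (Z : set 'M[R]_(ny, n)) (mZ : measurable Z).
Variables (y : X -> 'rV[R]_ny) (my : measurable_fun S y)
  (Dy : X -> 'M[R]_(ny, n)) (mDy : measurable_fun S Dy).
Hypotheses (yY : forall x, S x -> Y (y x))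
  (DyZ : {ae lambda, forall x, S x -> Z (Dy x)}).
Variables (mu : {measure set XYZ -> \bar R})
  (muE : is_occupation_measure lambda S Y Z y Dy mu).

Lemma vintegral_charge_occupation (nu : {charge set XY -> \bar R}) (u : X -> R)
    N (f : XY -> 'cV[R]_N) a :
  has_density nu (xy_marginal mu) (S `*` Y) (fun q => u q.1) ->
  Linfty lambda S u -> measurable_fun setT (fun q => f q a 0) ->
  Linfty lambda S (fun x => f (x, y x) a 0) ->
  vintegral_charge nu (S `*` Y) f a 0 =
  \int[lambda]_(x in S) (f (x, y x) a 0 * u x).
Proof.
move=> nuE Lu mf Lf; have [mu_ _] := Lu.
have mSY : measurable (S `*` Y) by exact: measurableX.
have mu1 : measurable_fun (S `*` Y) (fun q : XY => u q.1).
  apply: (@measurable_comp _ _ _ _ _ _ S) => //; first by move=> _ [q [? _] <-].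
  exact: measurable_funTS measurable_fst.
have mfSY : measurable_fun (S `*` Y) (fun q => f q a 0) by exact: measurable_funTS.
rewrite /vintegral_charge !mxE (Rintegral_charge mSY _ nuE)//.
- rewrite (Rintegral_marginal mS Soo mY mZ my mDy yY DyZ muE _ _
    (g := fun q => f q a 0 * u q.1))//.
  exact: measurable_funM.
- apply: (integrable_marginal mS Soo mY mZ my mDy yY DyZ muE (g := fun q => u q.1)) => //.
  exact: Linfty_integrable.
- apply: (integrable_marginal mS Soo mY mZ my mDy yY DyZ muE
    (g := fun q => f q a 0 * u q.1)) => //; first exact: measurable_funM.
  by apply: Linfty_integrable => //; exact: Linfty_mul.
Qed.

End charge_occupation.

Lemma Linfty_common_bound d (T : measurableType d) (R : realType)
    (mu : {measure set T -> \bar R}) (D : set T) N (f : 'I_N -> T -> R) :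
  (forall i, Linfty mu D (f i)) ->
  exists2 M, 0 <= M & forall i, {ae mu, forall x, D x -> `|f i x| <= M}.
Proof.
move=> Lf; have /fin_all_exists[M fM] i := (Lf i).2.
exists (\sum_i `|M i|); first by apply: sumr_ge0.
move=> i; apply: filterS (fM i) => x fx Dx; apply: le_trans (fx Dx) _.
by rewrite (bigD1 i)//= (le_trans (ler_norm _))// lerDl sumr_ge0.
Qed.

Lemma within_continuous_interior (T : topologicalType) (U : topologicalType)
    (S : set T) (f : T -> U) z :
  {within S, continuous f} -> S° z -> {for z, continuous f}.
Proof.
move=> cf Sz; have := continuous_subspaceW (@interior_subset _ S) cf.
rewrite continuous_open_subspace; last exact: open_interior.
by apply; rewrite inE.
Qed.

Lemma Wkinfty1 (R : realType) n k (U : set 'rV[R]_n) f :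
  Wkinfty k.+1 U f -> Wkinfty 1 U f.
Proof.
move=> [Lf Wf]; split => // m; have [g [wg Wg]] := Wf m.
by exists g; split => //; split => //; case: k Wg {Wf} => [|k] [].
Qed.

(** * Integral identities for the state *)

Section state.
Context {R : realType} {n ny : nat}.
Local Notation X := 'rV[R]_n.
Local Notation XY := ('rV[R]_n * 'rV[R]_ny)%type.
Local Notation XYZ := ('rV[R]_n * 'rV[R]_ny * 'M[R]_(ny, n))%type.
Local Notation leb := (@lebesgue_rV R n).
Variables (n_gt0 : (0 < n)%N) (Omega : set X) (cO : compact Omega).
Variables (sigma : {finite_measure set X -> \bar R}) (eta : X -> X).
Hypotheses (meta : measurable_fun (boundary Omega) eta)
  (eta_normal :
    {ae sigma, forall x, boundary Omega x -> outward_unit_normal Omega x (eta x)})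
  (divE : divergence_formula Omega sigma eta).
Variables (y : X -> 'rV[R]_ny) (Dy : X -> 'M[R]_(ny, n)).
Hypotheses (yW1 : forall l, Wkinfty 1 Omega° (fun x => y x 0 l))
  (cy : {within Omega, continuous y}) (mDy : measurable_fun Omega Dy)
  (Dy_weak : forall l m,
    weak_partial Omega° m (fun x => y x 0 l) (fun x => Dy x l m)).

Let oO : open Omega°. Proof. exact: open_interior. Qed.

Let mO : measurable Omega. Proof. exact: compact_measurable_mx. Qed.

Let OO : Omega° `<=` Omega. Proof. exact: interior_subset. Qed.

Lemma Linfty_interior g : Linfty leb Omega g -> Linfty leb Omega° g.
Proof. exact: LinftyS. Qed.

Lemma integrable_interior g :
  Linfty leb Omega° g -> leb.-integrable Omega° (EFin \o g).
Proof.
have mOo := open_measurable_mx oO.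
move=> Lg; apply: Linfty_integrable => //.
by apply: le_lt_trans (lebesgue_rV_compact cO); apply: le_measure; rewrite ?inE.
Qed.

Lemma Linfty_eta m : Linfty sigma (boundary Omega) (fun x => eta x 0 m).
Proof.
split; first exact: measurable_coord_on.
exists 1; apply: filterS eta_normal => x h Bx; have [eta1 _] := h Bx.
(* A coordinate is bounded by the Euclidean norm, here 1. *)
rewrite -sqrtr_sqr -eta1 ler_wsqrtr// /dotp (bigD1 m)//= -expr2 lerDl.
by apply: sumr_ge0 => i _; rewrite -expr2 sqr_ge0.
Qed.

(** The bound from the Sobolev condition holds on the interior and passes to Omega because the
    boundary is Lebesgue null. *)
Lemma Linfty_Dy l m : Linfty leb Omega (fun x => Dy x l m).
Proof.
split; first exact: measurable_coord_on.
have [_ [M DM]] := Wkinfty_weak_partial_Linfty oO (yW1 l) (Dy_weak l m).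
exists M; apply: filterS2 DM (ae_interior cO divE n_gt0) => x DM Ox /Ox.
exact: DM.
Qed.

Lemma Linfty_Dy_interior l m : Linfty leb Omega° (fun x => Dy x l m).
Proof. exact: LinftyS (Linfty_Dy l m). Qed.

Lemma measurable_state : measurable_fun Omega y.
Proof.
apply: measurable_fun_mx_on => // i j; rewrite ord1.
apply: within_continuous_measurable; first exact: compact_closed.
move=> x; apply: (@continuous_comp _ _ _ (y : subspace Omega -> _) (fun v : 'rV_ny => v 0 j)); first exact: cy.
exact: coord_continuous.
Qed.

Lemma weak_partial_state f m : Ck 1 f ->
  weak_partial Omega° m (fun x => f (x, y x))
    (fun x => total_partial f m (x, y x, Dy x)).
Proof.
move=> Cf; have [M M0 DM] := Linfty_common_bound (fun l => Linfty_Dy_interior l m).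
apply: (weak_partial_comp oO (M := M)) => //.
by move=> z; exact: within_continuous_interior.
Qed.

Lemma Linfty_total_partial_state f m : Ck 1 f ->
  Linfty leb Omega (fun x => total_partial f m (x, y x, Dy x)).
Proof.
by move=> Cf; apply: Linfty_total_partial => // l; exact: Linfty_Dy.
Qed.

Lemma divergence_state f m : Ck 1 f ->
  \int[sigma]_(x in boundary Omega) (f (x, y x) * eta x 0 m) =
  \int[leb]_(x in Omega°) total_partial f m (x, y x, Dy x).
Proof.
move=> Cf; apply: (divergence_bounded cO divE
  (g := fun m x => total_partial f m (x, y x, Dy x))).
- by apply: within_continuous_pair => //; exact: Ck_continuous Cf.
- by move=> i; exact: weak_partial_state.
- by move=> i; apply: LinftyS (Linfty_total_partial_state i Cf).
Qed.

(** [Wkinfty 2] speaks of its own first derivative h; as [Dy] equals h a.e., g is also a weak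
    partial of h and inherits the bound. *)
Lemma Linfty_second_partial b i m g : Wkinfty 2 Omega° (fun x => y x 0 b) ->
  weak_partial Omega° m (fun x => Dy x b i) g -> Linfty leb Omega° g.
Proof.
move=> yW2 Dyg; have [_ /(_ i)[h [yh Wh]]] := yW2.
apply: (@Wkinfty_weak_partial_Linfty _ _ 0 _ h m g oO Wh).
have [_ [mh _] _] := yh; have [_ [mg _] _] := Dyg.
apply: (weak_partial_ae oO mh mg _ _ Dyg); last exact: aeW.
exact: weak_partial_unique oO (Dy_weak b i) yh.
Qed.

(** The product rule and the divergence formula need a continuous factor, so the trace
    representative h replaces the entry of [Dy] and is exchanged back a.e. on the interior and on
    the boundary. *)
Lemma divergence_state_Dy f b i j (D2 : 'I_n -> X -> R) : Ck 1 f ->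
  Wkinfty 2 Omega° (fun x => y x 0 b) -> has_trace Omega sigma (fun x => Dy x b i) ->
  (forall m, weak_partial Omega° m (fun x => Dy x b i) (D2 m)) ->
  \int[sigma]_(x in boundary Omega) (f (x, y x) * Dy x b i * eta x 0 j) =
  \int[leb]_(x in Omega°)
    (Dy x b i * total_partial f j (x, y x, Dy x) + f (x, y x) * D2 j x).
Proof.
move=> Cf yW2 [h [ch Dyh Dyhb]] DyD2.
have cf : continuous f by exact: Ck_continuous Cf.
have mOo := open_measurable_mx oO.
have mB := measurable_boundary cO.
have BO : boundary Omega `<=` Omega by exact: boundary_sub.
have ch' z : Omega° z -> {for z, continuous h} by exact: within_continuous_interior.
have mh : measurable_fun Omega° h by exact: continuous_on_measurable.
have LD2 m : Linfty leb Omega° (D2 m) by exact: Linfty_second_partial yW2 (DyD2 m).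
have hD2 m : weak_partial Omega° m h (D2 m).
  have [_ [mD2 _] _] := DyD2 m.
  by apply: (weak_partial_ae oO mh mD2 Dyh _ (DyD2 m)); exact: aeW.
have Lh : Linfty leb Omega h by exact: within_continuous_Linfty.
have Lf : Linfty leb Omega (fun x => f (x, y x)) by exact: Linfty_pair.
pose G m x := h x * total_partial f m (x, y x, Dy x) + f (x, y x) * D2 m x.
have LG m : Linfty leb Omega° (G m).
  have Lh' := Linfty_interior Lh; have Lf' := Linfty_interior Lf.
  have Lt' := Linfty_interior (Linfty_total_partial_state m Cf).
  by apply: Linfty_add; apply: Linfty_mul.
have wG m : weak_partial Omega° m (fun x => f (x, y x) * h x) (G m).
  have [_ [M1 tM]] : Linfty leb Omega° (fun x => total_partial f m (x, y x, Dy x)).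
    by apply: Linfty_interior (Linfty_total_partial_state m Cf).
  have [_ [M2 DM]] := LD2 m.
  apply: (weak_partial_mul (M := `|M1| + `|M2|) oO (weak_partial_state m Cf) (hD2 m)) => //.
  - by apply: filterS tM => x tx /tx/le_trans; apply; rewrite (le_trans (ler_norm _))// lerDl.
  - by apply: filterS DM => x Dx /Dx/le_trans; apply; rewrite (le_trans (ler_norm _))// lerDr.
  - move=> z; apply: within_continuous_interior; exact: within_continuous_pair.
have cfh : {within Omega, continuous (fun x => f (x, y x) * h x)}.
  move=> x; apply: (@cvgM _ _ (nbhs (x : subspace Omega))); last exact: ch.
  exact: (within_continuous_pair cy cf).
have := divergence_bounded cO divE j cfh wG LG.
have mb (g : X -> R) : measurable_fun Omega g -> measurable_fun (boundary Omega) g.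
  exact: measurable_funS.
have mDyb := mb _ (Linfty_Dy b i).1; have mfb := mb _ Lf.1; have mhb := mb _ Lh.1.
have [meb _] := Linfty_eta j.
rewrite (@ae_eq_Rintegral _ _ _ sigma (boundary Omega) (fun x => f (x, y x) * h x * eta x 0 j)
  (fun x => f (x, y x) * Dy x b i * eta x 0 j)) => [->|//|||]; first last.
- by apply: filterS Dyhb => x hx Bx; rewrite hx.
- by apply: measurable_funM => //; exact: measurable_funM.
- by apply: measurable_funM => //; exact: measurable_funM.
apply: ae_eq_Rintegral => //; first exact: (LG j).1.
  apply: measurable_funD; apply: measurable_funM; last exact: (LD2 j).1.
  - exact: (Linfty_Dy_interior b i).1.
  - by apply: measurable_funS (Linfty_total_partial_state j Cf).1.
  - by apply: measurable_funS Lf.1.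
by apply: filterS Dyh => x hx Ox; rewrite /G hx.
Qed.

(** The divergence identity for the product f c and the Leibniz rule; the second derivative is
    isolated so that the equation can be substituted for it. *)
Lemma second_order_integral f c b i j (D2 : 'I_n -> X -> R) :
  Ck 1 f -> Ck 1 c -> Wkinfty 2 Omega° (fun x => y x 0 b) ->
  has_trace Omega sigma (fun x => Dy x b i) ->
  (forall m, weak_partial Omega° m (fun x => Dy x b i) (D2 m)) ->
  \int[leb]_(x in Omega°) (f (x, y x) * (c (x, y x) * D2 j x)) =
  \int[sigma]_(x in boundary Omega)
     (f (x, y x) * eta x 0 j * (c (x, y x) * Dy x b i)) -
  \int[leb]_(x in Omega°)
     (f (x, y x) * (total_partial c j (x, y x, Dy x) * Dy x b i)) -
  \int[leb]_(x in Omega°)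
     (total_partial f j (x, y x, Dy x) * (c (x, y x) * Dy x b i)).
Proof.
move=> Cf Cc yW2 tr DyD2.
have Lf : Linfty leb Omega° (fun x => f (x, y x)).
  by apply: Linfty_interior; apply: Linfty_pair => //; exact: Ck_continuous Cf.
have Lc : Linfty leb Omega° (fun x => c (x, y x)).
  by apply: Linfty_interior; apply: Linfty_pair => //; exact: Ck_continuous Cc.
have Ltf := Linfty_interior (Linfty_total_partial_state j Cf).
have Ltc := Linfty_interior (Linfty_total_partial_state j Cc).
have LDy := Linfty_Dy_interior b i.
have LD2 := Linfty_second_partial yW2 (DyD2 j).
have mOo := open_measurable_mx oO.
have := divergence_state_Dy j (Ck_mul Cf Cc) yW2 tr DyD2.
rewrite [X in X = _ -> _](_ : _ = \int[sigma]_(x in boundary Omega)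
     (f (x, y x) * eta x 0 j * (c (x, y x) * Dy x b i))); last first.
  by apply: eq_Rintegral => x _ /=; ring.
move=> ->.
have Ltfc := Linfty_interior (Linfty_total_partial_state j (Ck_mul Cf Cc)).
have i1 := integrable_interior (Linfty_add (Linfty_mul LDy Ltfc) (Linfty_mul (Linfty_mul Lf Lc) LD2)).
have i2 := integrable_interior (Linfty_mul Lf (Linfty_mul Ltc LDy)).
have i3 := integrable_interior (Linfty_mul Ltf (Linfty_mul Lc LDy)).
rewrite -RintegralB//.
rewrite -RintegralB//; last exact: (integrableB mOo i1 i2).
by apply: eq_Rintegral => x _; rewrite /= total_partial_mul//=; ring.
Qed.

Variables (Y : set 'rV[R]_ny) (mY : measurable Y)
  (Z : set 'M[R]_(ny, n)) (mZ : measurable Z).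
Hypotheses (yY : forall x, Omega x -> Y (y x))
  (DyZ : {ae leb, forall x, Omega° x -> Z (Dy x)})
  (DyZ_boundary : {ae sigma, forall x, boundary Omega x -> Z (Dy x)}).
Variables (mu mub : {measure set XYZ -> \bar R})
  (muE : is_occupation_measure leb Omega Y Z y Dy mu)
  (mubE : is_occupation_measure sigma (boundary Omega) Y Z y Dy mub).

Lemma Rintegral_mu f : measurable_fun setT f ->
  \int[mu]_(p in Omega `*` Y `*` Z) f p =
  \int[leb]_(x in Omega°) f (x, y x, Dy x).
Proof.
move=> mf; rewrite (Rintegral_occupation mO _ mY mZ measurable_state mDy yY _ muE)//.
- rewrite -(@Rintegral_ae_domain _ _ leb Omega Omega°)//.
  + exact: (open_measurable_mx oO).
  + have mg : measurable_fun Omega (fun x => (x, y x, Dy x) : XYZ).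
      apply: (@eq_measurable_fun _ _ _ _ _ (graph Omega y Dy)).
        by move=> x /set_mem Ox; rewrite graphE.
      by apply: measurable_funTS; exact: (measurable_graph mO measurable_state mDy).
    exact: measurableT_comp mf mg.
  + exact: (ae_interior cO divE n_gt0).
- exact: lebesgue_rV_compact.
- by apply: filterS2 DyZ (ae_interior cO divE n_gt0) => x h Ox /Ox /h.
- exact: measurable_funTS.
Qed.

Lemma Rintegral_mub f : measurable_fun (boundary Omega `*` setT `*` setT) f ->
  \int[mub]_(p in boundary Omega `*` Y `*` Z) f p =
  \int[sigma]_(x in boundary Omega) f (x, y x, Dy x).
Proof.
have BO := boundary_sub cO; have mB := measurable_boundary cO.
move=> mf; apply: (Rintegral_occupation mB _ mY mZ _ _ _ DyZ_boundary mubE) => //.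
- by rewrite ltey_eq fin_num_measure.
- exact: measurable_funS measurable_state.
- exact: measurable_funS mDy.
- by move=> x /BO /yY.
Qed.

Lemma measurable_eta_graph m :
  measurable_fun (boundary Omega `*` setT `*` setT) (fun p : XYZ => eta p.1.1 0 m).
Proof.
have mB := measurable_boundary cO.
apply: (@measurable_comp _ _ _ _ _ _ (boundary Omega) (fun x => eta x 0 m)) => //.
- by move=> _ [p [[? _] _] <-].
- exact: measurable_coord_on.
- by apply: measurable_funTS; exact: measurableT_comp.
Qed.

Lemma first_order_identity f m : Ck 1 f ->
  \int[mu]_(p in Omega `*` Y `*` Z) total_partial f m p -
  \int[mub]_(p in boundary Omega `*` Y `*` Z) (f p.1 * eta p.1.1 0 m) = 0.
Proof.
move=> Cf; rewrite Rintegral_mu; last exact: measurable_total_partial.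
rewrite Rintegral_mub ?divergence_state ?subrr//.
have mp : measurable_fun setT (fun p : XYZ => f p.1).
  by apply: measurable_pair_fst; exact: Ck_continuous Cf.
apply: measurable_funM; first exact: measurable_funTS.
exact: measurable_eta_graph.
Qed.

Lemma second_order_vintegral N (B : XY -> 'M[R]_(N, ny)) f i j
    (D2 : 'I_n -> X -> 'cV[R]_ny) :
  Ck 1 f -> (forall a b, Ck 1 (fun q => B q a b)) ->
  (forall b, Wkinfty 2 Omega° (fun x => y x 0 b)) ->
  (forall b, has_trace Omega sigma (fun x => Dy x b i)) ->
  (forall m b, weak_partial Omega° m (fun x => Dy x b i) (fun x => D2 m x b 0)) ->
  vintegral leb Omega° (fun x => f (x, y x) *: (B (x, y x) *m D2 j x)) =
  vintegral mub (boundary Omega `*` Y `*` Z)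
    (fun p => (f p.1 * eta p.1.1 0 j) *: (B p.1 *m col i p.2)) -
  vintegral mu (Omega `*` Y `*` Z)
    (fun p => f p.1 *: (total_partial B j p *m col i p.2)) -
  vintegral mu (Omega `*` Y `*` Z)
    (fun p => total_partial f j p *: (B p.1 *m col i p.2)).
Proof.
move=> Cf CB yW2 tr DyD2; apply/colP => a; rewrite !mxE.
have mOo := open_measurable_mx oO.
have mB := measurable_boundary cO.
have BO : boundary Omega `<=` Omega by exact: boundary_sub.
have mpair (g : XY -> R) : Ck 1 g -> measurable_fun setT (fun p : XYZ => g p.1).
  by move=> Cg; apply: measurable_pair_fst; exact: Ck_continuous Cg.
have mz b : measurable_fun setT (fun p : XYZ => p.2 b i) by exact: measurable_coord_on.
have entry (M : 'M[R]_(N, ny)) (c : R) (v : 'cV[R]_ny) :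
    (c *: (M *m v)) a 0 = \sum_b c * (M a b * v b 0) by rewrite !mxE mulr_sumr.
have entryz (M : 'M[R]_(N, ny)) (c : R) (z : 'M[R]_(ny, n)) :
    (c *: (M *m col i z)) a 0 = \sum_b c * (M a b * z b i).
  by rewrite entry; apply: eq_bigr => b _; rewrite mxE.
under eq_Rintegral do rewrite entry.
under [X in _ = X - _ - _]eq_Rintegral do rewrite entryz.
under [X in _ = _ - X - _]eq_Rintegral do rewrite entryz.
under [X in _ = _ - _ - X]eq_Rintegral do rewrite entryz.
rewrite (Rintegral_mub (f := fun p => \sum_b f p.1 * eta p.1.1 0 j * (B p.1 a b * p.2 b i))); last first.
  apply: measurable_sum => b; apply: measurable_funM.
    by apply: measurable_funM; [apply: measurable_funTS; exact: mpair|exact: measurable_eta_graph].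
  by apply: measurable_funTS; apply: measurable_funM => //; exact: (mpair (fun q => B q a b)).
rewrite (Rintegral_mu (f := fun p => \sum_b f p.1 * (total_partial B j p a b * p.2 b i))); last first.
  apply: measurable_sum => b; apply: measurable_funM; first exact: mpair.
  apply: measurable_funM => //; under eq_fun do rewrite total_partial_mx//.
  exact: measurable_total_partial.
rewrite (Rintegral_mu (f := fun p => \sum_b total_partial f j p * (B p.1 a b * p.2 b i))); last first.
  apply: measurable_sum => b; apply: measurable_funM; first exact: measurable_total_partial.
  by apply: measurable_funM => //; exact: (mpair (fun q => B q a b)).
have Lf : Linfty leb Omega (fun x => f (x, y x)).
  by apply: Linfty_pair => //; exact: Ck_continuous Cf.
have LB b : Linfty leb Omega (fun x => B (x, y x) a b).
  by apply: (Linfty_pair leb cO cy (f := fun q => B q a b)); exact: Ck_continuous (CB a b).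
have Ltf := Linfty_interior (Linfty_total_partial_state j Cf).
have LtB b := Linfty_interior (Linfty_total_partial_state j (CB a b)).
have LDy b := Linfty_Dy_interior b i.
have LD2 b := Linfty_second_partial (yW2 b) (DyD2 j b).
rewrite !Rintegral_sum//=.
- rewrite -!sumrB; apply: eq_bigr => b _.
  under [X in _ = _ - X - _]eq_Rintegral do rewrite total_partial_mx//.
    exact: (second_order_integral j Cf (CB a b) (yW2 b) (tr b)
    (D2 := fun m x => D2 m x b 0) (DyD2^~ b)).
- move=> b _; apply: integrable_interior; apply: Linfty_mul => //; apply: Linfty_mul => //.
  exact: Linfty_interior (LB b).
- move=> b _; apply: integrable_interior; apply: Linfty_mul; first exact: Linfty_interior Lf.
  by apply: Linfty_mul => //; under eq_fun do rewrite total_partial_mx//; exact: LtB.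
- move=> b _; apply: Linfty_integrable => //; first by rewrite ltey_eq fin_num_measure.
  have Ls g : Linfty sigma Omega g -> Linfty sigma (boundary Omega) g by exact: LinftyS.
  apply: Linfty_mul; apply: Linfty_mul.
  + by apply: Ls; apply: Linfty_pair => //; exact: Ck_continuous Cf.
  + exact: Linfty_eta.
  + apply: Ls; apply: (Linfty_pair sigma cO cy (f := fun q => B q a b)).
    exact: Ck_continuous (CB a b).
  (* On the boundary [Dy] is bounded through its trace: it agrees a.e. with a continuous function on
     a compact set. *)
  + have [h [ch _ Dyh]] := tr b.
    have mDyb : measurable_fun (boundary Omega) (fun x => Dy x b i).
      by apply: measurable_funS (Linfty_Dy b i).1.
    apply: (Linfty_ae mDyb _ (Ls _ (within_continuous_Linfty sigma cO ch))).
    by apply: filterS Dyh => x hx Bx; rewrite hx.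
- move=> b _; apply: integrable_interior; apply: Linfty_mul; first exact: Linfty_interior Lf.
  by apply: Linfty_mul => //; exact: Linfty_interior (LB b).
Qed.

End state.

(** * Integrals of functions defined piece by piece *)

Section piecewise_integral.
Context {R : realType} d {T : measurableType d} {k : nat}.
Variables (S : 'I_k -> set T).

(* Only finitely many membership patterns occur, and each of them determines the
   piece selected by [piecewise]. *)
Let pattern (A : {set 'I_k}) : set T := [set x | forall i, S i x <-> i \in A].

Lemma piecewiseE (g : 'I_k -> R) x :
  piecewise S g x =
  \sum_(A : {set 'I_k}) \1_(pattern A) x * (if [pick i in A] is Some i then g i else 0).
Proof.
pose A0 := [set i | `[< S i x >]]%SET.
have xA0 : pattern A0 x.
  by move=> i; rewrite inE; split => [/asboolP//|/asboolP].
rewrite (bigD1 A0)//= [X in _ + X]big1 ?addr0; last first.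
  move=> A AA0; rewrite indicE memNset ?mul0r// => xA.
  by move/eqP: AA0; apply; apply/setP => i; apply/idP/idP => [/xA/xA0|/xA0/xA].
rewrite indicE mem_set// mul1r /piecewise.
by rewrite (@eq_pick _ _ (mem A0))// => i; rewrite /= inE.
Qed.

Hypothesis mS : forall i, measurable (S i).

Lemma measurable_pattern A : measurable (pattern A).
Proof.
have -> : pattern A = \bigcap_(i in [set: 'I_k]) (if i \in A then S i else ~` S i).
  apply/seteqP; split => x.
    by move=> xA i _; case: ifPn => [/xA//|iA /xA]; exact/negP.
  move=> xA i; have := xA i Logic.I; case: ifPn => iA; split => //.
by apply: fin_bigcap_measurable => // i _; case: ifP => _ //; exact: measurableC.
Qed.

Lemma measurable_piecewise d' (T' : measurableType d') (D' : set T') (h : T' -> T)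
    (g : 'I_k -> T' -> R) : measurable D' -> measurable_fun D' h ->
  (forall i, measurable_fun D' (g i)) ->
  measurable_fun D' (fun p => piecewise S (g^~ p) (h p)).
Proof.
move=> mD' mh mg; under eq_fun do rewrite piecewiseE.
apply: measurable_sum => A; apply: measurable_funM.
  by apply: measurableT_comp mh; apply: measurable_indic; exact: measurable_pattern.
by case: pickP => [i _|_]; [exact: mg|exact: measurable_cst].
Qed.

(** Off the null overlaps a point lies in exactly one piece, so the piecewise function is there the
    sum of the [g i] cut off to their pieces. *)
Lemma Rintegral_piecewise (m : {finite_measure set T -> \bar R}) (g : 'I_k -> T -> R) :
  (forall i j, i != j -> m (S i `&` S j) = 0%E) ->
  (forall i, measurable_fun (\bigcup_i S i) (g i)) ->
  (forall i, Linfty m (S i) (g i)) ->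
  \int[m]_(x in \bigcup_i S i) piecewise S (g^~ x) x =
  \sum_i \int[m]_(x in S i) g i x.
Proof.
move=> S0 mg Lg; set D := \bigcup_i S i.
have mD : measurable D by apply: fin_bigcup_measurable.
have SD i : S i `<=` D by exact: bigcup_sup.
pose G i := g i \_ (S i).
have mG i : measurable_fun D (G i).
  by apply: measurable_funTS; apply/(measurable_restrictT _ (mS i)); exact: (Lg i).1.
rewrite (@ae_eq_Rintegral _ _ _ _ _ _ (fun x => \sum_i G i x))//; first last.
- have aeS : {ae m, forall x, forall ij : 'I_k * 'I_k, ij.1 != ij.2 ->
      ~ (S ij.1 `&` S ij.2) x}.
    have := @filter_forall T ('I_k * 'I_k)%type (fun ij => [set x | ij.1 != ij.2 ->
      ~ (S ij.1 `&` S ij.2) x]) (almost_everywhere m) _; apply=> -[i j].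
    have [->|ij] := eqVneq i j; first by apply: aeW => x /eqP.
    exists (S i `&` S j); split; [exact: measurableI|exact: S0|].
    by move=> x /= /not_implyP[_] /contrapT.
  apply: filterS aeS => x Sx [i _ Six].
  have Sn j : j != i -> ~ S j x by move=> ji Sjx; apply: (Sx (j, i)).
  rewrite (bigD1 i)//= big1 ?addr0; last first.
    by move=> j ji; rewrite /G patchE memNset//; exact: Sn.
  rewrite /G patchE mem_set// /piecewise; case: pickP => [j /asboolP Sjx|/(_ i)/asboolP//].
  by have [->//|/Sn] := eqVneq j i.
- exact: measurable_sum.
- exact: measurable_piecewise.
have LG i : Linfty m D (G i).
  split => //; have [_ [M gM]] := Lg i; exists `|M|; apply: filterS gM => x gx Dx.
  rewrite /G patchE; case: ifPn => [/set_mem/gx/le_trans|_]; first by apply; exact: ler_norm.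
  by rewrite [point]/(0 : R) normr0.
rewrite Rintegral_sum//; last first.
  by move=> i _; apply: Linfty_integrable => //; rewrite ltey_eq fin_num_measure.
by apply: eq_bigr => i _; rewrite /G -Rintegral_mkcondr setIidr.
Qed.

End piecewise_integral.

(** * Decomposition of the boundary measure *)

Section pieces.
Context {R : realType} {n ny nb : nat}.
Local Notation X := 'rV[R]_n.
Local Notation XYZ := ('rV[R]_n * 'rV[R]_ny * 'M[R]_(ny, n))%type.

(** For j other than i, [mubi j] lives over S j, and over the overlap with S i it is dominated by
    [mub], which vanishes there because sigma does. So on boxes over S i only [mubi i] contributes
    to the sum. *)
Lemma piece_is_occupation_measure (sigma : {finite_measure set X -> \bar R})
    (S : 'I_nb -> set X) (Y : set 'rV[R]_ny) (Z : set 'M[R]_(ny, n))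
    (y : X -> 'rV[R]_ny) (Dy : X -> 'M[R]_(ny, n))
    (mub : {measure set XYZ -> \bar R}) (mubi : 'I_nb -> {measure set XYZ -> \bar R}) :
  (forall i, measurable (S i)) -> measurable Y -> measurable Z ->
  measurable_fun (\bigcup_i S i) y -> measurable_fun (\bigcup_i S i) Dy ->
  (forall x, (\bigcup_i S i) x -> Y (y x)) ->
  {ae sigma, forall x, (\bigcup_i S i) x -> Z (Dy x)} ->
  (forall i j, i != j -> sigma (S i `&` S j) = 0%E) ->
  is_occupation_measure sigma (\bigcup_i S i) Y Z y Dy mub ->
  (forall A, measurable A -> mub A = (\sum_i mubi i A)%E) ->
  (forall i, mubi i (~` (S i `*` Y `*` Z)) = 0%E) ->
  forall i, is_occupation_measure sigma (S i) Y Z y Dy (mubi i).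
Proof.
move=> mS mY mZ my mDy yY DyZ S0 mubO; have [_ mubE] := mubO; move=> mub_sum mubi0 i; split => // A B E mA mB mE AS BY EZ.
have mX A' B' E' : measurable A' -> measurable B' -> measurable E' ->
    measurable (A' `*` B' `*` E' : set XYZ).
  by move=> ? ? ?; apply: measurableX => //; exact: measurableX.
have SD j : S j `<=` \bigcup_i S i by exact: bigcup_sup.
have mD : measurable (\bigcup_i S i) by apply: fin_bigcup_measurable.
have mubi_le j C : measurable C -> (mubi j C <= mub C)%E.
  by move=> mC; rewrite mub_sum// (bigD1 j)//= leeDl// sume_ge0.
have overlap0 j : j != i -> mub ((S i `&` S j) `*` Y `*` Z) = 0%E.
  move=> ji; have mSij := measurableI _ _ (mS i) (mS j).
  have Doo : (sigma (\bigcup_i S i) < +oo)%E by rewrite ltey_eq fin_num_measure.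
  rewrite (occupation_measureE mD Doo mY mZ my mDy yY DyZ mubO); last exact: mX.
  apply/eqP; rewrite eq_le measure_ge0 andbT -(S0 i j); last by rewrite eq_sym.
  apply: le_measure; rewrite ?inE//; last by move=> x [_ [[]]].
  apply: measurableI => //; rewrite -[X in measurable X]setTI.
  exact: (measurable_graph mD my mDy) measurableT _ (mX _ _ _ mSij mY mZ).
have other0 j : j != i -> mubi j (A `*` B `*` E) = 0%E.
  move=> ji; apply/eqP; rewrite eq_le measure_ge0 andbT.
  rewrite -(overlap0 j ji); apply: le_trans (mubi_le j _ (mX _ _ _ (measurableI _ _ (mS i) (mS j)) mY mZ)).
  rewrite -[leRHS]add0e -(mubi0 j).
  have mW := measurableC (mX _ _ _ (mS j) mY mZ).
  have mV := mX _ _ _ (measurableI _ _ (mS i) (mS j)) mY mZ.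
  apply: le_trans (measureU2 (mubi j) mW mV).
  apply: le_measure; rewrite ?inE; [exact: mX|exact: measurableU|].
  move=> [[x v] z] [[/= Ax Bv] Ez]; have [Sjx|nSjx] := pselect (S j x).
    by right; split; [split; [split; [exact: AS|]|exact: BY]|exact: EZ].
  by left => -[[]].
have -> : mubi i (A `*` B `*` E) = mub (A `*` B `*` E).
  rewrite mub_sum; last exact: mX.
  by rewrite (bigD1 i)//= big1 ?adde0// => j ji; exact: other0.
rewrite mubE//; last by move=> x /AS /SD.
rewrite -[in RHS](setIidr (SD i)) integral_mkcondr restrict_EFin.
apply: eq_integral => x _; congr EFin; rewrite patchE; case: ifPn => // /negP xS.
by rewrite indicE memNset// => -[[/AS + _] _]; rewrite -in_setE.
Qed.

End pieces.

Lemma vintegral0 (R : realType) d (T : measurableType d) N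
    (m : {measure set T -> \bar R}) (D : set T) (f : T -> 'cV[R]_N) :
  (forall p, f p = 0) -> vintegral m D f = 0.
Proof.
move=> f0; apply/colP => a; rewrite !mxE /Rintegral.
by under eq_integral do rewrite f0 mxE; rewrite integral0.
Qed.

Lemma mulmx_col (R : pzRingType) (m n p : nat) (A : 'M[R]_(m, n)) (B : 'M[R]_(n, p))
    (v : 'cV[R]_p) i : (A *m (B *m v)) i 0 = \sum_r (A *m col r B) i 0 * v r 0.
Proof.
rewrite mulmxA mxE; apply: eq_bigr => r _; congr (_ * _).
by rewrite !mxE; apply: eq_bigr => j _; rewrite mxE.
Qed.

(** The boundary operators [G i] take values in spaces of different dimensions. The third identity
    is therefore stated after arbitrary linear maps [J i] into a common space. *)
Theorem theorem4 (R : realType) (n ny nF nu nb : nat) (nG nub : 'I_nb -> nat)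
    (n_gt0 : (0 < n)%N)
    (* domain *)
    (Omega : set 'rV[R]_n)
    (Omega_semialg : basic_semialgebraic Omega)
    (Omega_compact : compact Omega)
    (Omega_closure : Omega = closure Omega°)
    (Omega_lipschitz : lipschitz_boundary Omega)
    (sigma : {finite_measure set 'rV[R]_n -> \bar R})
    (sigmaE : is_surface_measure Omega sigma)
    (eta : 'rV[R]_n -> 'rV[R]_n)
    (eta_measurable : measurable_fun (boundary Omega) eta)
    (eta_normal :
      {ae sigma, forall x, boundary Omega x -> outward_unit_normal Omega x (eta x)})
    (Omega_divergence : divergence_formula Omega sigma eta)
    (dOmega : 'I_nb -> set 'rV[R]_n)
    (dOmega_cover : boundary Omega = \bigcup_i dOmega i)
    (dOmega_semialg : forall i, basic_semialgebraic (dOmega i))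
    (dOmega_smooth : forall i, smooth_piece (dOmega i))
    (dOmega_disjoint :
      forall i j, i != j -> sigma (dOmega i `&` dOmega j) = 0%E)
    (* constraint sets *)
    (Y : set 'rV[R]_ny) (Z : set 'M[R]_(ny, n))
    (Y_semialg : basic_semialgebraic Y)
    (Z_semialg : basic_semialgebraic (mxvec @` Z))
    (* polynomial data *)
    (F : 'rV[R]_n * 'rV[R]_ny * 'M[R]_(ny, n) -> 'cV[R]_nF)
    (B : 'I_n -> 'I_n -> 'rV[R]_n * 'rV[R]_ny -> 'M[R]_(nF, ny))
    (C : 'rV[R]_n * 'rV[R]_ny -> 'M[R]_(nF, nu))
    (G : forall i, 'rV[R]_n * 'rV[R]_ny * 'M[R]_(ny, n) -> 'cV[R]_(nG i))
    (Cb : forall i, 'rV[R]_n * 'rV[R]_ny -> 'M[R]_(nG i, nub i))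
    (F_poly : forall a, polynomial_xyz (fun p => F p a 0))
    (B_poly : forall i j : 'I_n, (i <= j)%N ->
      forall a b, polynomial_xy (fun q => B i j q a b))
    (C_poly : forall a r, polynomial_xy (fun q => C q a r))
    (G_poly : forall i a, polynomial_xyz (fun p => G i p a 0))
    (Cb_poly : forall i a r, polynomial_xy (fun q => Cb i q a r))
    (* controls *)
    (u : 'rV[R]_n -> 'cV[R]_nu)
    (u_bounded : forall r, Linfty (lebesgue_rV n) Omega (fun x => u x r 0))
    (ub : forall i, 'rV[R]_n -> 'cV[R]_(nub i))
    (ub_bounded : forall i r, Linfty sigma (dOmega i) (fun x => ub i x r 0))
    (* state *)
    (k : nat)
    (kE : k = if `[< forall i j : 'I_n, (i <= j)%N -> forall q, B i j q = 0 >]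
              then 1%N else 2%N)
    (y : 'rV[R]_n -> 'rV[R]_ny)
    (y_sobolev : forall l, Wkinfty k Omega° (fun x => y x 0 l))
    (y_continuous : {within Omega, continuous y})
    (yY : forall x, Omega x -> Y (y x))
    (Dy : 'rV[R]_n -> 'M[R]_(ny, n))
    (Dy_measurable : measurable_fun Omega Dy)
    (Dy_weak : forall l m,
      weak_partial Omega° m (fun x => y x 0 l) (fun x => Dy x l m))
    (Dy_trace : k = 2%N -> forall l m, has_trace Omega sigma (fun x => Dy x l m))
    (DyZ : {ae lebesgue_rV n, forall x, Omega° x -> Z (Dy x)})
    (DyZ_boundary : {ae sigma, forall x, boundary Omega x -> Z (Dy x)})
    (D2y : 'I_n -> 'I_n -> 'rV[R]_n -> 'cV[R]_ny)
    (D2y_weak : k = 2%N -> forall i j l,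
      weak_partial Omega° j (fun x => Dy x l i) (fun x => D2y i j x l 0))
    (* equations *)
    (pde : {ae lebesgue_rV n, forall x, Omega° x ->
      F (x, y x, Dy x) +
        \sum_(i < n) \sum_(j < n | (i <= j)%N) B i j (x, y x) *m D2y i j x =
      C (x, y x) *m u x})
    (boundary_condition : forall i, {ae sigma, forall x, dOmega i x ->
      G i (x, y x, Dy x) = Cb i (x, y x) *m ub i x})
    (* measures *)
    (mu mub : {measure set ('rV[R]_n * 'rV[R]_ny * 'M[R]_(ny, n)) -> \bar R})
    (muE : is_occupation_measure (lebesgue_rV n) Omega Y Z y Dy mu)
    (mubE : is_occupation_measure sigma (boundary Omega) Y Z y Dy mub)
    (mubi : 'I_nb ->
      {measure set ('rV[R]_n * 'rV[R]_ny * 'M[R]_(ny, n)) -> \bar R})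
    (mubi_sum : forall A, measurable A -> mub A = (\sum_(i < nb) mubi i A)%E)
    (mubi_support : forall i, mubi i (~` (dOmega i `*` Y `*` Z)) = 0%E)
    (nuu : 'I_nu -> {charge set ('rV[R]_n * 'rV[R]_ny)%type -> \bar R})
    (nuuE : forall r, has_density (nuu r) (xy_marginal mu) (Omega `*` Y)
      (fun q => u q.1 r 0))
    (nuub : forall i, 'I_(nub i) ->
      {charge set ('rV[R]_n * 'rV[R]_ny)%type -> \bar R})
    (nuubE : forall i r, has_density (nuub i r) (xy_marginal (mubi i))
      (dOmega i `*` Y) (fun q => ub i q.1 r 0))
    (* test function *)
    (phi : 'rV[R]_n * 'rV[R]_ny -> R) (phi_smooth : smooth phi) :
  [/\ forall m : 'I_n,
        \int[mu]_(p in Omega `*` Y `*` Z) total_partial phi m p -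
        \int[mub]_(p in boundary Omega `*` Y `*` Z)
          (phi p.1 * eta p.1.1 0 m) = 0,
      vintegral mu (Omega `*` Y `*` Z) (fun p => phi p.1 *: F p) -
      \sum_(i < n) \sum_(j < n | (i <= j)%N)
        vintegral mu (Omega `*` Y `*` Z)
          (fun p => phi p.1 *: (total_partial (B i j) j p *m col i p.2)) -
      \sum_(i < n) \sum_(j < n | (i <= j)%N)
        vintegral mu (Omega `*` Y `*` Z)
          (fun p => total_partial phi j p *: (B i j p.1 *m col i p.2)) +
      \sum_(i < n) \sum_(j < n | (i <= j)%N)
        vintegral mub (boundary Omega `*` Y `*` Z)
          (fun p => (phi p.1 * eta p.1.1 0 j) *: (B i j p.1 *m col i p.2)) =
      \sum_(r < nu)
        vintegral_charge (nuu r) (Omega `*` Y) (fun q => phi q *: col r (C q))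
    & forall (N : nat) (J : forall i, 'M[R]_(N, nG i)),
        vintegral mub (boundary Omega `*` Y `*` Z)
          (fun p => phi p.1 *: piecewise dOmega (fun i => J i *m G i p) p.1.1) =
        \sum_(i < nb) \sum_(r < nub i)
          vintegral_charge (nuub i r) (dOmega i `*` Y)
            (fun q => phi q *: (J i *m col r (Cb i q)))].

Proof.
have mO : measurable Omega by exact: compact_measurable_mx.
have mOo : measurable Omega° by exact: open_measurable_mx (@open_interior _ _).
have OO : Omega° `<=` Omega by exact: interior_subset.
have Ooo := lebesgue_rV_compact Omega_compact.
have mY : measurable Y by apply: closed_measurable_mx; exact: basic_semialgebraic_closed.
have mZ : measurable Z.
  (* Semialgebraic sets consist of row vectors, so Z is measured as a preimage under
     vectorization. *)
  have -> : Z = mxvec @^-1` (mxvec @` Z).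
    apply/seteqP; split => [z Zz|z [w Zw /(can_inj mxvecK) <-]//]; by exists z.
  rewrite -[X in measurable X]setTI.
  suff : measurable_fun setT (@mxvec R ny n).
    by apply => //; apply: closed_measurable_mx; exact: basic_semialgebraic_closed.
  apply: measurable_fun_mx => i j; rewrite ord1.
  case/mxvec_indexP: j => a b; under eq_fun do rewrite mxvecE.
  exact: measurable_coord_mx.
have mdO i : measurable (dOmega i).
  by apply: closed_measurable_mx; exact: basic_semialgebraic_closed.
have BO : boundary Omega `<=` Omega by exact: boundary_sub.
have mB : measurable (boundary Omega) by exact: measurable_boundary.
have dOB i : dOmega i `<=` boundary Omega by rewrite dOmega_cover; exact: bigcup_sup.
have yW1 l : Wkinfty 1 Omega° (fun x => y x 0 l).
  by move: (y_sobolev l); rewrite kE; case: ifP => _ //; exact: Wkinfty1.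
have my := measurable_state Omega_compact y_continuous.
have Cphi : Ck 1 phi by [].
have cphi : continuous phi by exact: Ck_continuous Cphi.
have CC a r : continuous (fun q => C q a r).
  exact: Ck_continuous (polynomial_xy_Ck 0 (C_poly a r)).
have aeO := ae_interior Omega_compact Omega_divergence n_gt0.
have Lr := Linfty_interior Omega_compact.
split.
- move=> m.
  exact: (first_order_identity n_gt0 Omega_compact eta_measurable
    Omega_divergence yW1 y_continuous Dy_measurable Dy_weak mY mZ yY DyZ
    DyZ_boundary muE mubE _ Cphi).
- have DyZO : {ae lebesgue_rV n, forall x, Omega x -> Z (Dy x)}.
    by apply: filterS2 DyZ aeO => x h Ox /Ox /h.
  (* For k = 1 neither traces of [Dy] nor second derivatives are available, but then every term with
     B is 0. *)
  have order_cases : (forall i j : 'I_n, (i <= j)%N -> forall q, B i j q = 0) \/ k = 2%N.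
    by move: kE; case: asboolP; [left|right].
  have term (i j : 'I_n) : (i <= j)%N ->
      vintegral (lebesgue_rV n) Omega° (fun x => phi (x, y x) *: (B i j (x, y x) *m D2y i j x)) =
      vintegral mub (boundary Omega `*` Y `*` Z)
        (fun p => (phi p.1 * eta p.1.1 0 j) *: (B i j p.1 *m col i p.2)) -
      vintegral mu (Omega `*` Y `*` Z)
        (fun p => phi p.1 *: (total_partial (B i j) j p *m col i p.2)) -
      vintegral mu (Omega `*` Y `*` Z)
        (fun p => total_partial phi j p *: (B i j p.1 *m col i p.2)).
    move=> ij; have [B0|k2] := order_cases.
      have -> : B i j = fun=> 0 by apply/funext => q; exact: B0 ij q.
      by rewrite !vintegral0 ?subr0// => p; rewrite ?total_partial0 ?mul0mx ?scaler0.
    apply: (second_order_vintegral n_gt0 Omega_compact eta_measurable eta_normal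
      Omega_divergence yW1 y_continuous Dy_measurable Dy_weak mY mZ yY DyZ
      DyZ_boundary muE mubE j (D2 := D2y i) Cphi).
    + by move=> a b; exact: polynomial_xy_Ck (B_poly _ _ ij a b).
    + by move=> b; move: (y_sobolev b); rewrite k2.
    + by move=> b; exact: Dy_trace.
    + by move=> m b; exact: D2y_weak.
  have LDy l m : Linfty (lebesgue_rV n) Omega (fun x => Dy x l m).
    exact: (Linfty_Dy n_gt0 Omega_compact Omega_divergence yW1 Dy_measurable Dy_weak).
  have Lterm (i j : 'I_n) a : (i <= j)%N -> Linfty (lebesgue_rV n) Omega°
      (fun x => (phi (x, y x) *: (B i j (x, y x) *m D2y i j x)) a 0).
    move=> ij; have [B0|k2] := order_cases.
      by under eq_fun do rewrite B0// mul0mx scaler0 mxE; exact: Linfty_cst.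
    under eq_fun do rewrite !mxE.
    apply: Linfty_mul; first by apply: Lr; exact: Linfty_pair.
    apply: Linfty_sum => b _; apply: Linfty_mul.
      apply: Lr; apply: (@Linfty_pair R n ny _ _ y _ _ (fun q => B i j q a b)) => //.
      exact: Ck_continuous (polynomial_xy_Ck 0 (B_poly _ _ ij a b)).
    apply: (Linfty_second_partial Dy_weak _ (D2y_weak k2 i j b)).
    by move: (y_sobolev b); rewrite k2.
  have LF a : Linfty (lebesgue_rV n) Omega
      (fun x => (phi (x, y x) *: F (x, y x, Dy x)) a 0).
    under eq_fun do rewrite mxE.
    apply: Linfty_mul; first exact: Linfty_pair.
    apply: (polynomial_xyz_Linfty (g := fun x => (x, y x, Dy x)) (F_poly a)) => //= i.
      apply: (@Linfty_pair R n ny _ _ y _ _ (fun q => q.1 0 i)) => //.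
      exact: Ck_continuous (Ck_fst_coord 0 i).
    apply: (@Linfty_pair R n ny _ _ y _ _ (fun q => q.2 0 i)) => //.
    exact: Ck_continuous (Ck_snd_coord 0 i).
  have -> : vintegral mu (Omega `*` Y `*` Z) (fun p => phi p.1 *: F p) =
      vintegral (lebesgue_rV n) Omega° (fun x => phi (x, y x) *: F (x, y x, Dy x)).
    apply/colP => a; rewrite !mxE.
    apply: (Rintegral_mu n_gt0 Omega_compact Omega_divergence y_continuous
      Dy_measurable mY mZ yY DyZ muE (f := fun p => (phi p.1 *: F p) a 0)).
    under eq_fun do rewrite mxE; apply: measurable_funM.
      exact: measurable_pair_fst.
    exact: polynomial_xyz_measurable.
  (* By [term], the three sums of B-terms together are the integral of phi times the second-order
     part of the equation. *)
  rewrite -addrA -addrA -[X in _ + X](_ : \sum_(i < n) \sum_(j < n | (i <= j)%N)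
      vintegral (lebesgue_rV n) Omega°
        (fun x => phi (x, y x) *: (B i j (x, y x) *m D2y i j x)) = _); last first.
    under eq_bigr => i _ do rewrite (eq_bigr _ (term i)) !sumrB.
    by rewrite !sumrB addrA addrC addrA.
  apply/colP => a; rewrite !mxE !summxE.
  under eq_bigr do rewrite summxE; under eq_bigr do under eq_bigr do rewrite mxE.
  have isum (i : 'I_n) : (lebesgue_rV n).-integrable Omega° (EFin \o (fun x => \sum_(j < n | (i <= j)%N)
      (phi (x, y x) *: (B i j (x, y x) *m D2y i j x)) a 0)).
    by apply: integrable_Rsum => // j ij; exact/integrable_interior/Lterm.
  rewrite (eq_bigr (fun i : 'I_n => \int[lebesgue_rV n]_(x in Omega°)
      (\sum_(j < n | (i <= j)%N) (phi (x, y x) *: (B i j (x, y x) *m D2y i j x)) a 0))); last first.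
    by move=> i _; rewrite Rintegral_sum// => j ij; exact/integrable_interior/Lterm.
  rewrite -Rintegral_sum//.
  have iF := integrable_interior Omega_compact (Lr _ (LF a)).
  have iS := integrable_Rsum mOo (fun i _ => isum i) (index_enum 'I_n).
  rewrite -RintegralD//.
  have LC r : Linfty (lebesgue_rV n) Omega
      (fun x => (phi (x, y x) *: col r (C (x, y x))) a 0).
    under eq_fun do rewrite !mxE.
    by apply: Linfty_mul; [exact: Linfty_pair|exact: Linfty_pair (CC a r)].
  have Lu r : Linfty (lebesgue_rV n) Omega
      (fun x => (phi (x, y x) *: col r (C (x, y x))) a 0 * u x r 0).
    exact: Linfty_mul.
  have charge r : vintegral_charge (nuu r) (Omega `*` Y) (fun q => phi q *: col r (C q)) a 0 =
      \int[lebesgue_rV n]_(x in Omega°) ((phi (x, y x) *: col r (C (x, y x))) a 0 * u x r 0).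
    rewrite (vintegral_charge_occupation mO Ooo mY mZ my Dy_measurable yY DyZO muE
      (nuuE r) (u_bounded r)).
    - by apply/esym; apply: Rintegral_ae_domain => //; exact: (Lu r).1.
    - under eq_fun do rewrite !mxE.
      by apply: measurable_funM; exact: continuous_measurable_pair.
    - exact: LC.
  under eq_bigr do rewrite charge.
  rewrite -Rintegral_sum//; last by move=> r _; exact/integrable_interior/Lr/Lu.
  apply: ae_eq_Rintegral => //.
  - apply: measurable_funD; first exact: (Lr _ (LF a)).1.
    by apply: measurable_sum => i; apply/measurable_EFinP; exact: measurable_int (isum i).
  - by apply: measurable_sum => r; exact: (Lr _ (Lu r)).1.
  (* The equation times phi, read entrywise, identifies the two integrands a.e. on the interior. *)
  apply: filterS pde => x h Ox.
  transitivity ((phi (x, y x) *: (F (x, y x, Dy x) + \sum_(i < n) \sum_(j < n | (i <= j)%N)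
      B i j (x, y x) *m D2y i j x)) a 0).
    rewrite scalerDr scaler_sumr [RHS]mxE summxE; congr (_ + _).
    by apply: eq_bigr => i _; rewrite scaler_sumr summxE.
  rewrite h// !mxE mulr_sumr; apply: eq_bigr => r _.
  by rewrite !mxE mulrA.
- move=> N J; apply/colP => a; rewrite !mxE !summxE.
  pose g i p := (phi p.1 *: (J i *m G i p)) a 0.
  (* [piecewise] commutes with scaling and with taking an entry because its default value is 0. *)
  have pwE p : (phi p.1 *: piecewise dOmega (fun i => J i *m G i p) p.1.1) a 0 =
      piecewise dOmega (g^~ p) p.1.1.
    by rewrite /piecewise; case: pickP => // _; rewrite scaler0 mxE.
  under eq_Rintegral do rewrite pwE.
  have mg i : measurable_fun setT (g i).
    rewrite (_ : g i = fun p => phi p.1 * \sum_b J i a b * G i p b 0); last first.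
      by apply/funext => p; rewrite /g !mxE.
    apply: measurable_funM.
      exact: measurable_pair_fst.
    apply: measurable_sum => b; apply: measurable_funM; first exact: measurable_cst.
    exact: polynomial_xyz_measurable.
  rewrite (Rintegral_mub Omega_compact y_continuous Dy_measurable mY mZ yY
    DyZ_boundary mubE (f := fun p => piecewise dOmega (g^~ p) p.1.1)); last first.
    apply: measurable_piecewise => //.
    - by apply: measurableX => //; exact: measurableX.
    - by apply: measurable_funTS; exact: measurableT_comp.
    - by move=> i; exact: measurable_funTS.
  have dO i : dOmega i `<=` Omega by move=> x /dOB /BO.
  have myB : measurable_fun (boundary Omega) y by exact: measurable_funS my.
  have mDyB : measurable_fun (boundary Omega) Dy by exact: measurable_funS Dy_measurable.
  have soo i : (sigma (dOmega i) < +oo)%E by rewrite ltey_eq fin_num_measure.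
  have CJ i r : continuous (fun q => (phi q *: (J i *m col r (Cb i q))) a 0).
    apply: (@Ck_continuous R _ 0); under eq_fun do rewrite !mxE.
    apply: Ck_mul; first exact: phi_smooth.
    apply: Ck_sum => b _; apply: Ck_mul; first exact: Ck_cst.
    by under eq_fun do rewrite mxE; exact: polynomial_xy_Ck.
  have LJ i r : Linfty sigma (dOmega i)
      (fun x => (phi (x, y x) *: (J i *m col r (Cb i (x, y x)))) a 0).
    exact: LinftyS mO (dO i) (Linfty_pair sigma Omega_compact y_continuous (CJ i r)).
  have Lu i r : Linfty sigma (dOmega i)
      (fun x => (phi (x, y x) *: (J i *m col r (Cb i (x, y x)))) a 0 * ub i x r 0).
    by apply: Linfty_mul.
  have gE i : {ae sigma, forall x, dOmega i x ->
      \sum_r (phi (x, y x) *: (J i *m col r (Cb i (x, y x)))) a 0 * ub i x r 0 =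
      g i (x, y x, Dy x)}.
    apply: filterS (boundary_condition i) => x h dx.
    rewrite /g h// [RHS]mxE mulmx_col mulr_sumr; apply: eq_bigr => r _.
    by rewrite mxE mulrA.
  have mgB i : measurable_fun (boundary Omega) (fun x => g i (x, y x, Dy x)).
    apply: (@eq_measurable_fun _ _ _ _ _ (g i \o graph (boundary Omega) y Dy)).
      by move=> x /set_mem Bx; rewrite /= graphE.
    apply: measurable_funTS; apply: measurableT_comp (mg i) _.
    exact: (measurable_graph mB myB mDyB).
  (* For k = 1 no bound on [Dy] is known on the boundary; the bound on [g i] comes from the boundary
     condition, whose right-hand side is bounded. *)
  have Lg i : Linfty sigma (dOmega i) (fun x => g i (x, y x, Dy x)).
    apply: (Linfty_ae _ (gE i)); last by apply: Linfty_sum => r _; exact: Lu.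
    exact: measurable_funS mB (dOB i) (mgB i).
  have -> : \int[sigma]_(x in boundary Omega)
        piecewise dOmega (g^~ (x, y x, Dy x)) (x, y x, Dy x).1.1 =
      \sum_(i < nb) \int[sigma]_(x in dOmega i) g i (x, y x, Dy x).
    rewrite dOmega_cover.
    rewrite (Rintegral_piecewise mdO (g := fun i x => g i (x, y x, Dy x)))//.
    by rewrite -dOmega_cover.
  have Omub : is_occupation_measure sigma (\bigcup_i dOmega i) Y Z y Dy mub.
    by rewrite -dOmega_cover.
  apply: eq_bigr => i _; rewrite summxE.
  (* [nuub i] has its density relative to the marginal of [mubi i], so [mubi i] itself must be known
     along the graph. *)
  have Omubi : is_occupation_measure sigma (dOmega i) Y Z y Dy (mubi i).
    apply: (piece_is_occupation_measure mdO mY mZ _ _ _ _ dOmega_disjoint Omub mubi_sum mubi_support);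
      rewrite -dOmega_cover//.
    by move=> x /BO /yY.
  have charge r : vintegral_charge (nuub i r) (dOmega i `*` Y)
      (fun q => phi q *: (J i *m col r (Cb i q))) a 0 =
      \int[sigma]_(x in dOmega i)
        ((phi (x, y x) *: (J i *m col r (Cb i (x, y x)))) a 0 * ub i x r 0).
    have myi : measurable_fun (dOmega i) y by exact: measurable_funS my.
    have mDyi : measurable_fun (dOmega i) Dy by exact: measurable_funS Dy_measurable.
    have yYi x : dOmega i x -> Y (y x) by move=> /dO /yY.
    have DyZi : {ae sigma, forall x, dOmega i x -> Z (Dy x)}.
      by apply: filterS DyZ_boundary => x h /dOB /h.
    rewrite (vintegral_charge_occupation (mdO i) (soo i) mY mZ myi mDyi yYi DyZi Omubi
      (nuubE i r) (ub_bounded i r))//.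
    exact: continuous_measurable_pair.
  under eq_bigr do rewrite charge.
  rewrite -Rintegral_sum//; last by move=> r _; exact: (Linfty_integrable (mdO i) (soo i) (Lu i r)).
  apply: ae_eq_Rintegral => //; first exact: (Lg i).1.
    by apply: measurable_sum => r; exact: (Lu i r).1.
  by apply: filterS (gE i) => x h dx; rewrite h.
Qed.
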